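(* Let $k$ be an algebraically closed field, let $H$ be a cosemisimple Hopf algebra over $k$, and let $P\le H$ be its cocenter. Then the fusion semiring $R_+(P)$, viewed as a sub-semiring of $R_+(H)$, coincides with each of the following: (a) the sub-semiring of $R_+(H)$ (additively) spanned by those $x\in\widehat H$ for which there exist $n$ and $z_1,\ldots,z_n\in\widehat H$ with $x\le (z_1\cdots z_n)(z_1\cdots z_n)^*$ in $R_+(H)$; (b) the (based) sub-semiring of $R_+(H)$ generated by those $x\in\widehat H$ for which there exists $z\in\widehat H$ with $x\le zz^*$ in $R_+(H)$.
   Context: Conventions: $k$ is an algebraically closed field. Comodules are right and finite-dimensional. A Hopf algebra is cosemisimple if its comodule category is semisimple. $\widehat H$ is the set of isomorphism classes of simple $H$-comodules. The fusion semiring $R_+(H)$ is the Grothendieck semiring of the category of $H$-comodules (addition: direct sum; multiplication: tensor product); additively it is the free commutative monoid on $\widehat H$. It has the multiplication-reversing involution $x\mapsto x^*$ given by duals, and the partial order $x\le y$ iff $y=x+z$ for some $z\in R_+(H)$. All sub-semirings are assumed based, meaning that they are the additive span of a subset of $\widehat H$; the sub-semiring generated by a set of simples is the smallest based sub-semiring containing it. For a Hopf subalgebra $P\le H$, $R_+(P)$ is embedded in $R_+(H)$ by viewing $P$-comodules as $H$-comodules. Center and cocenter: a Hopf algebra map $\pi:H\to K$ is central if $\pi(h_1)\otimes h_2=\pi(h_2)\otimes h_1$ in $K\otimes H$ for all $h\in H$ (Sweedler notation). The category of central arrows of $H$ has as objects the central maps $H\to k[\Gamma]$ with $\Gamma$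 a group, and as morphisms the commutative triangles under $H$. It has an initial object $\pi:H\to Z$, called the center of $H$. For this $\pi$ the sets $\{h\in H: \pi(h_1)\otimes h_2=1\otimes h\}$ and $\{h\in H: h_1\otimes\pi(h_2)=h\otimes 1\}$ coincide and form a Hopf subalgebra $P$ of $H$ (the Hopf kernel of $\pi$), called the cocenter of $H$. *)

(* Defs.v *)
From HB Require Import structures.
From mathcomp Require Import all_boot all_order all_algebra finmap.
From mathcomp Require Import boolp.
From mathcomp Require Import monalg.

Set Implicit Arguments.
Unset Strict Implicit.
Unset Printing Implicit Defensive.

Import GRing.Theory.

Local Open Scope ring_scope.
Local Open Scope quotient_scope.

Reserved Notation "V ⊗ W" (at level 40, left associativity).
Reserved Notation "v ⊗v w" (at level 40, left associativity).
Reserved Notation "\sweedler_ ( a , b <- t ) E"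
  (at level 36, E at level 36, a name, b name, t at level 50,
   format "\sweedler_ ( a ,  b  <-  t )  E").

Definition bilin (k : fieldType) (V W U : lmodType k) (f : V -> W -> U) :=
  (forall w, linear (f^~ w)) /\ (forall v, linear (f v)).

Section Tensor.
Variables (k : fieldType) (V W : lmodType k).
Implicit Types U : lmodType k.

(* A formal sum s stands for \sum_(p <- s) p.1 ⊗ p.2; two formal sums are
   identified when every bilinear map takes the same value on both, which is
   the universal property of the tensor product read off as a definition. *)
Definition tensor_rel (s t : seq (V * W)) : Prop :=
  forall (U : lmodType k) (f : V -> W -> U), bilin f ->
    \sum_(p <- s) f p.1 p.2 = \sum_(p <- t) f p.1 p.2.

Definition tensor_relb : rel (seq (V * W)) := fun s t => `[< tensor_rel s t >].

Fact tensor_relb_refl : reflexive tensor_relb.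
Proof. by move=> s; apply/asboolP=> U f. Qed.
Fact tensor_relb_sym : symmetric tensor_relb.
Proof.
by move=> s t; apply/asboolP/asboolP=> + U f bf => /(_ U f bf) ->.
Qed.
Fact tensor_relb_trans : transitive tensor_relb.
Proof.
move=> t s u /asboolP st /asboolP tu; apply/asboolP=> U f bf.
by rewrite st // tu.
Qed.
Canonical tensor_equiv :=
  EquivRel tensor_relb tensor_relb_refl tensor_relb_sym tensor_relb_trans.

Definition tensor := {eq_quot tensor_equiv}.
HB.instance Definition _ := Choice.on tensor.
HB.instance Definition _ := EqQuotient.on tensor.

Definition tpure (v : V) (w : W) : tensor := \pi_tensor [:: (v, w)].

Definition tlift (U : lmodType k) (f : V -> W -> U) (t : tensor) : U :=
  \sum_(p <- repr t) f p.1 p.2.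

Lemma tlift_pi U (f : V -> W -> U) s : bilin f ->
  tlift f (\pi_tensor s) = \sum_(p <- s) f p.1 p.2.
Proof.
move=> bf; rewrite /tlift; case: piP => t /eqmodP /asboolP st.
by rewrite -st.
Qed.

Lemma tensor_eqP (s t : seq (V * W)) :
  tensor_rel s t -> \pi_tensor s = \pi_tensor t.
Proof. by move=> st; apply/eqmodP/asboolP. Qed.

Lemma bilin_suml U (f : V -> W -> U) a s : bilin f ->
  \sum_(p <- [seq (a *: q.1, q.2) | q <- s]) f p.1 p.2
    = a *: \sum_(p <- s) f p.1 p.2 :> U.
Proof.
move=> [fl _]; rewrite big_map scaler_sumr; apply: eq_bigr => p _ /=.
have f0 : f 0 p.2 = 0.
  by have := fl p.2 (-1) 0 0; rewrite /= scaler0 addr0 scaleN1r addNr.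
by have := fl p.2 a p.1 0; rewrite /= f0 !addr0.
Qed.

Definition tadd (s t : tensor) : tensor := \pi_tensor (repr s ++ repr t).
Definition tscale (a : k) (t : tensor) : tensor :=
  \pi_tensor [seq (a *: p.1, p.2) | p <- repr t].
Definition topp (t : tensor) := tscale (-1) t.
Definition tzero : tensor := \pi_tensor [::].

Lemma tensor_sep (s t : tensor) :
  (forall (U : lmodType k) (f : V -> W -> U), bilin f -> tlift f s = tlift f t)
    -> s = t.
Proof.
move=> st; rewrite -[s]reprK -[t]reprK; apply: tensor_eqP => U f bf.
exact: st.
Qed.

Lemma tliftD0 U (f : V -> W -> U) s t : bilin f ->
  tlift f (tadd s t) = tlift f s + tlift f t.
Proof. by move=> bf; rewrite tlift_pi // big_cat. Qed.
Lemma tliftZ0 U (f : V -> W -> U) a t : bilin f ->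
  tlift f (tscale a t) = a *: tlift f t.
Proof. by move=> bf; rewrite tlift_pi // bilin_suml. Qed.
Lemma tlift00 U (f : V -> W -> U) : bilin f -> tlift f tzero = 0.
Proof. by move=> bf; rewrite tlift_pi // big_nil. Qed.

Fact taddA : associative tadd.
Proof. by move=> *; apply: tensor_sep => U f bf; rewrite !tliftD0 // addrA. Qed.
Fact taddC : commutative tadd.
Proof. by move=> *; apply: tensor_sep => U f bf; rewrite !tliftD0 // addrC. Qed.
Fact tadd0 : left_id tzero tadd.
Proof.
by move=> *; apply: tensor_sep => U f bf; rewrite tliftD0 // tlift00 // add0r.
Qed.
Fact taddN : left_inverse tzero topp tadd.
Proof.
move=> *; apply: tensor_sep => U f bf.
by rewrite tliftD0 // tliftZ0 // tlift00 // scaleN1r addNr.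
Qed.
HB.instance Definition _ := GRing.isZmodule.Build tensor taddA taddC tadd0 taddN.

Fact tscaleA a b t : tscale a (tscale b t) = tscale (a * b) t.
Proof. by apply: tensor_sep => U f bf; rewrite !tliftZ0 // scalerA. Qed.
Fact tscale1 : left_id 1 tscale.
Proof. by move=> *; apply: tensor_sep => U f bf; rewrite !tliftZ0 // scale1r. Qed.
Fact tscaleDr : right_distributive tscale +%R.
Proof.
move=> *; apply: tensor_sep => U f bf.
by rewrite tliftZ0 // !tliftD0 // !tliftZ0 // scalerDr.
Qed.
Fact tscaleDl t : {morph tscale^~ t : a b / a + b}.
Proof.
by move=> *; apply: tensor_sep => U f bf; rewrite tliftD0 // !tliftZ0 // scalerDl.
Qed.
HB.instance Definition _ := GRing.Zmodule_isLmodule.Build k tensor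
  tscaleA tscale1 tscaleDr tscaleDl.

End Tensor.

Notation "V ⊗ W" := (tensor V W) : type_scope.
Notation "v ⊗v w" := (tpure v w) : ring_scope.
Notation "\sweedler_ ( a , b <- t ) E" := (tlift (fun a b => E) t) : ring_scope.

Section TensorTheory.
Variables (k : fieldType) (V W : lmodType k).
Implicit Types (U : lmodType k) (t : V ⊗ W).

Lemma tliftE U (f : V -> W -> U) v w : bilin f -> tlift f (v ⊗v w) = f v w.
Proof. by move=> bf; rewrite tlift_pi // big_seq1. Qed.

Lemma tlift_linear U (f : V -> W -> U) : bilin f -> linear (tlift f).
Proof. by move=> bf a s t; rewrite -tliftZ0 // -tliftD0. Qed.

Lemma tpure_bilin : bilin (@tpure k V W).
Proof.
split=> [w | v] a x y; apply: tensor_sep => U f bf;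
  rewrite tlift_linear // !tliftE //; first by rewrite (proj1 bf).
by rewrite (proj2 bf).
Qed.

Lemma tensorE t : t = \sum_(p <- repr t) p.1 ⊗v p.2.
Proof.
apply: tensor_sep => U f bf.
have L := tlift_linear bf.
pose M : {linear V ⊗ W -> U} :=
  HB.pack (tlift f) (GRing.isLinear.Build _ _ _ _ (tlift f) L).
rewrite -[RHS]/(M _) linear_sum /=.
by apply: eq_bigr => p _; rewrite tliftE.
Qed.

Lemma tensor_ind (P : V ⊗ W -> Prop) :
  P 0 -> (forall v w t, P t -> P (v ⊗v w + t)) -> forall t, P t.
Proof.
move=> P0 PD t; rewrite [t]tensorE.
elim: (repr t) => [|p s IH]; rewrite ?big_nil // big_cons; exact: PD.
Qed.

Lemma tensor_ext U (f g : V ⊗ W -> U) : linear f -> linear g ->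
  (forall v w, f (v ⊗v w) = g (v ⊗v w)) -> f =1 g.
Proof.
move=> Lf Lg fg t.
pose F : {linear V ⊗ W -> U} :=
  HB.pack f (GRing.isLinear.Build _ _ _ _ f Lf).
pose G : {linear V ⊗ W -> U} :=
  HB.pack g (GRing.isLinear.Build _ _ _ _ g Lg).
rewrite -[f]/(F : _ -> _) -[g]/(G : _ -> _) [t]tensorE !linear_sum.
by apply: eq_bigr => p _; apply: fg.
Qed.

Lemma tlift_pure t : \sweedler_(v, w <- t) (v ⊗v w) = t.
Proof. by rewrite [RHS]tensorE. Qed.

Lemma tlift_comp U U' (g : U -> U') (f : V -> W -> U) t : linear g ->
  g (tlift f t) = \sweedler_(v, w <- t) g (f v w).
Proof.
move=> Lg; pose G : {linear U -> U'} :=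
  HB.pack g (GRing.isLinear.Build _ _ _ _ g Lg).
by rewrite -[g]/(G : _ -> _) /tlift linear_sum.
Qed.

(* no bilinearity is needed: tlift f t is a finite sum of values of f *)
Lemma tlift_fun U (f g : V -> W -> U) a t :
  \sweedler_(v, w <- t) (a *: f v w + g v w) = a *: tlift f t + tlift g t.
Proof. by rewrite /tlift scaler_sumr -big_split. Qed.

Lemma eq_tlift U (f g : V -> W -> U) t : (forall v w, f v w = g v w) ->
  tlift f t = tlift g t.
Proof. by move=> fg; apply: eq_bigr => p _; apply: fg. Qed.

End TensorTheory.

Lemma tlift_exchange (k : fieldType) (V W V' W' U : lmodType k)
    (f : V -> W -> V' -> W' -> U) (t : V ⊗ W) (s : V' ⊗ W') :
  \sweedler_(v, w <- t) \sweedler_(x, y <- s) f v w x y =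
  \sweedler_(x, y <- s) \sweedler_(v, w <- t) f v w x y.
Proof. exact: exchange_big. Qed.


Section LinearTools.
Variable k : fieldType.
Implicit Types U V W : lmodType k.

Definition pack_linear V U (f : V -> U) (Lf : linear f) : {linear V -> U} :=
  HB.pack f (GRing.isLinear.Build _ _ _ _ f Lf).

Lemma tpureDZl V W a (x y : V) (w : W) :
  (a *: x + y) ⊗v w = a *: (x ⊗v w) + y ⊗v w.
Proof. by case: (@tpure_bilin k V W) => + _; apply. Qed.
Lemma tpureDZr V W a (v : V) (x y : W) :
  v ⊗v (a *: x + y) = a *: (v ⊗v x) + v ⊗v y.
Proof. by case: (@tpure_bilin k V W) => _; apply. Qed.

Lemma linear_sumE V U (f : V -> U) I (r : seq I) (P : pred I) (F : I -> V) :
  linear f -> f (\sum_(i <- r | P i) F i) = \sum_(i <- r | P i) f (F i).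
Proof.
by move=> Lf; exact: (linear_sum (pack_linear Lf)).
Qed.
Lemma linear_ZE V U (f : V -> U) a v : linear f -> f (a *: v) = a *: f v.
Proof.
by move=> Lf; exact: (linearZ_LR (pack_linear Lf)).
Qed.
Lemma linear_0E V U (f : V -> U) : linear f -> f 0 = 0.
Proof. by move=> Lf; have := @linear_ZE _ _ f 0 0 Lf; rewrite !scale0r. Qed.

Lemma tpure_suml V W I (r : seq I) (P : pred I) (F : I -> V) (w : W) :
  (\sum_(i <- r | P i) F i) ⊗v w = \sum_(i <- r | P i) F i ⊗v w.
Proof. exact: (linear_sumE _ _ _ ((@tpure_bilin k V W).1 w)). Qed.
Lemma tpure_sumr V W I (r : seq I) (P : pred I) (F : I -> W) (v : V) :
  v ⊗v (\sum_(i <- r | P i) F i) = \sum_(i <- r | P i) v ⊗v F i.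
Proof. exact: (linear_sumE _ _ _ ((@tpure_bilin k V W).2 v)). Qed.
Lemma tpureZl V W a (v : V) (w : W) : (a *: v) ⊗v w = a *: (v ⊗v w).
Proof. exact: (linear_ZE _ _ ((@tpure_bilin k V W).1 w)). Qed.
Lemma tpureZr V W a (v : V) (w : W) : v ⊗v (a *: w) = a *: (v ⊗v w).
Proof. exact: (linear_ZE _ _ ((@tpure_bilin k V W).2 v)). Qed.

Lemma bilin_comp V W U U' (g : U -> U') (f : V -> W -> U) :
  linear g -> bilin f -> bilin (fun v w => g (f v w)).
Proof. by move=> Lg [fl fr]; split=> ? a x y /=; rewrite (fl, fr) Lg. Qed.

Lemma bilin_pre V W V' W' U (f : V -> W -> U) (g : V' -> V) (h : W' -> W) :
  bilin f -> linear g -> linear h -> bilin (fun v w => f (g v) (h w)).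
Proof.
by move=> [fl fr] Lg Lh; split=> ? a x y /=; rewrite (Lg, Lh) (fl, fr).
Qed.

Lemma bilin_swap V W U (f : V -> W -> U) : bilin f -> bilin (fun w v => f v w).
Proof. by case. Qed.

Lemma bilin_tlift V W V' W' U (F : V -> W -> V' -> W' -> U) (t : V' ⊗ W') :
  (forall x y, bilin (fun v w => F v w x y)) ->
  bilin (fun v w => tlift (F v w) t).
Proof.
move=> bF; split=> ? a x y /=; rewrite -tlift_fun; apply: eq_tlift => c d.
  exact: (bF c d).1.
exact: (bF c d).2.
Qed.

Lemma linear_tlift V W U U' (F : U' -> V -> W -> U) (t : V ⊗ W) :
  (forall x y, linear (fun u => F u x y)) -> linear (fun u => tlift (F u) t).
Proof.
move=> LF a x y; rewrite -tlift_fun; apply: eq_tlift => c d; exact: LF.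
Qed.

Lemma linear_comp V W U (g : W -> U) (f : V -> W) :
  linear g -> linear f -> linear (fun v => g (f v)).
Proof. by move=> Lg Lf a x y; rewrite Lf Lg. Qed.

Lemma linear_id V : linear (fun v : V => v). Proof. by []. Qed.

Lemma linear_scale V (a : k) : linear (fun v : V => a *: v).
Proof. by move=> b x y; rewrite scalerDr !scalerA mulrC. Qed.

Lemma linear_scalel V W (f : V -> k^o) (w : W) :
  linear f -> linear (fun v => f v *: w).
Proof. by move=> Lf a x y; rewrite Lf scalerDl scalerA. Qed.

Lemma linear_mull (A : algType k) (c : A) : linear (fun x => x * c).
Proof. by move=> a x y; rewrite mulrDl scalerAl. Qed.
Lemma linear_mulr (A : algType k) (c : A) : linear (fun x => c * x).
Proof. by move=> a x y; rewrite mulrDr scalerAr. Qed.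
Lemma bilin_mul (A : algType k) : bilin (fun x y : A => x * y).
Proof. by split=> ?; [apply: linear_mull | apply: linear_mulr]. Qed.

End LinearTools.

Section TensorPzRing.
Variables (k : fieldType) (A B : algType k).

Definition tmul (s t : A ⊗ B) : A ⊗ B :=
  \sweedler_(a, b <- s) \sweedler_(c, d <- t) ((a * c) ⊗v (b * d)).

Let bil1 c d : bilin (fun (a : A) (b : B) => (a * c) ⊗v (b * d)).
Proof.
by apply: (bilin_pre (@tpure_bilin k A B)); apply: linear_mull.
Qed.
Let bil2 a b : bilin (fun (c : A) (d : B) => (a * c) ⊗v (b * d)).
Proof.
by apply: (bilin_pre (@tpure_bilin k A B)); apply: linear_mulr.
Qed.

Lemma tmul_linearl t : linear (tmul^~ t).
Proof. by apply: tlift_linear; apply: bilin_tlift => c d; apply: bil1. Qed.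
Lemma tmul_linearr s : linear (tmul s).
Proof.
by apply: linear_tlift => a b; apply: tlift_linear; apply: bil2.
Qed.

Lemma tmulE a b c d : tmul (a ⊗v b) (c ⊗v d) = (a * c) ⊗v (b * d).
Proof.
rewrite /tmul tliftE; first by rewrite tliftE.
by apply: bilin_tlift => x y; apply: bil1.
Qed.

Fact tmulA : associative tmul.
Proof.
move=> r s t; apply: (@tensor_ext _ _ _ _ (fun r => tmul r (tmul s t))
  (fun r => tmul (tmul r s) t)); first exact: tmul_linearl.
  exact: linear_comp (tmul_linearl _) (tmul_linearl _).
move=> a b; apply: (@tensor_ext _ _ _ _ (fun s => tmul (a ⊗v b) (tmul s t))
  (fun s => tmul (tmul (a ⊗v b) s) t)).
- exact: linear_comp (tmul_linearr _) (tmul_linearl _).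
- exact: linear_comp (tmul_linearl _) (tmul_linearr _).
move=> c d; apply: (@tensor_ext _ _ _ _ (fun t => tmul _ (tmul _ t))
  (fun t => tmul (tmul _ _) t)).
- exact: linear_comp (tmul_linearr _) (tmul_linearr _).
- exact: tmul_linearr.
by move=> e f; rewrite !tmulE !mulrA.
Qed.
Fact tmul1 : left_id (1 ⊗v 1) tmul.
Proof.
apply: (@tensor_ext _ _ _ _ (tmul _) id) => [||a b].
- exact: tmul_linearr.
- exact: linear_id.
by rewrite tmulE !mul1r.
Qed.
Fact t1mul : right_id (1 ⊗v 1) tmul.
Proof.
apply: (@tensor_ext _ _ _ _ (tmul^~ _) id) => [||a b].
- exact: tmul_linearl.
- exact: linear_id.
by rewrite tmulE !mulr1.
Qed.
Fact tmulDl : left_distributive tmul +%R.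
Proof. by move=> x y t; have := tmul_linearl t 1 x y; rewrite !scale1r. Qed.
Fact tmulDr : right_distributive tmul +%R.
Proof. by move=> t x y; have := tmul_linearr t 1 x y; rewrite !scale1r. Qed.

HB.instance Definition _ := GRing.Zmodule_isPzRing.Build (A ⊗ B)
  tmulA tmul1 t1mul tmulDl tmulDr.

Lemma tensor_mulE (a c : A) (b d : B) :
  (a ⊗v b) * (c ⊗v d) = (a * c) ⊗v (b * d).
Proof. exact: tmulE. Qed.
Lemma tensor_linear_mull (t : A ⊗ B) : linear (fun s : A ⊗ B => s * t).
Proof. exact: tmul_linearl. Qed.
Lemma tensor_linear_mulr (s : A ⊗ B) : linear (fun t : A ⊗ B => s * t).
Proof. exact: tmul_linearr. Qed.

End TensorPzRing.

Section TensorVector.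
Import VectorInternalTheory.
Variables (k : fieldType) (V W : vectType k).
Local Notation m := (dim V).
Local Notation n := (dim W).

Let v2m (v : V) (w : W) : 'rV[k]_(m * n) := mxvec ((v2r v)^T *m v2r w).
Let bil_v2m : bilin v2m.
Proof.
split=> ? a x y; rewrite /v2m.
  by rewrite [v2r (_ + _)]linearP [(_ + _)^T]linearP /= mulmxDl -scalemxAl
             linearP.
by rewrite [v2r (_ + _)]linearP /= mulmxDr -scalemxAr linearP.
Qed.
Let t2r : V ⊗ W -> 'rV[k]_(m * n) := tlift v2m.
Let r2t (r : 'rV[k]_(m * n)) : V ⊗ W :=
  \sum_(i < m) \sum_(j < n)
    (vec_mx r i j) *: (r2v (delta_mx 0 i) ⊗v r2v (delta_mx 0 j)).

Let lin_t2r : linear t2r. Proof. exact: tlift_linear. Qed.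
Let lin_r2t : linear r2t.
Proof.
move=> a x y; rewrite /r2t scaler_sumr -big_split; apply: eq_bigr => i _.
rewrite scaler_sumr -big_split; apply: eq_bigr => j _ /=.
by rewrite linearP !mxE scalerDl scalerA.
Qed.
Fact tensor_vect_iso : Vector.axiom (m * n) (V ⊗ W).
Proof.
exists t2r; first exact: lin_t2r.
exists r2t.
- apply: (@tensor_ext _ _ _ _ (fun t => r2t (t2r t)) id).
  + exact: linear_comp lin_r2t lin_t2r.
  + exact: linear_id.
  move=> v w; rewrite /t2r tliftE // /r2t /v2m mxvecK.
  have vE : v = \sum_(i < m) v2r v 0 i *: r2v (delta_mx 0 i).
    rewrite -{1}[v]v2rK {1}[v2r v]row_sum_delta linear_sum.
    by apply: eq_bigr => i _; rewrite linearZ.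
  have wE : w = \sum_(j < n) v2r w 0 j *: r2v (delta_mx 0 j).
    rewrite -{1}[w]v2rK {1}[v2r w]row_sum_delta linear_sum.
    by apply: eq_bigr => i _; rewrite linearZ.
  rewrite [in RHS]vE tpure_suml; apply: eq_bigr => i _.
  rewrite [in RHS]wE tpure_sumr; apply: eq_bigr => j _.
  rewrite tpureZl tpureZr scalerA; congr (_ *: _).
  by rewrite !mxE big_ord1 !mxE.
- move=> r; rewrite /r2t (linear_sumE _ _ _ lin_t2r) -[RHS]vec_mxK.
  rewrite [X in mxvec X]matrix_sum_delta linear_sum; apply: eq_bigr => i _ /=.
  rewrite (linear_sumE _ _ _ lin_t2r) linear_sum; apply: eq_bigr => j _ /=.
  rewrite (linear_ZE _ _ lin_t2r) linearZ /= /t2r tliftE // /v2m !r2vK.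
  by rewrite trmx_delta mul_delta_mx.
Qed.
HB.instance Definition _ := Lmodule_hasFinDim.Build k (V ⊗ W) tensor_vect_iso.

End TensorVector.

HB.mixin Record isHopf (k : fieldType) H of GRing.Algebra k H := {
  comul : H -> H ⊗ H;
  counit : H -> k;
  antipode : H -> H;
  comul_linear : linear comul;
  comul_monoid_morphism : monoid_morphism comul;
  counit_linear : linear (counit : H -> k^o);
  counit_monoid_morphism : monoid_morphism counit;
  antipode_linear : linear antipode;
  comulA : forall h,
    \sweedler_(h1, h2 <- comul h) \sweedler_(a, b <- comul h1) (a ⊗v (b ⊗v h2))
    = \sweedler_(h1, h2 <- comul h) (h1 ⊗v comul h2);
  counitl : forall h, \sweedler_(h1, h2 <- comul h) (counit h1 *: h2) = h;
  counitr : forall h, \sweedler_(h1, h2 <- comul h) (counit h2 *: h1) = h;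
  antipodel : forall h,
    \sweedler_(h1, h2 <- comul h) (antipode h1 * h2) = counit h *: 1;
  antipoder : forall h,
    \sweedler_(h1, h2 <- comul h) (h1 * antipode h2) = counit h *: 1
}.

#[short(type="hopfAlgType")]
HB.structure Definition HopfAlgebra (k : fieldType) :=
  { H of isHopf k H & GRing.Algebra k H }.

(* {malg k[G]} with the convolution product; monalg has the ring structure only
   for monoids without invertible elements. *)
Definition group_algebra (k : fieldType) (G : groupType) := {malg k[G]}.

Section GroupAlgebra.
Variables (k : fieldType) (G : groupType).
Local Notation kG := (group_algebra k G).
Implicit Types U : lmodType k.

HB.instance Definition _ := GRing.Lmodule.on kG.

Definition gelt (g : G) : kG := << 1 *g g >>.

Definition galift U (f : G -> U) (x : kG) : U :=
  \sum_(g <- msupp x) x@_g *: f g.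

Lemma galiftEw U (f : G -> U) (x : kG) (d : {fset G}) : (msupp x `<=` d)%fset ->
  galift f x = \sum_(g <- d) x@_g *: f g.
Proof.
move=> xd; rewrite /galift; apply: (big_fset_incl _ xd) => g _ gx.
by rewrite mcoeff_outdom // scale0r.
Qed.

Lemma galift_linear U (f : G -> U) : linear (galift f).
Proof.
move=> a x y; pose d := (msupp x `|` msupp y `|` msupp (a *: x + y))%fset.
have [xd yd zd] : [/\ msupp x `<=` d, msupp y `<=` d
    & msupp (a *: x + y) `<=` d]%fset.
  split; apply/fsubsetP => g; rewrite !inE => ->; rewrite ?orbT //.
rewrite !(@galiftEw _ _ _ d) // scaler_sumr -big_split; apply: eq_bigr => g _.
by rewrite mcoeffD mcoeffZ scalerDl scalerA.
Qed.

Lemma galiftE U (f : G -> U) g : galift f (gelt g) = f g.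
Proof.
rewrite /galift /gelt msuppU oner_eq0 big_seq_fset1.
by rewrite mcoeffUU scale1r.
Qed.

Lemma group_algebraE (x : kG) : x = \sum_(g <- msupp x) x@_g *: gelt g.
Proof.
rewrite {1}[x]monalgE; apply: eq_bigr => g _; apply/malgP => h.
by rewrite mcoeffZ !mcoeffU mulr_natr.
Qed.

Lemma group_algebra_ext U (f f' : kG -> U) : linear f -> linear f' ->
  (forall g, f (gelt g) = f' (gelt g)) -> f =1 f'.
Proof.
move=> Lf Lf' ff' x; rewrite [x]group_algebraE.
rewrite (linear_sumE _ _ _ Lf) (linear_sumE _ _ _ Lf'); apply: eq_bigr => g _.
by rewrite (linear_ZE _ _ Lf) (linear_ZE _ _ Lf') ff'.
Qed.

Lemma linear_galift U U' (F : U' -> G -> U) (x : kG) :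
  (forall g, linear (F^~ g)) -> linear (fun u => galift (F u) x).
Proof.
move=> LF a u v; rewrite /galift scaler_sumr -big_split; apply: eq_bigr => g _.
by rewrite LF scalerDr !scalerA mulrC.
Qed.

Definition gamul (x y : kG) : kG :=
  galift (fun g => galift (fun h => gelt (g * h)%g) y) x.
Lemma gamul_linearl y : linear (gamul^~ y).
Proof. exact: galift_linear. Qed.
Lemma gamul_linearr x : linear (gamul x).
Proof. by apply: linear_galift => g; apply: galift_linear. Qed.
Lemma gamulE g h : gamul (gelt g) (gelt h) = gelt (g * h)%g.
Proof. by rewrite /gamul !galiftE. Qed.

Fact gamulA : associative gamul.
Proof.
move=> x y z; apply: (@group_algebra_ext _ (fun x => gamul x (gamul y z))
  (fun x => gamul (gamul x y) z)).
- exact: gamul_linearl.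
- exact: linear_comp (gamul_linearl _) (gamul_linearl _).
move=> g; apply: (@group_algebra_ext _ (fun y => gamul _ (gamul y z))
  (fun y => gamul (gamul _ y) z)).
- exact: linear_comp (gamul_linearr _) (gamul_linearl _).
- exact: linear_comp (gamul_linearl _) (gamul_linearr _).
move=> h; apply: (@group_algebra_ext _ (fun z => gamul _ (gamul _ z))
  (fun z => gamul (gamul _ _) z)).
- exact: linear_comp (gamul_linearr _) (gamul_linearr _).
- exact: gamul_linearr.
by move=> l; rewrite !gamulE mulgA.
Qed.
Fact ga1mul : left_id (gelt 1%g) gamul.
Proof.
apply: (@group_algebra_ext _ (gamul (gelt 1%g)) id) => [||g].
- exact: gamul_linearr.
- exact: linear_id.
by rewrite gamulE mul1g.
Qed.
Fact gamul1 : right_id (gelt 1%g) gamul.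
Proof.
apply: (@group_algebra_ext _ (gamul^~ (gelt 1%g)) id) => [||g].
- exact: gamul_linearl.
- exact: linear_id.
by rewrite gamulE mulg1.
Qed.
Fact gamulDl : left_distributive gamul +%R.
Proof. by move=> x y z; have := gamul_linearl z 1 x y; rewrite !scale1r. Qed.
Fact gamulDr : right_distributive gamul +%R.
Proof. by move=> z x y; have := gamul_linearr z 1 x y; rewrite !scale1r. Qed.
Fact ga1_neq0 : gelt 1%g != 0.
Proof. by rewrite /gelt monalgU_eq0 oner_eq0. Qed.
HB.instance Definition _ := GRing.Zmodule_isNzRing.Build kG
  gamulA ga1mul gamul1 gamulDl gamulDr ga1_neq0.
Fact gascaleAl (a : k) (x y : kG) : a *: (x * y) = (a *: x) * y.
Proof. exact/esym/(linear_ZE a x (gamul_linearl y)). Qed.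
HB.instance Definition _ := GRing.Lmodule_isLalgebra.Build k kG gascaleAl.
Fact gascaleAr (a : k) (x y : kG) : a *: (x * y) = x * (a *: y).
Proof. exact/esym/(linear_ZE a y (gamul_linearr x)). Qed.
HB.instance Definition _ := GRing.Lalgebra_isAlgebra.Build k kG gascaleAr.

Lemma geltM g h : gelt (g * h)%g = gelt g * gelt h.
Proof. by rewrite -[RHS]/(gamul _ _) gamulE. Qed.
Lemma gelt1 : gelt 1%g = 1. Proof. by []. Qed.

Definition gacomul : kG -> kG ⊗ kG := galift (fun g => gelt g ⊗v gelt g).
Definition gacounit : kG -> k := galift (fun _ => (1 : k^o)).
Definition gaantipode : kG -> kG := galift (fun g => gelt g^-1%g).

Let Lcomul : linear gacomul. Proof. exact: galift_linear. Qed.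
Let Lcounit : linear (gacounit : kG -> k^o). Proof. exact: galift_linear. Qed.
Let Lantipode : linear gaantipode. Proof. exact: galift_linear. Qed.

Fact gacomul_monoid_morphism : monoid_morphism gacomul.
Proof.
split; first by rewrite -gelt1 /gacomul galiftE.
move=> x y; apply: (@group_algebra_ext _ (fun x => gacomul (x * y))
  (fun x => gacomul x * gacomul y)).
- exact: linear_comp Lcomul (linear_mull _).
- exact: linear_comp (tensor_linear_mull _) Lcomul.
move=> g; apply: (@group_algebra_ext _ (fun y => gacomul (_ * y))
  (fun y => gacomul _ * gacomul y)).
- exact: linear_comp Lcomul (linear_mulr _).
- exact: linear_comp (tensor_linear_mulr _) Lcomul.
by move=> h; rewrite -geltM /gacomul !galiftE tensor_mulE geltM.
Qed.
Fact gacounit_monoid_morphism : monoid_morphism gacounit.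
Proof.
split; first by rewrite -gelt1 /gacounit galiftE.
move=> x y; apply: (@group_algebra_ext k^o (fun x => gacounit (x * y))
  (fun x => gacounit x * gacounit y)).
- exact: linear_comp Lcounit (linear_mull _).
- exact: linear_comp (@linear_mull k k^o _) Lcounit.
move=> g; apply: (@group_algebra_ext k^o (fun y => gacounit (_ * y))
  (fun y => gacounit _ * gacounit y)).
- exact: linear_comp Lcounit (linear_mulr _).
- exact: linear_comp (@linear_mulr k k^o _) Lcounit.
by move=> h; rewrite -geltM /gacounit !galiftE mulr1.
Qed.
Fact gacomulA h :
  \sweedler_(h1, h2 <- gacomul h)
    \sweedler_(a, b <- gacomul h1) (a ⊗v (b ⊗v h2))
  = \sweedler_(h1, h2 <- gacomul h) (h1 ⊗v gacomul h2).
Proof.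
have b1 (y : kG) : bilin (fun a b : kG => a ⊗v (b ⊗v y)).
  by split=> ? a u v; rewrite ?tpureDZl ?tpureDZr.
have b2 : bilin (fun h1 h2 : kG => \sweedler_(a, b <- gacomul h1) (a ⊗v (b ⊗v h2))).
  split=> x /=; first exact: (linear_comp (tlift_linear (b1 x)) Lcomul).
  by apply: linear_tlift => a b c u v; rewrite !tpureDZr.
have b3 : bilin (fun h1 h2 : kG => h1 ⊗v gacomul h2).
  exact: bilin_pre (@tpure_bilin _ _ _) (@linear_id _ _) Lcomul.
move: h; apply: group_algebra_ext.
- exact: linear_comp (tlift_linear b2) Lcomul.
- exact: linear_comp (tlift_linear b3) Lcomul.
by move=> g; rewrite /gacomul !galiftE !tliftE // /gacomul !galiftE ?tliftE.
Qed.
Fact gacounitl h : \sweedler_(h1, h2 <- gacomul h) (gacounit h1 *: h2) = h.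
Proof.
have b : bilin (fun h1 h2 : kG => gacounit h1 *: h2).
  by split=> ?; [exact: linear_scalel | exact: linear_scale].
move: h; apply: group_algebra_ext => [||g].
- exact: linear_comp (tlift_linear b) Lcomul.
- exact: linear_id.
by rewrite /gacomul galiftE tliftE // /gacounit galiftE scale1r.
Qed.
Fact gacounitr h : \sweedler_(h1, h2 <- gacomul h) (gacounit h2 *: h1) = h.
Proof.
have b : bilin (fun h1 h2 : kG => gacounit h2 *: h1).
  by split=> ?; [exact: linear_scale | exact: linear_scalel].
move: h; apply: group_algebra_ext => [||g].
- exact: linear_comp (tlift_linear b) Lcomul.
- exact: linear_id.
by rewrite /gacomul galiftE tliftE // /gacounit galiftE scale1r.
Qed.
Fact gaantipodel h :
  \sweedler_(h1, h2 <- gacomul h) (gaantipode h1 * h2) = gacounit h *: 1.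
Proof.
have b : bilin (fun h1 h2 : kG => gaantipode h1 * h2).
  exact: bilin_pre (bilin_mul _) Lantipode (@linear_id _ _).
move: h; apply: group_algebra_ext => [||g].
- exact: linear_comp (tlift_linear b) Lcomul.
- exact: linear_scalel.
rewrite /gacomul galiftE tliftE // /gacounit /gaantipode !galiftE.
by rewrite -geltM mulVg scale1r.
Qed.
Fact gaantipoder h :
  \sweedler_(h1, h2 <- gacomul h) (h1 * gaantipode h2) = gacounit h *: 1.
Proof.
have b : bilin (fun h1 h2 : kG => h1 * gaantipode h2).
  exact: bilin_pre (bilin_mul _) (@linear_id _ _) Lantipode.
move: h; apply: group_algebra_ext => [||g].
- exact: linear_comp (tlift_linear b) Lcomul.
- exact: linear_scalel.
rewrite /gacomul galiftE tliftE // /gacounit /gaantipode !galiftE.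
by rewrite -geltM mulgV scale1r.
Qed.
HB.instance Definition _ := isHopf.Build k kG
  Lcomul gacomul_monoid_morphism Lcounit gacounit_monoid_morphism Lantipode
  gacomulA gacounitl gacounitr gaantipodel gaantipoder.

End GroupAlgebra.

Record hopf_map (k : fieldType) (H K : hopfAlgType k) := HopfMap {
  hopf_fun :> {lrmorphism H -> K};
  hopf_comul : forall h,
    comul (hopf_fun h) =
    \sweedler_(h1, h2 <- comul h) (hopf_fun h1 ⊗v hopf_fun h2);
  hopf_counit : forall h, counit (hopf_fun h) = counit h
}.

Section Center.
Variables (k : fieldType) (H : hopfAlgType k).

Definition central (K : hopfAlgType k) (p : hopf_map H K) : Prop :=
  forall h, \sweedler_(h1, h2 <- comul h) (p h1 ⊗v h2) =
            \sweedler_(h1, h2 <- comul h) (p h2 ⊗v h1).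

Definition is_center (G : groupType) (p : hopf_map H (group_algebra k G)) : Prop :=
  central p /\
  forall (G' : groupType) (p' : hopf_map H (group_algebra k G')), central p' ->
    exists f : hopf_map (group_algebra k G) (group_algebra k G'),
      (forall h, f (p h) = p' h) /\
      (forall f' : hopf_map (group_algebra k G) (group_algebra k G'),
         (forall h, f' (p h) = p' h) -> f' =1 f).

Definition hopf_kernel (K : hopfAlgType k) (p : hopf_map H K) (h : H) : Prop :=
  \sweedler_(h1, h2 <- comul h) (p h1 ⊗v h2) = 1 ⊗v h.

End Center.

(* The cocenter, a Hopf subalgebra, is given as a Hopf algebra P with an
   embedding i : P -> H whose image is the Hopf kernel of the center. *)
Definition is_cocenter (k : fieldType) (H P : hopfAlgType k) (i : hopf_map P H) :
    Prop :=
  injective i /\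
  exists (G : groupType) (p : hopf_map H (group_algebra k G)),
    is_center p /\ forall h, (exists x, i x = h) <-> hopf_kernel p h.

Section HopfTheory.
Variables (k : fieldType) (H : hopfAlgType k).
Local Notation S := (@antipode k H).
Local Notation Delta := (@comul k H).

Lemma comulM (x y : H) : comul (x * y) = comul x * comul y.
Proof. exact: (@comul_monoid_morphism k H).2. Qed.
Lemma comul1 : comul (1 : H) = 1 ⊗v 1.
Proof. exact: (@comul_monoid_morphism k H).1. Qed.
Lemma counitM (x y : H) : counit (x * y) = counit x * counit y.
Proof. exact: (@counit_monoid_morphism k H).2. Qed.
Lemma counit1 : counit (1 : H) = 1.
Proof. exact: (@counit_monoid_morphism k H).1. Qed.

Let bp V W := @tpure_bilin k V W.
Let LD := @comul_linear k H.
Let Le := @counit_linear k H.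
Let LS := @antipode_linear k H.

Lemma comulA_lift (U : lmodType k) (F : H -> H -> H -> U) h :
  (forall z, bilin (fun x y => F x y z)) ->
  (forall x, bilin (fun y z => F x y z)) ->
  \sweedler_(h1, h2 <- comul h) \sweedler_(a, b <- comul h1) F a b h2 =
  \sweedler_(h1, h2 <- comul h) \sweedler_(a, b <- comul h2) F h1 a b.
Proof.
move=> Fl Fr; pose f (x : H) (t : H ⊗ H) := \sweedler_(a, b <- t) F x a b.
have bf : bilin f.
  split=> [t | x]; first by apply: linear_tlift => a b; apply: (Fl b).1.
  exact: tlift_linear.
have /(congr1 (tlift f)) := comulA h.
rewrite (tlift_comp _ _ (tlift_linear bf)) => E.
transitivity (\sweedler_(h1, h2 <- comul h) f h1 (comul h2)); last by [].
rewrite (tlift_comp _ _ (tlift_linear bf)) in E.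
transitivity (\sweedler_(h1, h2 <- comul h)
    tlift f (\sweedler_(a, b <- comul h1) (a ⊗v (b ⊗v h2)))).
  apply: eq_tlift => x y; rewrite (tlift_comp _ _ (tlift_linear bf)).
  by apply: eq_tlift => a b; rewrite tliftE // /f tliftE.
by rewrite E; apply: eq_tlift => x y; rewrite tliftE.
Qed.

Lemma counit_antipode h : counit (S h) = counit h.
Proof.
have /(congr1 (counit : H -> k^o)) := antipodel h.
rewrite (tlift_comp _ _ Le) (linear_ZE _ _ Le) counit1 [_ *: _]mulr1 => <-.
rewrite -{1}[h]counitr (tlift_comp _ _ LS) [LHS](tlift_comp _ _ Le).
apply: (@eq_tlift k H H k^o) => a b.
by rewrite (linear_ZE _ _ LS) counitM mulrC; apply: (linear_ZE _ _ Le).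
Qed.

(* the antipode reverses the comultiplication *)
Lemma comul_antipode h :
  comul (S h) = \sweedler_(h1, h2 <- comul h) (S h2 ⊗v S h1).
Proof.
pose B (x : H) : H ⊗ H := \sweedler_(a, b <- comul x) (S b ⊗v S a).
have bB : bilin (fun a b : H => S b ⊗v S a).
  by apply: bilin_swap; apply: bilin_pre (bp _ _) LS LS.
have LB : linear B by apply: linear_comp (tlift_linear bB) LD.
have BmulT : bilin (fun s t : H ⊗ H => s * t).
  by split=> t; [apply: tensor_linear_mull | apply: tensor_linear_mulr].
pose L x := comul (S x).
have LL : linear L by apply: linear_comp LD LS.
have SD x : \sweedler_(a, b <- comul x) (L a * comul b) = counit x *: (1 : H ⊗ H).
  rewrite -[1 in RHS]comul1 -(linear_ZE _ _ LD) -antipodel (tlift_comp _ _ LD).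
  by apply: eq_tlift => a b; rewrite comulM.
have DB x : \sweedler_(a, b <- comul x) (comul a * B b) = counit x *: (1 : H ⊗ H).
  (* sum x1 S(x4) ⊗ x2 S(x3) *)
  pose G (y : H) (a b : H) : H ⊗ H := comul y * (S b ⊗v S a).
  have bG1 y : bilin (G y).
    by apply: bilin_comp (tensor_linear_mulr _) bB.
  have bG2 b : bilin (fun y a => G y a b).
    apply: bilin_pre BmulT LD _.
    by apply: linear_comp ((bp _ _).2 _) LS.
  transitivity (\sweedler_(h1, h2 <- comul x)
      \sweedler_(a, b <- comul h2) G h1 a b).
    apply: eq_tlift => y z.
    by rewrite /B (tlift_comp _ _ (tensor_linear_mulr _)).
  rewrite -comulA_lift //.
  have E y z : \sweedler_(a, b <- comul y) G a b z =
      \sweedler_(a, b <- comul y) ((a * S z) ⊗v (counit b *: 1)).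
    pose F (a b c : H) : H ⊗ H := (a * S z) ⊗v (b * S c).
    transitivity (\sweedler_(h1, h2 <- comul y)
        \sweedler_(a, b <- comul h1) F a b h2).
      apply: eq_tlift => u v; rewrite /G -{1}[comul u]tlift_pure.
      rewrite (tlift_comp _ _ (tensor_linear_mull _)).
      by apply: eq_tlift => a b; rewrite tensor_mulE.
    rewrite comulA_lift.
    - apply: eq_tlift => u v; rewrite -antipoder.
      by rewrite (tlift_comp _ _ ((bp _ _).2 _)).
    - by move=> w; apply: bilin_pre (bp _ _) _ _; apply: linear_mull.
    - move=> u; apply: bilin_comp ((bp _ _).2 _) _.
      exact: bilin_pre (@bilin_mul k H) (@linear_id _ _) LS.
  transitivity (\sweedler_(y, z <- comul x) ((y * S z) ⊗v (1 : H))).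
    apply: eq_tlift => y z; rewrite E -{2}[y]counitr.
    rewrite (tlift_comp _ _ (@linear_mull k H (S z))).
    rewrite (tlift_comp _ _ ((bp _ _).1 _)); apply: eq_tlift => a b.
    by rewrite -scalerAl tpureZl tpureZr.
  by rewrite -(tlift_comp _ _ ((bp _ _).1 _)) antipoder tpureZl.
pose F (x y z : H) : H ⊗ H := L x * comul y * B z.
have b1 z : bilin (fun x y => F x y z).
  apply: bilin_comp (tensor_linear_mull _) _.
  exact: bilin_pre BmulT LL LD.
have b2 x : bilin (fun y z => F x y z).
  rewrite /F; split=> [z | y].
    exact: linear_comp (tensor_linear_mull _)
      (linear_comp (tensor_linear_mulr _) LD).
  exact: linear_comp (tensor_linear_mulr _) LB.
have := comulA_lift h b1 b2; rewrite -/(B h) -/(L h) => E.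
transitivity (\sweedler_(h1, h2 <- comul h)
    \sweedler_(a, b <- comul h2) F h1 a b).
  rewrite -{1}[h]counitr (tlift_comp _ _ LL); apply: eq_tlift => x y.
  rewrite (linear_ZE _ _ LL) -[X in _ *: X]mulr1.
  rewrite -(linear_ZE _ _ (tensor_linear_mulr (L x))) -DB.
  rewrite (tlift_comp _ _ (tensor_linear_mulr (L x))).
  by apply: eq_tlift => a b; rewrite /F mulrA.
rewrite -E -{2}[h]counitl (tlift_comp _ _ LB); apply: eq_tlift => x y.
rewrite (linear_ZE _ _ LB) -[X in _ = _ *: X]mul1r.
rewrite -(linear_ZE _ _ (tensor_linear_mull (B y))) -SD.
by rewrite (tlift_comp _ _ (tensor_linear_mull (B y))).
Qed.

End HopfTheory.

Record comodule (k : fieldType) (H : hopfAlgType k) := Comodule {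
  comod_space :> vectType k;
  coact : {linear comod_space -> comod_space ⊗ H};
  coactA : forall v,
    \sweedler_(v0, h <- coact v) \sweedler_(w, a <- coact v0) (w ⊗v (a ⊗v h))
    = \sweedler_(v0, h <- coact v) (v0 ⊗v comul h);
  coact_counit : forall v, \sweedler_(v0, h <- coact v) (counit h *: v0) = v
}.
Arguments coact {k H} _.

Section Comodules.
Variables (k : fieldType) (H : hopfAlgType k).
Implicit Types V W : comodule H.

Let bp A B := @tpure_bilin k A B.
Let LD := @comul_linear k H.
Let Le := @counit_linear k H.
Let LS := @antipode_linear k H.

Definition comod_hom V W (f : V -> W) : Prop :=
  linear f /\
  forall v, coact W (f v) = \sweedler_(v0, h <- coact V v) (f v0 ⊗v h).

Definition comod_iso V W : Prop :=
  exists2 f : V -> W, comod_hom f & bijective f.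

Lemma coact_linear V : linear (coact V).
Proof. exact: linearP. Qed.

Let lin_counit (V : lmodType k) (v : V) : linear (fun h : H => counit h *: v).
Proof. exact: (@linear_scalel k H V _ v Le). Qed.
Let bil_counit (V : lmodType k) : bilin (fun (v : V) (h : H) => counit h *: v).
Proof. by split=> ?; [apply: linear_scale | apply: lin_counit]. Qed.
Let bil_comul (V : lmodType k) : bilin (fun (v : V) (h : H) => v ⊗v comul h).
Proof. exact: bilin_pre (bp _ _) (@linear_id _ _) LD. Qed.
Let bil_assoc (V : lmodType k) (h : H) :
  bilin (fun (w : V) (a : H) => w ⊗v (a ⊗v h)).
Proof. by split=> ? a u v; rewrite ?tpureDZl ?tpureDZr. Qed.
Let bil_rho (V : lmodType k) (rho : V -> V ⊗ H) : linear rho ->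
  bilin (fun (v : V) (h : H) => \sweedler_(w, a <- rho v) (w ⊗v (a ⊗v h))).
Proof.
move=> Lr; split=> [h | v] /=.
  exact: (@linear_comp k _ _ _ _ _ (tlift_linear (@bil_assoc V h)) Lr).
by apply: linear_tlift => w a b x y; rewrite !tpureDZr.
Qed.
Let bil_map (A B : lmodType k) (f : A -> B) : linear f ->
  bilin (fun (v : A) (h : H) => f v ⊗v h).
Proof. by move=> Lf; apply: bilin_pre (bp _ _) Lf (@linear_id _ _). Qed.

Section Zero.
Let rho (v : 'rV[k]_0) : 'rV[k]_0 ⊗ H := 0.
Let rhoL : linear rho.
Proof. by move=> a x y; rewrite /rho scaler0 addr0. Qed.
Let rhoA v :
  \sweedler_(v0, h <- rho v) \sweedler_(w, a <- rho v0) (w ⊗v (a ⊗v h))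
  = \sweedler_(v0, h <- rho v) (v0 ⊗v comul h).
Proof.
have t0 (V : lmodType k) (t : 'rV[k]_0 ⊗ V) : t = 0.
  elim/tensor_ind: t => // v0 w t ->.
  by rewrite [v0]thinmx0 -[X in X ⊗v _](scale0r (0 : 'rV[k]_0)) tpureZl scale0r
             addr0.
by rewrite [LHS]t0 [RHS]t0.
Qed.
Let rho1 v : \sweedler_(v0, h <- rho v) (counit h *: v0) = v.
Proof. by rewrite [LHS]thinmx0 [RHS]thinmx0. Qed.
Definition comod0 : comodule H :=
  @Comodule k H 'rV[k]_0 (pack_linear rhoL) rhoA rho1.
End Zero.

Section Unit.
Let rho (v : k^o) : k^o ⊗ H := v ⊗v 1.
Let rhoL : linear rho. Proof. exact: (bp _ _).1. Qed.
Let rhoA v :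
  \sweedler_(v0, h <- rho v) \sweedler_(w, a <- rho v0) (w ⊗v (a ⊗v h))
  = \sweedler_(v0, h <- rho v) (v0 ⊗v comul h).
Proof.
have b := bil_rho rhoL.
by rewrite /rho !tliftE // comul1.
Qed.
Let rho1 v : \sweedler_(v0, h <- rho v) (counit h *: v0) = v.
Proof. by rewrite /rho tliftE // counit1 scale1r. Qed.
Definition comod1 : comodule H :=
  @Comodule k H k^o (pack_linear rhoL) rhoA rho1.

Lemma coact1E (a : k^o) : coact comod1 a = a ⊗v 1. Proof. by []. Qed.
End Unit.

Section Sum.
Variables V W : comodule H.
Let inV (v : V) : V * W := (v, 0).
Let inW (w : W) : V * W := (0, w).
Let LinV : linear inV.
Proof. by move=> a x y; congr (_, _); rewrite /= scaler0 addr0. Qed.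
Let LinW : linear inW.
Proof. by move=> a x y; congr (_, _); rewrite /= scaler0 addr0. Qed.
Let bV := bil_map LinV.
Let bW := bil_map LinW.
Let rho (u : V * W) : (V * W)%type ⊗ H :=
  \sweedler_(v, h <- coact V u.1) ((v, 0) ⊗v h) +
  \sweedler_(w, h <- coact W u.2) ((0, w) ⊗v h).
Let rhoV v : rho (inV v) = \sweedler_(v, h <- coact V v) (inV v ⊗v h).
Proof.
by rewrite /rho /= linear0 [X in _ + X](linear_0E (tlift_linear bW)) addr0.
Qed.
Let rhoW w : rho (inW w) = \sweedler_(w, h <- coact W w) (inW w ⊗v h).
Proof.
by rewrite /rho /= linear0 [X in X + _](linear_0E (tlift_linear bV)) add0r.
Qed.
Let rhoL : linear rho.
Proof.
move=> a x y; rewrite /rho /= !linearP /= (tlift_linear bV) (tlift_linear bW).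
by rewrite scalerDr addrACA.
Qed.
Let inVW (u : V * W) : u = inV u.1 + inW u.2.
Proof. by case: u => v w; congr (_, _); rewrite /= ?addr0 ?add0r. Qed.
Let sum_ext (U : lmodType k) (f g : V * W -> U) : linear f -> linear g ->
  (forall v, f (inV v) = g (inV v)) -> (forall w, f (inW w) = g (inW w)) ->
  f =1 g.
Proof.
move=> Lf Lg fgV fgW u; rewrite [u]inVW -[inV _]scale1r.
by rewrite Lf Lg fgV fgW.
Qed.
Let brho : bilin (fun (v : V * W) (h : H) =>
    \sweedler_(w, a <- rho v) (w ⊗v (a ⊗v h))).
Proof. exact: bil_rho rhoL. Qed.
(* (j ⊗ id) transports coassociativity along an inclusion j *)
Let incl (X : comodule H) (j : X -> V * W) (x : X) : linear j ->
  (forall x, rho (j x) = \sweedler_(x0, h <- coact X x) (j x0 ⊗v h)) ->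
  \sweedler_(v0, h <- rho (j x)) \sweedler_(w, a <- rho v0) (w ⊗v (a ⊗v h))
  = \sweedler_(v0, h <- rho (j x)) (v0 ⊗v comul h).
Proof.
move=> Lj rj; have bj := bil_map Lj.
rewrite !rj !(tlift_comp _ _ (tlift_linear _)) //.
have bjj : bilin (fun (w : X) (t : H ⊗ H) => j w ⊗v t).
  exact: bilin_pre (bp _ _) Lj (@linear_id _ _).
have /(congr1 (tlift (fun (w : X) (t : H ⊗ H) => j w ⊗v t))) := coactA x.
rewrite !(tlift_comp _ _ (tlift_linear bjj)).
under [X in X = _ -> _]eq_tlift => y h.
  rewrite (tlift_comp _ _ (tlift_linear bjj)).
  under eq_tlift do rewrite tliftE //.
  over.
under [X in _ = X -> _]eq_tlift do rewrite tliftE //.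
move=> E; transitivity (\sweedler_(v, w <- coact X x)
    \sweedler_(v0, w0 <- coact X v) (j v0 ⊗v (w0 ⊗v w))); last first.
  by rewrite E; apply: eq_tlift => v h; rewrite tliftE.
apply: eq_tlift => v h; rewrite tliftE // rj (tlift_comp _ _ (tlift_linear _)) //.
by apply: eq_tlift => y a; rewrite tliftE.
Qed.
Let rhoA v :
  \sweedler_(v0, h <- rho v) \sweedler_(w, a <- rho v0) (w ⊗v (a ⊗v h))
  = \sweedler_(v0, h <- rho v) (v0 ⊗v comul h).
Proof.
move: v; apply: sum_ext => [||v|w].
- exact: linear_comp (tlift_linear brho) rhoL.
- exact: linear_comp (tlift_linear (bil_comul _)) rhoL.
- exact: incl.
- exact: incl.
Qed.
Let rho1 v : \sweedler_(v0, h <- rho v) (counit h *: v0) = v.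
Proof.
have incl1 (X : comodule H) (j : X -> V * W) (x : X) : linear j ->
  (forall x, rho (j x) = \sweedler_(x0, h <- coact X x) (j x0 ⊗v h)) ->
  \sweedler_(v0, h <- rho (j x)) (counit h *: v0) = j x.
  move=> Lj rj; rewrite rj (tlift_comp _ _ (tlift_linear _)) //.
  rewrite -[in RHS](coact_counit x) (tlift_comp _ _ Lj).
  apply: eq_tlift => y h; rewrite tliftE // (linear_ZE _ _ Lj) //.
move: v; apply: sum_ext => [||v|w].
- exact: linear_comp (tlift_linear (bil_counit _)) rhoL.
- exact: linear_id.
- exact: incl1.
- exact: incl1.
Qed.
Definition comod_sum : comodule H :=
  @Comodule k H (V * W)%type (pack_linear rhoL) rhoA rho1.

Lemma coact_sumE (u : V * W) :
  coact comod_sum u =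
  \sweedler_(v, h <- coact V u.1) (((v, 0) : V * W) ⊗v h) +
  \sweedler_(w, h <- coact W u.2) (((0, w) : V * W) ⊗v h).
Proof. by []. Qed.
End Sum.


Section Tensor.
Variables V W : comodule H.

(* s, t |-> \sum (v ⊗ w) ⊗ m a b for s = \sum v ⊗ a and t = \sum w ⊗ b *)
Let mix (A : lmodType k) (m : A -> A -> A) (s : V ⊗ A) (t : W ⊗ A) :
    (V ⊗ W) ⊗ A :=
  \sweedler_(v, a <- s) \sweedler_(w, b <- t) ((v ⊗v w) ⊗v m a b).
Let bil_mix (A : lmodType k) (m : A -> A -> A) : bilin m -> bilin (mix m).
Proof.
move=> bm; split=> [t | s].
  apply: tlift_linear; apply: bilin_tlift => w b.
  exact: bilin_pre (bp _ _) ((bp _ _).1 _) (bm.1 _).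
apply: linear_tlift => v a; apply: tlift_linear.
exact: bilin_pre (bp _ _) ((bp _ _).2 _) (bm.2 _).
Qed.
Let mixE (A : lmodType k) (m : A -> A -> A) v a w b : bilin m ->
  mix m (v ⊗v a) (w ⊗v b) = (v ⊗v w) ⊗v m a b.
Proof.
move=> bm; rewrite /mix tliftE.
  by rewrite tliftE //; apply: bilin_pre (bp _ _) ((bp _ _).2 _) (bm.2 _).
apply: bilin_tlift => x y.
exact: bilin_pre (bp _ _) ((bp _ _).1 _) (bm.1 _).
Qed.
Let mH (a b : H) := a * b.
Let mHH (a b : H ⊗ H) := a * b.
Let bmH : bilin mH. Proof. exact: bilin_mul. Qed.
Let bmHH : bilin mHH.
Proof. by split=> t; [apply: tensor_linear_mull | apply: tensor_linear_mulr]. Qed.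

Let rho0 (v : V) (w : W) : (V ⊗ W) ⊗ H :=
  \sweedler_(v0, a <- coact V v) \sweedler_(w0, b <- coact W w)
    ((v0 ⊗v w0) ⊗v (a * b)).
Let rho (t : V ⊗ W) : (V ⊗ W) ⊗ H := tlift rho0 t.
Let brho0 : bilin rho0.
Proof. exact: bilin_pre (bil_mix bmH) (@coact_linear V) (@coact_linear W). Qed.
Let rhoL : linear rho. Proof. exact: tlift_linear. Qed.
Let rhoA t :
  \sweedler_(v0, h <- rho t) \sweedler_(w, a <- rho v0) (w ⊗v (a ⊗v h))
  = \sweedler_(v0, h <- rho t) (v0 ⊗v comul h).
Proof.
move: t; apply: tensor_ext => [||v w].
- exact: linear_comp (tlift_linear (bil_rho rhoL)) rhoL.
- exact: linear_comp (tlift_linear (bil_comul _)) rhoL.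
have bK := bil_mix bmHH.
pose X (Z : comodule H) (z : Z) :=
  \sweedler_(z0, h <- coact Z z) \sweedler_(y, a <- coact Z z0)
    (y ⊗v (a ⊗v h)).
pose Y (Z : comodule H) (z : Z) := \sweedler_(z0, h <- coact Z z) (z0 ⊗v comul h).
have XY Z z : X Z z = Y Z z by exact: coactA.
transitivity (mix mHH (X V v) (X W w)).
  rewrite /rho tliftE // /rho0.
  rewrite (tlift_comp _ _ (tlift_linear (bil_rho rhoL))).
  rewrite /X (tlift_comp _ _ (bK.1 _)); apply: eq_tlift => v0 a.
  rewrite (tlift_comp _ _ (tlift_linear (bil_rho rhoL))).
  rewrite (tlift_comp _ _ (bK.1 _)).
  under [RHS]eq_tlift do rewrite (tlift_comp _ _ (bK.2 _)).
  rewrite [RHS]tlift_exchange; apply: eq_tlift => w0 b.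
  rewrite tliftE; last exact: (bil_rho rhoL).
  rewrite /rho tliftE // /rho0 (tlift_comp _ _ (tlift_linear (bil_assoc _ _))).
  apply: eq_tlift => v1 a1.
  rewrite (tlift_comp _ _ (tlift_linear (bil_assoc _ _))) (tlift_comp _ _ (bK.2 _)).
  by apply: eq_tlift => w1 b1; rewrite tliftE // mixE // /mHH tensor_mulE.
rewrite !XY /Y /rho tliftE // /rho0 (tlift_comp _ _ (bK.1 _)).
rewrite (tlift_comp _ _ (tlift_linear (bil_comul _))).
apply: eq_tlift => v0 a; rewrite (tlift_comp _ _ (bK.2 _)).
rewrite (tlift_comp _ _ (tlift_linear (bil_comul _))).
by apply: eq_tlift => w0 b; rewrite tliftE // mixE // comulM.
Qed.
Let rho1 t : \sweedler_(v0, h <- rho t) (counit h *: v0) = t.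
Proof.
move: t; apply: tensor_ext => [||v w].
- exact: linear_comp (tlift_linear (bil_counit _)) rhoL.
- exact: linear_id.
rewrite /rho tliftE // /rho0 (tlift_comp _ _ (tlift_linear (bil_counit _))).
rewrite -[in RHS](coact_counit v) (tlift_comp _ _ ((bp _ _).1 _)).
apply: eq_tlift => v0 a; rewrite (tlift_comp _ _ (tlift_linear (bil_counit _))).
rewrite -[in RHS](coact_counit w) (tlift_comp _ _ ((bp _ _).2 _)).
apply: eq_tlift => w0 b; rewrite tliftE // counitM tpureZl tpureZr scalerA.
by [].
Qed.
Definition comod_tensor : comodule H :=
  @Comodule k H (V ⊗ W) (pack_linear rhoL) rhoA rho1.

Lemma coact_tensorE (v : V) (w : W) :
  coact comod_tensor (v ⊗v w) =
  \sweedler_(v0, a <- coact V v) \sweedler_(w0, b <- coact W w)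
    ((v0 ⊗v w0) ⊗v (a * b)).
Proof. exact: tliftE brho0. Qed.
End Tensor.

Section Dual.
Variable V : comodule H.
Local Notation n := (\dim {:V}).
Let e (i : 'I_n) : V := (vbasis {:V})`_i.
Let e' (i : 'I_n) : 'Hom(V, k^o) := linfun (coord (vbasis {:V}) i : V -> k^o).

Let e'E i v : e' i v = coord (vbasis {:V}) i v. Proof. by rewrite lfunE. Qed.
Let eE v : v = \sum_i (e' i v : k) *: e i.
Proof.
rewrite {1}(coord_vbasis (memvf v)).
by apply: eq_bigr => i _; rewrite e'E.
Qed.

(* the matrix coefficient f(v_0) v_1 *)
Definition mcoef (f : 'Hom(V, k^o)) (v : V) : H :=
  \sweedler_(v0, h <- coact V v) ((f v0 : k) *: h).

Let bil_f (f : 'Hom(V, k^o)) (U : lmodType k) :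
  bilin (fun (v : V) (u : U) => (f v : k) *: u).
Proof.
split=> ?; last exact: linear_scale.
by apply: linear_scalel => a x y; rewrite linearP.
Qed.
Lemma mcoef_bilin : bilin mcoef.
Proof.
split=> [v | f].
  apply: linear_tlift => v0 h a f g.
  by rewrite add_lfunE scale_lfunE scalerDl scalerA.
exact: linear_comp (tlift_linear (bil_f f H)) (@coact_linear V).
Qed.
Let LmcR f := mcoef_bilin.2 f.
Let LmcL v := mcoef_bilin.1 v.

Let comul_mcoef f v :
  comul (mcoef f v) = \sum_i mcoef f (e i) ⊗v mcoef (e' i) v.
Proof.
rewrite /mcoef (tlift_comp _ _ LD).
have bfHH := bil_f f (H ⊗ H).
transitivity (tlift (fun (v0 : V) (t : H ⊗ H) => (f v0 : k) *: t)
    (\sweedler_(v0, h <- coact V v) (v0 ⊗v comul h))).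
  rewrite (tlift_comp _ _ (tlift_linear bfHH)).
  by apply: eq_tlift => v0 h; rewrite tliftE // (linear_ZE _ _ LD).
rewrite -coactA (tlift_comp _ _ (tlift_linear bfHH)).
transitivity (\sweedler_(v0, h <- coact V v) (mcoef f v0 ⊗v h)).
  apply: eq_tlift => v0 h; rewrite (tlift_comp _ _ (tlift_linear bfHH)).
  rewrite /mcoef (tlift_comp _ _ ((bp _ _).1 h)).
  by apply: eq_tlift => w a; rewrite tliftE // tpureZl.
transitivity (\sweedler_(v0, h <- coact V v)
    \sum_i mcoef f (e i) ⊗v ((e' i v0 : k) *: h)).
  apply: eq_tlift => v0 h; rewrite {1}[v0]eE (linear_sumE _ _ _ (LmcR f)).
  rewrite tpure_suml; apply: eq_bigr => i _.
  by rewrite (linear_ZE _ _ (LmcR f)) tpureZl tpureZr.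
rewrite [LHS]exchange_big; apply: eq_bigr => i _.
by rewrite (tlift_comp _ _ ((bp _ _).2 _)).
Qed.

Let counit_mcoef f v : counit (mcoef f v) = f v.
Proof.
rewrite /mcoef [LHS](tlift_comp _ _ Le) -[in RHS](coact_counit v).
have Lf : linear f by move=> a x y; rewrite linearP.
rewrite (tlift_comp _ _ Lf).
apply: (@eq_tlift k V H k^o) => v0 h.
rewrite [LHS](linear_ZE _ _ Le) (linear_ZE _ _ Lf).
exact: mulrC.
Qed.

(* f |-> f_0 ⊗ f_1 with f_0(v) f_1 = f(v_0) S(v_1) *)
Let rho (f : 'Hom(V, k^o)) : 'Hom(V, k^o) ⊗ H :=
  \sum_i e' i ⊗v antipode (mcoef f (e i)).
Let rhoL : linear rho.
Proof.
move=> a f g; rewrite /rho scaler_sumr -big_split; apply: eq_bigr => i _.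
by rewrite LmcL LS tpureDZr.
Qed.
Let rhoA f :
  \sweedler_(v0, h <- rho f) \sweedler_(w, a <- rho v0) (w ⊗v (a ⊗v h))
  = \sweedler_(v0, h <- rho f) (v0 ⊗v comul h).
Proof.
rewrite [in LHS]/rho (linear_sumE _ _ _ (tlift_linear (bil_rho rhoL))).
rewrite [in RHS]/rho (linear_sumE _ _ _ (tlift_linear (bil_comul _))).
have bS : bilin (fun a b : H => antipode b ⊗v antipode a).
  by apply: bilin_swap; apply: bilin_pre (bp _ _) LS LS.
under eq_bigr => i _.
  rewrite tliftE; last exact: (bil_rho rhoL).
  rewrite /rho (linear_sumE _ _ _ (tlift_linear (bil_assoc _ _))).
  under eq_bigr do rewrite tliftE //.
  over.
rewrite exchange_big; apply: eq_bigr => j _ /=.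
rewrite tliftE; last exact: bil_comul.
rewrite comul_antipode comul_mcoef.
rewrite (linear_sumE _ _ _ (tlift_linear bS)) tpure_sumr.
by apply: eq_bigr => i _; rewrite tliftE.
Qed.
Let rho1 f : \sweedler_(v0, h <- rho f) (counit h *: v0) = f.
Proof.
rewrite /rho (linear_sumE _ _ _ (tlift_linear (bil_counit _))).
under eq_bigr do rewrite tliftE // counit_antipode counit_mcoef.
apply/lfunP => v; rewrite sum_lfunE [v in RHS]eE linear_sum.
by apply: eq_bigr => i _; rewrite scale_lfunE linearZ /=; apply: mulrC.
Qed.
Definition comod_dual : comodule H :=
  @Comodule k H 'Hom(V, k^o) (pack_linear rhoL) rhoA rho1.

Lemma coact_dualE f v :
  tlift (fun (f0 : 'Hom(V, k^o)) h => (f0 v : k) *: h) (coact comod_dual f) =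
  antipode (mcoef f v).
Proof.
have bev : bilin (fun (f0 : 'Hom(V, k^o)) (h : H) => (f0 v : k) *: h).
  split=> ?; last exact: linear_scale.
  by apply: linear_scalel => a x y; rewrite add_lfunE scale_lfunE.
rewrite [coact _ _]/(rho f) /rho (linear_sumE _ _ _ (tlift_linear bev)).
rewrite [v in RHS]eE (linear_sumE _ _ _ (LmcR f)) (linear_sumE _ _ _ LS).
apply: eq_bigr => i _.
by rewrite tliftE // (linear_ZE _ _ (LmcR f)) (linear_ZE _ _ LS).
Qed.

Lemma dual_sep (s t : 'Hom(V, k^o) ⊗ H) :
  (forall v, tlift (fun (f : 'Hom(V, k^o)) h => (f v : k) *: h) s =
             tlift (fun (f : 'Hom(V, k^o)) h => (f v : k) *: h) t) -> s = t.
Proof.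
have bev v : bilin (fun (f0 : 'Hom(V, k^o)) (h : H) => (f0 v : k) *: h).
  split=> ?; last exact: linear_scale.
  by apply: linear_scalel => a x y; rewrite add_lfunE scale_lfunE.
pose F (t : 'Hom(V, k^o) ⊗ H) :=
  \sum_i e' i ⊗v tlift (fun (f : 'Hom(V, k^o)) h => (f (e i) : k) *: h) t.
have FE t0 : F t0 = t0.
  move: t0; apply: tensor_ext => [a x y||f h]; last 1 first.
  - rewrite /F -[in RHS](_ : \sum_i (f (e i) : k) *: e' i = f).
      rewrite tpure_suml; apply: eq_bigr => i _.
      by rewrite tliftE // tpureZl tpureZr.
    apply/lfunP => v; rewrite sum_lfunE [v in RHS]eE linear_sum.
    by apply: eq_bigr => i _; rewrite scale_lfunE linearZ /=; apply: mulrC.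
  - rewrite /F scaler_sumr -big_split; apply: eq_bigr => i _.
    by rewrite (tlift_linear (bev _)) tpureDZr.
  - exact: linear_id.
by move=> st; rewrite -[s]FE -[t]FE /F; apply: eq_bigr => i _; rewrite st.
Qed.

End Dual.

End Comodules.

Section Pushforward.
Variables (k : fieldType) (P H : hopfAlgType k) (i : hopf_map P H).
Variable V : comodule P.

Let Li : linear i. Proof. exact: linearP. Qed.
Let bi : bilin (fun (v : V) (p : P) => v ⊗v i p).
Proof. exact: bilin_pre (@tpure_bilin k V H) (@linear_id _ _) Li. Qed.
Let rho (v : V) : V ⊗ H := \sweedler_(v0, p <- coact V v) (v0 ⊗v i p).
Let rhoL : linear rho.
Proof. exact: linear_comp (tlift_linear bi) (@coact_linear k P V). Qed.
Let bas (h : H) : bilin (fun (w : V) (a : H) => w ⊗v (a ⊗v h)).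
Proof. by split=> ? a u v; rewrite ?tpureDZl ?tpureDZr. Qed.
Let rhoA v :
  \sweedler_(v0, h <- rho v) \sweedler_(w, a <- rho v0) (w ⊗v (a ⊗v h))
  = \sweedler_(v0, h <- rho v) (v0 ⊗v comul h).
Proof.
have brho : bilin (fun (v : V) (h : H) =>
    \sweedler_(w, a <- rho v) (w ⊗v (a ⊗v h))).
  split=> [h | x] /=.
    exact: (@linear_comp k _ _ _ _ _ (tlift_linear (bas h)) rhoL).
  by apply: linear_tlift => w a c x' y; rewrite !tpureDZr.
have bii : bilin (fun a b : P => i a ⊗v i b).
  exact: bilin_pre (@tpure_bilin k H H) Li Li.
pose ii := tlift (fun a b : P => i a ⊗v i b).
have bV : bilin (fun (w : V) (t : P ⊗ P) => w ⊗v ii t).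
  exact: bilin_pre (@tpure_bilin k V _) (@linear_id _ _) (tlift_linear bii).
have bc : bilin (fun (v : V) (h : H) => v ⊗v comul h).
  exact: bilin_pre (@tpure_bilin k V _) (@linear_id _ _) (@comul_linear k H).
have /(congr1 (tlift (fun w t => w ⊗v ii t))) := coactA v.
rewrite !(tlift_comp _ _ (tlift_linear bV)) => E.
rewrite {2}/rho (tlift_comp _ _ (tlift_linear brho)).
rewrite [in RHS]/rho (tlift_comp _ _ (tlift_linear bc)).
transitivity (\sweedler_(v0, w <- coact V v)
    tlift (fun w t => w ⊗v ii t) (\sweedler_(w0, a <- coact V v0)
      (w0 ⊗v (a ⊗v w)))).
  apply: eq_tlift => v0 p; rewrite tliftE // /rho.
  rewrite (tlift_comp _ _ (tlift_linear (bas _))).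
  rewrite (tlift_comp _ _ (tlift_linear bV)).
  by apply: eq_tlift => w a; rewrite !tliftE // /ii tliftE.
rewrite E; apply: eq_tlift => v0 p; rewrite !tliftE //.
by rewrite hopf_comul.
Qed.
Let rho1 v : \sweedler_(v0, h <- rho v) (counit h *: v0) = v.
Proof.
have b : bilin (fun (v : V) (h : H) => counit h *: v).
  split=> ?; first exact: linear_scale.
  exact: (@linear_scalel k H V (counit : H -> k^o) _ (@counit_linear k H)).
rewrite /rho (tlift_comp _ _ (tlift_linear b)) -[RHS]coact_counit.
by apply: eq_tlift => v0 p; rewrite tliftE // hopf_counit.
Qed.
Definition comod_push : comodule H :=
  @Comodule k H V (pack_linear rhoL) rhoA rho1.

Lemma coact_pushE v :
  coact comod_push v = \sweedler_(v0, p <- coact V v) (v0 ⊗v i p).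
Proof. by []. Qed.

End Pushforward.

Section Isomorphism.
Variables (k : fieldType) (H : hopfAlgType k).
Implicit Types V W : comodule H.

Let bil_map (A B : lmodType k) (f : A -> B) : linear f ->
  bilin (fun (v : A) (h : H) => f v ⊗v h).
Proof.
by move=> Lf; apply: bilin_pre (@tpure_bilin k _ _) Lf (@linear_id _ _).
Qed.

Lemma comod_iso_refl V : comod_iso V V.
Proof.
exists id; last by exists id.
by split=> // v; rewrite tlift_pure.
Qed.

Lemma comod_hom_can V W (f : V -> W) (g : W -> V) :
  comod_hom f -> cancel f g -> cancel g f -> comod_hom g.
Proof.
move=> [Lf fP] fK gK.
have Lg : linear g.
  by move=> a x y; apply: (can_inj fK); rewrite Lf !gK.
split=> // w; rewrite -{2}[w]gK fP (tlift_comp _ _ (tlift_linear _)).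
  rewrite -[LHS]tlift_pure; apply: eq_tlift => v h.
  by rewrite tliftE ?fK //; apply: bil_map.
exact: bil_map.
Qed.

Lemma comod_iso_sym V W : comod_iso V W -> comod_iso W V.
Proof.
case=> f Hf [g fK gK]; exists g; first exact: comod_hom_can Hf fK gK.
by exists f.
Qed.

Lemma comod_iso_trans V W X : comod_iso V W -> comod_iso W X -> comod_iso V X.
Proof.
case=> f [Lf fP] bf [g [Lg gP] bg]; exists (fun v => g (f v)); last first.
  exact: bij_comp.
split=> [|v]; first exact: linear_comp.
rewrite gP fP (tlift_comp _ _ (tlift_linear (bil_map Lg))).
by apply: eq_tlift => v0 h; rewrite tliftE //; apply: bil_map.
Qed.

Lemma comod_sum_iso V V' W W' : comod_iso V V' -> comod_iso W W' ->
  comod_iso (comod_sum V W) (comod_sum V' W').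
Proof.
case=> f [Lf fP] [f' fK f'K] [g [Lg gP] [g' gK g'K]].
pose F (u : V * W) : V' * W' := (f u.1, g u.2).
have LF : linear F by move=> a x y; congr (_, _); rewrite /= (Lf, Lg).
exists (F : comod_sum V W -> comod_sum V' W'); last first.
  exists (fun u => (f' u.1, g' u.2)) => -[x y];
    by rewrite /F /= ?fK ?gK ?f'K ?g'K.
split=> // u.
have bV : bilin (fun (v : V') (h : H) => ((v, 0) : V' * W') ⊗v h).
  by apply: bil_map => a x y; congr (_, _); rewrite /= scaler0 addr0.
have bW : bilin (fun (w : W') (h : H) => ((0, w) : V' * W') ⊗v h).
  by apply: bil_map => a x y; congr (_, _); rewrite /= scaler0 addr0.
have bF := bil_map LF.
rewrite !coact_sumE /= fP gP.
rewrite !(tlift_comp _ _ (tlift_linear bV)) !(tlift_comp _ _ (tlift_linear bW)).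
have FD (s t : (V * W)%type ⊗ H) : tlift (fun v h => F v ⊗v h) (s + t) =
    tlift (fun v h => F v ⊗v h) s + tlift (fun v h => F v ⊗v h) t.
  by have := tlift_linear bF 1 s t; rewrite !scale1r.
rewrite FD.
rewrite !(tlift_comp _ _ (tlift_linear bF)).
congr (_ + _); apply: eq_tlift => x h; rewrite !tliftE //; congr (_ ⊗v _);
  congr (_, _); rewrite /=; exact/esym/linear_0E.
Qed.

Lemma comod_tensor_iso V V' W W' : comod_iso V V' -> comod_iso W W' ->
  comod_iso (comod_tensor V W) (comod_tensor V' W').
Proof.
case=> f [Lf fP] [f' fK f'K] [g [Lg gP] [g' gK g'K]].
have Lf' : linear f' by move=> a x y; apply: (can_inj fK); rewrite Lf !f'K.
have Lg' : linear g' by move=> a x y; apply: (can_inj gK); rewrite Lg !g'K.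
have bfg : bilin (fun (v : V) (w : W) => f v ⊗v g w).
  exact: bilin_pre (@tpure_bilin k _ _) Lf Lg.
have bfg' : bilin (fun (v : V') (w : W') => f' v ⊗v g' w).
  exact: bilin_pre (@tpure_bilin k _ _) Lf' Lg'.
pose F : V ⊗ W -> V' ⊗ W' := tlift (fun v w => f v ⊗v g w).
pose F' : V' ⊗ W' -> V ⊗ W := tlift (fun v w => f' v ⊗v g' w).
have LF : linear F by exact: tlift_linear.
have LF' : linear F' by exact: tlift_linear.
exists (F : comod_tensor V W -> comod_tensor V' W'); last first.
  exists F'.
  - apply: (@tensor_ext _ _ _ _ (fun t => F' (F t)) id) => [||v w].
    + exact: linear_comp LF' LF.
    + exact: linear_id.
    + by rewrite /F tliftE // /F' tliftE // fK gK.
  - apply: (@tensor_ext _ _ _ _ (fun t => F (F' t)) id) => [||v w].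
    + exact: linear_comp LF LF'.
    + exact: linear_id.
    + by rewrite /F' tliftE // /F tliftE // f'K g'K.
split=> //; apply: (@tensor_ext k V W _ (fun t => coact (comod_tensor V' W') (F t))
    (fun t => tlift (fun v h => F v ⊗v h) (coact (comod_tensor V W) t))).
- exact: linear_comp (@coact_linear k H (comod_tensor V' W')) LF.
- exact: linear_comp (tlift_linear (bil_map LF))
                     (@coact_linear k H (comod_tensor V W)).
move=> v w; rewrite {1}/F tliftE //.
have bm (x : V' ) (a : H) :
    bilin (fun (y : W') b => (x ⊗v y) ⊗v (a * b)).
  apply: bilin_pre (@tpure_bilin k _ _) _ _; last exact: linear_mulr.
  exact: (tpure_bilin _ _).2.
have bm' (t : W' ⊗ H) : bilin (fun (x : V') (a : H) =>
    \sweedler_(y, b <- t) ((x ⊗v y) ⊗v (a * b))).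
  apply: bilin_tlift => y b; apply: bilin_pre (@tpure_bilin k _ _) _ _.
    exact: (tpure_bilin _ _).1.
  exact: linear_mull.
rewrite !coact_tensorE fP gP (tlift_comp _ _ (tlift_linear (bil_map LF))).
rewrite (tlift_comp _ _ (tlift_linear (bm' _))); apply: eq_tlift => v0 a.
rewrite tliftE // (tlift_comp _ _ (tlift_linear (bil_map LF))).
rewrite (tlift_comp _ _ (tlift_linear (bm _ _))); apply: eq_tlift => w0 b.
by rewrite !tliftE //; [rewrite /F tliftE | apply: bil_map].
Qed.

Lemma comod_dual_iso V W : comod_iso V W ->
  comod_iso (comod_dual V) (comod_dual W).
Proof.
case=> f Hf [g fK gK]; have [Lf fP] := Hf.
have [Lg gP] := comod_hom_can Hf fK gK.
pose fl : {linear V -> W} := HB.pack f (GRing.isLinear.Build _ _ _ _ f Lf).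
pose gl : {linear W -> V} := HB.pack g (GRing.isLinear.Build _ _ _ _ g Lg).
pose D (p : 'Hom(V, k^o)) : 'Hom(W, k^o) := (p \o linfun gl)%VF.
pose D' (p : 'Hom(W, k^o)) : 'Hom(V, k^o) := (p \o linfun fl)%VF.
have DE p w : D p w = p (g w) by rewrite comp_lfunE lfunE.
have D'E p v : D' p v = p (f v) by rewrite comp_lfunE lfunE.
exists (D : comod_dual V -> comod_dual W); last first.
  exists D' => p; apply/lfunP => x; first by rewrite D'E DE fK.
  by rewrite DE D'E gK.
have LD : linear D.
  by move=> a x y; apply/lfunP => w; rewrite !(DE, add_lfunE, scale_lfunE).
split=> // p; apply: dual_sep => w; rewrite coact_dualE.
have bev : bilin (fun (f0 : 'Hom(W, k^o)) (h : H) => (f0 w : k) *: h).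
  split=> ?; last exact: linear_scale.
  by apply: linear_scalel => a x y; rewrite add_lfunE scale_lfunE.
rewrite (tlift_comp _ _ (tlift_linear bev)).
transitivity (antipode (mcoef p (g w))); last first.
  rewrite -coact_dualE; apply: eq_tlift => q h.
  by rewrite tliftE // DE.
have bp : bilin (fun (v : V) (h : H) => (p v : k) *: h).
  split=> ?; last exact: linear_scale.
  by apply: linear_scalel => a x y; rewrite linearP.
congr (antipode _); rewrite /mcoef gP (tlift_comp _ _ (tlift_linear bp)).
by apply: eq_tlift => w0 h; rewrite tliftE // DE.
Qed.

End Isomorphism.

Lemma comod_push_iso (k : fieldType) (P H : hopfAlgType k) (i : hopf_map P H)
    (V W : comodule P) :
  comod_iso V W -> comod_iso (comod_push i V) (comod_push i W).
Proof.
case=> f [Lf fP] bf; exists f => //; split=> // v.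
have Li : linear i by exact: linearP.
have b (X : lmodType k) : bilin (fun (v : X) (p : P) => v ⊗v i p).
  exact: bilin_pre (@tpure_bilin k _ _) (@linear_id _ _) Li.
have bm : bilin (fun (v : V) (h : H) => f v ⊗v h).
  exact: bilin_pre (@tpure_bilin k _ _) Lf (@linear_id _ _).
rewrite !coact_pushE fP.
rewrite (tlift_comp _ _ (tlift_linear (b W))) (tlift_comp _ _ (tlift_linear bm)).
by apply: eq_tlift => v0 p; rewrite !tliftE.
Qed.

Section Simple.
Variables (k : fieldType) (H : hopfAlgType k).

(* the coaction of V restricts to W -> W ⊗ H *)
Definition subcomodule (V : comodule H) (W : {vspace V}) : Prop :=
  forall w, w \in W -> exists s : seq (V * H),
    all (fun p => p.1 \in W) s /\ coact V w = \sum_(p <- s) p.1 ⊗v p.2.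

Definition simple_comodule (V : comodule H) : Prop :=
  ({:V} != 0)%VS /\
  forall W : {vspace V}, subcomodule W -> W = 0%VS \/ W = {:V}%VS.

Definition cosemisimple : Prop :=
  forall V : comodule H, exists (n : nat) (S : 'I_n -> comodule H),
    (forall j, simple_comodule (S j)) /\
    comod_iso V (\big[@comod_sum k H/comod0 H]_(j < n) S j).

End Simple.

Section Fusion.
Variables (k : fieldType) (H : hopfAlgType k).

(* An element of R_+(H) is an isomorphism class of comodules. Comodules live in
   a universe too large for a MathComp semiring instance, hence the explicit
   operations below; their values on classes are given by fadd_class etc. *)
Definition fusion := {C : comodule H -> Prop | exists V, C = comod_iso V}.

Definition fclass (V : comodule H) : fusion :=
  exist _ (comod_iso V) (ex_intro _ V erefl).
Definition frepr (x : fusion) : comodule H := projT1 (cid (svalP x)).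

Lemma fclass_eq V W : fclass V = fclass W <-> comod_iso V W.
Proof.
split=> [/(congr1 sval) /= VW|VW]; first by rewrite VW; apply: comod_iso_refl.
apply: eq_exist; apply/funext => X; apply/propext; split=> h.
  exact: comod_iso_trans (comod_iso_sym VW) h.
exact: comod_iso_trans VW h.
Qed.

Lemma freprK x : fclass (frepr x) = x.
Proof.
case: x => C CV; apply: eq_exist; rewrite /frepr.
by case: (cid _) => V /= ->.
Qed.

Lemma frepr_class V : comod_iso (frepr (fclass V)) V.
Proof. by apply/fclass_eq; rewrite freprK. Qed.

Definition fzero := fclass (comod0 H).
Definition fone := fclass (comod1 H).
Definition fadd (x y : fusion) := fclass (comod_sum (frepr x) (frepr y)).
Definition fmul (x y : fusion) := fclass (comod_tensor (frepr x) (frepr y)).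
Definition fstar (x : fusion) := fclass (comod_dual (frepr x)).
Definition fle (x y : fusion) : Prop := exists z, y = fadd x z.

Lemma fadd_class V W : fadd (fclass V) (fclass W) = fclass (comod_sum V W).
Proof. by apply/fclass_eq; apply: comod_sum_iso; apply: frepr_class. Qed.
Lemma fmul_class V W : fmul (fclass V) (fclass W) = fclass (comod_tensor V W).
Proof. by apply/fclass_eq; apply: comod_tensor_iso; apply: frepr_class. Qed.
Lemma fstar_class V : fstar (fclass V) = fclass (comod_dual V).
Proof. by apply/fclass_eq; apply: comod_dual_iso; apply: frepr_class. Qed.

Definition fsimple (x : fusion) : Prop :=
  exists2 V, simple_comodule V & x = fclass V.

Definition fspan (S : fusion -> Prop) (x : fusion) : Prop :=
  exists (n : nat) (y : 'I_n -> fusion),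
    (forall j, S (y j)) /\ x = \big[fadd/fzero]_(j < n) y j.

Definition based_subsemiring (T : fusion -> Prop) : Prop :=
  [/\ T fzero /\ T fone,
      forall x y, T x -> T y -> T (fadd x y),
      forall x y, T x -> T y -> T (fmul x y)
    & exists2 S : fusion -> Prop, (forall x, S x -> fsimple x)
        & forall x, T x <-> fspan S x].

Definition fgenerated (S : fusion -> Prop) (x : fusion) : Prop :=
  forall T, based_subsemiring T -> (forall y, S y -> T y) -> T x.

End Fusion.

Section FusionPush.
Variables (k : fieldType) (P H : hopfAlgType k) (i : hopf_map P H).

Definition fpush (x : fusion P) : fusion H := fclass (comod_push i (frepr x)).

Lemma fpush_class V : fpush (fclass V) = fclass (comod_push i V).
Proof. by apply/fclass_eq; apply: comod_push_iso; apply: frepr_class. Qed.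

(* R_+(P) inside R_+(H) *)
Definition fimage (x : fusion H) : Prop := exists y : fusion P, x = fpush y.

End FusionPush.

(* Main.v *)
(* Let p : H -> k[G] be the center.  By centrality the projections of a
   comodule onto its G-components are comodule maps, so every simple comodule is
   homogeneous for p; since degrees are multiplicative, every constituent of
   w w^*, with w a product of simples, has degree 1, i.e. its matrix coefficients
   lie in the Hopf kernel of p.

   Conversely, link two simples when both occur in a common product of simples.
   The classes form a group (the chain group), with x^* the inverse of x.  As H
   is spanned by matrix coefficients of simples, and comodules without common
   constituents share no nonzero matrix coefficient, H is graded by this group,
   which gives a central map q.  By initiality q factors through p, so a
   constituent of a P-comodule has trivial class: it occurs with 1 in a product
   w, hence in w w^*.

   Finally, if t <= z x x^* with x, z simple, then t <= w x^* for a simple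
   w <= z x, and Frobenius reciprocity gives x^* <= w^* z, so t <= w w^* z.
   Hence products of elements z z^* can be moved past simples, and by induction
   on w every constituent of w w^* lies below such a product. *)

Require Import Defs.
From HB Require Import structures.
From mathcomp Require Import all_boot all_algebra.
From mathcomp Require Import boolp classical_sets monalg.

Set Implicit Arguments.
Unset Strict Implicit.
Unset Printing Implicit Defensive.

Import GRing.Theory.
Local Open Scope ring_scope.

(** * Linear algebra over a field *)

(** Constituents are never counted, only detected. For a simple element the order of the fusion
    semiring amounts to being a direct summand, so the order is replaced by retracts, which compose
    and tensor without any choice of complement; Hom spaces are replaced by the existence of a
    nonzero map. Duality then enters only through two adjunctions for one and the same dual, and the
    simplicity of a dual comes from a comparison of dimensions. Comodules are finite-dimensional
    while [H] may not be, so semisimplicity says nothing about [H] directly. The link is the matrix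
    coefficient f(v_0) v_1: every element of [H] is one, its counit is f(v), and for fixed f it is a
    colinear function of v with values in [H]. The map to the group algebra is q(h) = \sum_g ε(h_g)
    g, with h_g the component of degree g; the real content is that this does not depend on how h is
    written. As tensor products with [H] come without bases, shortest expressions of tensors and
    functionals dual to their factors take the place of coordinates. *)

Section LinearRetraction.
Variables (k : fieldType) (V W : lmodType k) (i : V -> W).
Hypotheses (Li : linear i) (inj_i : injective i).

Let partial (G : W * V -> Prop) : Prop :=
  (forall a p q, G p -> G q -> G (a *: p.1 + q.1, a *: p.2 + q.2)) /\
  (forall v, G (0, v) -> v = 0).
Let base (p : W * V) : Prop := p.1 = i p.2.
(** Zorn's lemma is applied to sets [G] for which [above G] is the graph of a partial retraction.
    Joining [base] here, instead of asking [G] to contain it, lets the empty chain pass: its union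
    is empty, and above it there is just [base]. *)
Let above (G : W * V -> Prop) p := G p \/ base p.

Let base_partial : partial base.
Proof.
split=> [a [w v] [w' v'] | v]; rewrite /base /=.
  by move=> -> ->; rewrite Li.
by move=> E; apply: inj_i; rewrite -E (linear_0E Li).
Qed.

Lemma linear_retraction : exists r : W -> V, linear r /\ cancel i r.
Proof.
pose P : set (set (W * V)) := fun G => partial (above G).
have [F FP Fch|A [[AD A0] Amax]] := @Zorn_bigcup _ P.
  have cov p q : above (\bigcup_(X in F) X)%classic p ->
      above (\bigcup_(X in F) X)%classic q ->
      exists X, [/\ P X, above X p, above X q
        & forall u, X u -> (\bigcup_(X in F) X)%classic u].
    have up X : F X -> forall u, X u -> (\bigcup_(X in F) X)%classic u.
      by move=> FX u Xu; exists X.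
    move=> [[X FX Xp]|Bp] [[Y FY Yq]|Bq].
    - have [XY|YX] := Fch _ _ FX FY.
        by exists Y; split; [exact: FP | left; exact: XY | left | exact: up].
      by exists X; split; [exact: FP | left | left; exact: YX | exact: up].
    - by exists X; split; [exact: FP | left | right | exact: up].
    - by exists Y; split; [exact: FP | right | left | exact: up].
    - exists set0; split; [|by right|by right|by []].
      split=> [a p' q' [//|Bp'] [//|Bq']|v [//|]]; last exact: base_partial.2.
      by right; apply: (base_partial.1 a p' q').
  split=> [a p q Fp Fq|v Fv].
    have [X [PX Xp Xq XF]] := cov _ _ Fp Fq.
    by case: (PX.1 a p q Xp Xq) => [/XF|]; [left | right].
  have [X [PX Xv _ _]] := cov _ _ Fv Fv; exact: (PX.2 v Xv).
have dom w : exists v, above A (w, v).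
  apply: contrapT => nw.
  have A00 : above A (0, 0) by right; rewrite /base /= (linear_0E Li).
  (* The graph enlarged by the pair [(w, 0)], against which maximality of [A] is tested. *)
  pose B : set (W * V) :=
    fun p => exists a x, above A x /\ p = (a *: w + x.1, x.2).
  have AB p : above A p -> B p.
    by case: p => x v Ap; exists 0, (x, v); rewrite scale0r add0r.
  have BB p : above B p -> B p by case=> // ?; apply: AB; right.
  apply: (Amax B).
    split=> [p Ap|BA]; first by apply: AB; left.
    apply: nw; exists 0; left; apply: BA; exists 1, (0, 0); split=> //.
    by rewrite scale1r addr0.
  split=> [c p q /BB [a [x [Ax ->]]] /BB [b [y [Ay ->]]]|v /BB [a [x [Ax]]]].
    left; exists (c * a + b), (c *: x.1 + y.1, c *: x.2 + y.2).
    split; first exact: AD.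
    by rewrite /= scalerDr scalerDl scalerA addrACA.
  (* If [a] is nonzero, [E] expresses [w] through the old domain, contrary to [nw]. *)
  case=> E ->; case: (eqVneq a 0) => [a0|a0].
    move: E; rewrite a0 scale0r add0r => E; apply: A0.
    by case: x E Ax => /= ? ? <-.
  case: nw; exists (- a^-1 *: x.2 + 0).
  have -> : w = - a^-1 *: x.1 + 0.
    apply: (scalerI a0); rewrite addr0 scalerA mulrN divff // scaleN1r.
    by apply/eqP; rewrite -addr_eq0 -E.
  exact: (AD (- a^-1) x (0, 0)).
have uniq w v v' : above A (w, v) -> above A (w, v') -> v = v'.
  move=> Av Av'; have := AD (-1) _ _ Av Av'; rewrite /= !scaleN1r addNr.
  by move/A0/eqP; rewrite addrC subr_eq0 => /eqP.
exists (fun w => sval (cid (dom w))); split=> [a x y|v].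
  have domP w := svalP (cid (dom w)).
  exact: uniq (domP _) (AD a _ _ (domP x) (domP y)).
by apply: uniq (svalP (cid (dom (i v)))) _; right.
Qed.

End LinearRetraction.

Section LinearAlgebra.
Variable k : fieldType.
Implicit Types U V W : lmodType k.

Lemma linear_NE V W (f : V -> W) v : linear f -> f (- v) = - f v.
Proof. by move=> Lf; rewrite -scaleN1r (linear_ZE _ _ Lf) scaleN1r. Qed.
Lemma linear_DE V W (f : V -> W) u v : linear f -> f (u + v) = f u + f v.
Proof. by move=> Lf; rewrite -{1}[u]scale1r Lf scale1r. Qed.
Lemma linear_BE V W (f : V -> W) u v : linear f -> f (u - v) = f u - f v.
Proof. by move=> Lf; rewrite (linear_DE _ _ Lf) (linear_NE _ Lf). Qed.
Lemma linear_zero V W : linear (fun _ : V => 0 : W).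
Proof. by move=> a x y; rewrite scaler0 addr0. Qed.
Lemma linear_sumf V W I (r : seq I) (f : I -> V -> W) :
  (forall i, linear (f i)) -> linear (fun v => \sum_(i <- r) f i v).
Proof.
move=> Lf a x y; rewrite scaler_sumr -big_split; apply: eq_bigr => i _.
exact: Lf.
Qed.
Lemma linear_inj V W (f : V -> W) : linear f -> (forall v, f v = 0 -> v = 0) ->
  injective f.
Proof.
move=> Lf f0 x y E; apply/eqP; rewrite -subr_eq0; apply/eqP/f0.
by rewrite (linear_BE _ _ Lf) E subrr.
Qed.

(** Independence makes [f] an injection of [k^n] into [W]; the coordinates of a linear retraction of
    it are the dual functionals. *)
Lemma dual_family W n (w : 'I_n -> W) :
  (forall r : 'I_n -> k, \sum_i r i *: w i = 0 -> forall i, r i = 0) ->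
  exists om : 'I_n -> W -> k^o,
    (forall i, linear (om i)) /\ (forall i j, om i (w j) = (i == j)%:R).
Proof.
move=> indep; pose f (r : 'rV[k]_n) := \sum_i r 0 i *: w i.
have Lf : linear f.
  move=> a x y; rewrite /f scaler_sumr -big_split; apply: eq_bigr => i _.
  by rewrite !mxE scalerDl scalerA.
have [r [Lr rK]] : exists r : W -> 'rV[k]_n, linear r /\ cancel f r.
  apply: linear_retraction => //; apply: linear_inj => // r r0.
  by apply/rowP => i; rewrite mxE; apply: (indep (fun i => r 0 i)).
exists (fun i x => r x 0 i); split=> [i a x y|i j].
  by rewrite Lr !mxE.
have -> : w j = f (delta_mx 0 j).
  rewrite /f (bigD1 j) //= !mxE !eqxx scale1r big1 ?addr0 // => l lj.
  by rewrite !mxE (negPf lj) andbF scale0r.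
by rewrite rK !mxE eqxx.
Qed.

Lemma functional_sep V (v : V) :
  (forall f : V -> k^o, linear f -> f v = 0) -> v = 0.
Proof.
move=> sep; apply: contrapT => v0.
have [|om [Lom E]] := @dual_family V 1 (fun _ => v).
  move=> r; rewrite big_ord1 => /eqP; rewrite scaler_eq0 => /orP[/eqP E i|/eqP //].
  by rewrite ord1.
have := sep _ (Lom 0); rewrite (E 0 0) => /eqP; by rewrite oner_eq0.
Qed.

Lemma functional_neq0 V (v : V) : v <> 0 ->
  exists f : V -> k^o, linear f /\ f v <> 0.
Proof.
move=> v0; apply: contrapT => nf; apply: v0; apply: functional_sep => f Lf.
by apply: contrapT => fv; apply: nf; exists f.
Qed.

Definition tmap V W V' W' (f : V -> V') (g : W -> W') (t : V ⊗ W) : V' ⊗ W' :=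
  \sweedler_(v, w <- t) (f v ⊗v g w).
Definition lslice V W (f : V -> k^o) (t : V ⊗ W) : W :=
  \sweedler_(v, w <- t) ((f v : k) *: w).
Definition rslice V W (g : W -> k^o) (t : V ⊗ W) : V :=
  \sweedler_(v, w <- t) ((g w : k) *: v).

Lemma bilin_tmap V W V' W' (f : V -> V') (g : W -> W') :
  linear f -> linear g -> bilin (fun v w => f v ⊗v g w).
Proof. exact: bilin_pre (@tpure_bilin k _ _). Qed.
Lemma bilin_lslice V W (f : V -> k^o) : linear f ->
  bilin (fun (v : V) (w : W) => (f v : k) *: w).
Proof. by move=> Lf; split=> ?; [exact: linear_scalel|exact: linear_scale]. Qed.
Lemma bilin_rslice V W (g : W -> k^o) : linear g ->
  bilin (fun (v : V) (w : W) => (g w : k) *: v).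
Proof. by move=> Lf; split=> ?; [exact: linear_scale|exact: linear_scalel]. Qed.

Lemma tmap_linear V W V' W' (f : V -> V') (g : W -> W') :
  linear f -> linear g -> linear (tmap f g).
Proof. by move=> Lf Lg; apply/tlift_linear/bilin_tmap. Qed.
Lemma tmapE V W V' W' (f : V -> V') (g : W -> W') v w :
  linear f -> linear g -> tmap f g (v ⊗v w) = f v ⊗v g w.
Proof. by move=> Lf Lg; rewrite /tmap tliftE //; apply: bilin_tmap. Qed.
Lemma tmap_id V W (t : V ⊗ W) : tmap id id t = t.
Proof. exact: tlift_pure. Qed.
Lemma tmap_comp V W V' W' V2 W2 (f : V -> V') (g : W -> W') (f' : V' -> V2)
    (g' : W' -> W2) t : linear f -> linear g -> linear f' -> linear g' ->
  tmap f' g' (tmap f g t) = tmap (fun v => f' (f v)) (fun w => g' (g w)) t.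
Proof.
move=> Lf Lg Lf' Lg'; rewrite [LHS](tlift_comp _ _ (tmap_linear Lf' Lg')).
by apply: eq_tlift => v w; rewrite tmapE.
Qed.
Lemma eq_tmap V W V' W' (f f' : V -> V') (g g' : W -> W') t :
  f =1 f' -> g =1 g' -> tmap f g t = tmap f' g' t.
Proof. by move=> ff gg; apply: eq_tlift => v w; rewrite ff gg. Qed.
Lemma tmapDl V W V' W' (f f' : V -> V') (g : W -> W') t :
  tmap (fun v => f v + f' v) g t = tmap f g t + tmap f' g t.
Proof.
rewrite -[tmap f g t]scale1r -tlift_fun; apply: eq_tlift => v w.
by rewrite scale1r -{1}[f v]scale1r tpureDZl scale1r.
Qed.
Lemma tmap0l V W V' W' (g : W -> W') (t : V ⊗ W) :
  tmap (fun _ => 0 : V') g t = 0.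
Proof.
by rewrite /tmap /tlift big1 // => p _; rewrite -(scale0r 0) tpureZl scale0r.
Qed.

Lemma lslice_linear V W (f : V -> k^o) : linear f -> linear (@lslice V W f).
Proof. by move=> Lf; apply/tlift_linear/bilin_lslice. Qed.
Lemma lsliceE V W (f : V -> k^o) (v : V) (w : W) : linear f ->
  lslice f (v ⊗v w) = (f v : k) *: w.
Proof. by move=> Lf; rewrite /lslice tliftE //; apply: bilin_lslice. Qed.
Lemma rslice_linear V W (f : W -> k^o) : linear f -> linear (@rslice V W f).
Proof. by move=> Lf; apply/tlift_linear/bilin_rslice. Qed.
Lemma rsliceE V W (f : W -> k^o) (v : V) (w : W) : linear f ->
  rslice f (v ⊗v w) = (f w : k) *: v.
Proof. by move=> Lf; rewrite /rslice tliftE //; apply: bilin_rslice. Qed.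
Lemma lslice_tmap V W V' W' (f : V' -> k^o) (g : V -> V') (h : W -> W') t :
  linear f -> linear g -> linear h ->
  lslice f (tmap g h t) = h (lslice (fun v => f (g v)) t).
Proof.
move=> Lf Lg Lh; rewrite [LHS](tlift_comp _ _ (lslice_linear Lf)).
rewrite [RHS](tlift_comp _ _ Lh); apply: eq_tlift => v w.
by rewrite lsliceE // (linear_ZE _ _ Lh).
Qed.

(** Solving a linear relation among the [w i] for one of them saves a summand. A general bilinear
    [f] stands in place of the pure tensor so that, after a swap, the same applies to relations
    among the left factors. *)
Let shorten V W U (f : V -> W -> U) n (v : 'I_n.+1 -> V) (w : 'I_n.+1 -> W) r i0 :
  bilin f -> \sum_i (r i : k) *: w i = 0 -> r i0 != 0 ->
  exists (v' : 'I_n -> V) (w' : 'I_n -> W),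
    \sum_i f (v i) (w i) = \sum_i f (v' i) (w' i).
Proof.
move=> bf; rewrite (bigD1_ord i0) //= => E r0.
have wE : w i0 = \sum_(i < n) (- (r (lift i0 i) / r i0)) *: w (lift i0 i).
  apply: (scalerI r0); rewrite scaler_sumr; move/eqP: E.
  rewrite addr_eq0 => /eqP ->; rewrite -sumrN; apply: eq_bigr => i _.
  by rewrite scalerA mulrN mulrCA divff // mulr1 scaleNr.
exists (fun i => (- (r (lift i0 i) / r i0)) *: v i0 + v (lift i0 i)).
exists (fun i => w (lift i0 i)).
rewrite (bigD1_ord i0) //= {1}wE (linear_sumE _ _ _ (bf.2 _)) -big_split.
apply: eq_bigr => i _ /=.
by rewrite (bf.1 _) (linear_ZE _ _ (bf.2 _)).
Qed.

(** In an expression with the fewest summands the left factors are independent, and so are the right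
    ones, since otherwise [shorten] applies. The dual functionals then read off single factors, as
    coordinates would. *)
Lemma tensor_min V W (t : V ⊗ W) : exists n (v : 'I_n -> V) (w : 'I_n -> W)
    (nu : 'I_n -> V -> k^o) (om : 'I_n -> W -> k^o),
  [/\ forall i, linear (nu i), forall i, linear (om i),
      forall i j, nu i (v j) = (i == j)%:R, forall i j, om i (w j) = (i == j)%:R
    & t = \sum_i v i ⊗v w i].
Proof.
pose P n := `[< exists (v : 'I_n -> V) (w : 'I_n -> W), t = \sum_i v i ⊗v w i >].
have exP : exists n, P n.
  exists (size (repr t)); apply/asboolP.
  exists (fun i => (nth (0, 0) (repr t) i).1), (fun i => (nth (0, 0) (repr t) i).2).
  by rewrite {1}[t]tensorE (big_nth (0, 0)) big_mkord.
case: (ex_minnP exP) => n /asboolP [v [w tE]] nmin.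
have indw r : \sum_i r i *: w i = 0 -> forall i, r i = 0.
  move=> E i; apply/eqP/contraT => ri.
  case: n v w r i tE nmin E ri => [|n] v w r i tE nmin E ri; first by case: i ri.
  have [v' [w' E']] := shorten v (@tpure_bilin k V W) E ri.
  have : P n by apply/asboolP; exists v', w'; rewrite tE.
  by move/nmin; rewrite ltnn.
have indv r : \sum_i r i *: v i = 0 -> forall i, r i = 0.
  move=> E i; apply/eqP/contraT => ri.
  case: n v w r i tE nmin E ri {indw} => [|n] v w r i tE nmin E ri.
    by case: i ri.
  have [w' [v' E']] := shorten w (bilin_swap (@tpure_bilin k V W)) E ri.
  have : P n by apply/asboolP; exists v', w'; rewrite tE.
  by move/nmin; rewrite ltnn.
have [nu [Lnu nuE]] := dual_family indv.
have [om [Lom omE]] := dual_family indw.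
by exists n, v, w, nu, om.
Qed.

Lemma lslice_sep V W (s t : V ⊗ W) :
  (forall f, linear f -> lslice f s = lslice f t) -> s = t.
Proof.
move=> st; apply/eqP; rewrite -subr_eq0; apply/eqP.
have {}st f : linear f -> lslice f (s - t) = 0.
  by move=> Lf; rewrite (linear_BE _ _ (lslice_linear Lf)) st // subrr.
have [n [v [w [nu [om [Lnu Lom nuE omE E]]]]]] := tensor_min (s - t).
rewrite E in st *; apply: big1 => i _; suff -> : w i = 0.
  by rewrite -(scale0r 0) tpureZr scale0r.
rewrite -(st _ (Lnu i)) (linear_sumE _ _ _ (lslice_linear (Lnu i))) (bigD1 i) //=.
rewrite lsliceE // nuE eqxx scale1r big1 ?addr0 // => j ji.
by rewrite lsliceE // nuE eq_sym (negPf ji) scale0r.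
Qed.

End LinearAlgebra.

Section Subspaces.
Variables (k : fieldType) (V : vectType k).

(** Among the subspaces inside [P], one of maximal dimension is all of [P]: a further vector would
    enlarge it. *)
Lemma vspace_of_pred (P : V -> Prop) : P 0 ->
  (forall a u v, P u -> P v -> P (a *: u + v)) ->
  exists K : {vspace V}, forall v, v \in K <-> P v.
Proof.
move=> P0 PD.
pose Q n := `[< exists2 K : {vspace V}, \dim K = n & forall v, v \in K -> P v >].
have exQ : exists n, Q n.
  by exists (\dim (0%VS : {vspace V})); apply/asboolP; exists 0%VS => // v;
     rewrite memv0 => /eqP ->.
have ubQ n : Q n -> (n <= \dim {:V})%N by move=> /asboolP [K <- _]; exact/dimvS/subvf.
case: (ex_maxnP exQ ubQ) => n /asboolP [K Kn KP] nmax.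
exists K => v; split=> [/KP //|Pv].
have : Q (\dim (K + <[v]>)%VS).
  apply/asboolP; exists (K + <[v]>)%VS => // u /memv_addP [x xK [y /vlineP [a ->] ->]].
  by rewrite addrC; apply: PD => //; apply: KP.
move/nmax; rewrite -Kn => le.
have /eqP -> : K == (K + <[v]>)%VS by rewrite eqEdim addvSl le.
by apply: (subvP (addvSr K <[v]>%VS)); apply: memv_line.
Qed.

End Subspaces.

(** * Matrix coefficients *)

Section MatrixCoefficients.
Variables (k : fieldType) (H : hopfAlgType k).
Implicit Types V W A B C : comodule H.

Definition coef V (f : V -> k^o) (v : V) : H := lslice f (coact V v).

Lemma coef_linear V (f : V -> k^o) : linear f -> linear (coef f).
Proof. by move=> Lf; apply: linear_comp (lslice_linear Lf) (@coact_linear k H V). Qed.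

Lemma eq_coef V (f g : V -> k^o) v : f =1 g -> coef f v = coef g v.
Proof. by move=> fg; apply: eq_tlift => w h; rewrite fg. Qed.

Lemma coef_linearl V (U : lmodType k) (F : U -> V -> k^o) v :
  (forall w, linear (F^~ w)) -> linear (fun u => coef (F u) v).
Proof.
move=> LF; apply: linear_tlift => w h.
exact: linear_scalel (LF w).
Qed.

Lemma counit_coef V (f : V -> k^o) v : linear f -> counit (coef f v) = f v.
Proof.
move=> Lf; rewrite -[in RHS](coact_counit v) (tlift_comp _ _ Lf).
rewrite /coef /lslice [LHS](tlift_comp _ _ (@counit_linear k H)).
apply: (@eq_tlift k V H k^o) => w h.
rewrite [LHS](linear_ZE _ _ (@counit_linear k H)) (linear_ZE _ _ Lf).
exact: mulrC.
Qed.

(** This is coassociativity sliced by [f]. With [H] coacting on itself by [comul], it makes [coef f]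
    a comodule map from [V] to [H], so that its kernel is a subcomodule. *)
Lemma comul_coef V (f : V -> k^o) v : linear f ->
  comul (coef f v) = tmap (coef f) id (coact V v).
Proof.
move=> Lf; have LD := @comul_linear k H.
have /(congr1 (lslice f)) := coactA v.
rewrite !(tlift_comp _ _ (lslice_linear Lf)) => E.
rewrite /coef {1}/lslice (tlift_comp _ _ LD).
transitivity (\sweedler_(v0, h <- coact V v) lslice f (v0 ⊗v comul h)).
  by apply: eq_tlift => w h; rewrite lsliceE // (linear_ZE _ _ LD).
rewrite -E; apply: eq_tlift => w h; rewrite (tlift_comp _ _ (lslice_linear Lf)).
rewrite /lslice (tlift_comp _ _ ((@tpure_bilin k H H).1 h)).
by apply: eq_tlift => u a; rewrite [LHS]lsliceE // tpureZl.
Qed.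

Lemma coef0 V (f : V -> k^o) : linear f -> coef f 0 = 0.
Proof. by move=> Lf; apply/linear_0E/coef_linear. Qed.

Section Basis.
Variable V : comodule H.
Let n := \dim {:V}.
Definition cbasis (i : 'I_n) : V := (vbasis {:V})`_i.
Definition ccoord (i : 'I_n) : 'Hom(V, k^o) := linfun (coord (vbasis {:V}) i : V -> k^o).
Lemma cbasisE v : v = \sum_i (ccoord i v : k) *: cbasis i.
Proof.
rewrite {1}(coord_vbasis (memvf v)).
by apply: eq_bigr => i _; rewrite lfunE.
Qed.
Lemma lfun_linear (f : 'Hom(V, k^o)) : linear f.
Proof. by move=> a x y; rewrite linearP. Qed.
Lemma comul_coef_basis (f : V -> k^o) v : linear f ->
  comul (coef f v) = \sum_i coef f (cbasis i) ⊗v coef (ccoord i) v.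
Proof.
move=> Lf; rewrite comul_coef //.
transitivity (\sum_i tlift (fun (w : V) (h : H) =>
    coef f (cbasis i) ⊗v ((ccoord i w : k) *: h)) (coact V v)).
  rewrite /tlift exchange_big; apply: eq_bigr => p _ /=.
  rewrite {1}[p.1]cbasisE (linear_sumE _ _ _ (coef_linear Lf)) tpure_suml.
  by apply: eq_bigr => i _; rewrite (linear_ZE _ _ (coef_linear Lf)) tpureZl tpureZr.
by apply: eq_bigr => i _; rewrite -(tlift_comp _ _ ((@tpure_bilin k H H).2 _)).
Qed.
Lemma coact_basis v : coact V v = \sum_i cbasis i ⊗v coef (ccoord i) v.
Proof.
apply: lslice_sep => f Lf.
rewrite (linear_sumE _ _ _ (lslice_linear Lf)).
transitivity (\sum_i tlift (fun (w : V) (h : H) =>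
    (f (cbasis i) : k) *: ((ccoord i w : k) *: h)) (coact V v)).
  rewrite /lslice /tlift exchange_big; apply: eq_bigr => p _ /=.
  rewrite {1}[p.1]cbasisE (linear_sumE _ _ _ Lf) scaler_suml.
  by apply: eq_bigr => i _; rewrite (linear_ZE _ _ Lf) scalerA mulrC.
by apply: eq_bigr => i _; rewrite lsliceE // /coef /lslice /tlift scaler_sumr.
Qed.
End Basis.

Lemma hom_coef V W (F : V -> W) (f : W -> k^o) v : comod_hom F -> linear f ->
  coef f (F v) = coef (fun v => f (F v)) v.
Proof.
move=> [LF FP] Lf; rewrite /coef FP.
exact: (lslice_tmap _ Lf LF (@linear_id k H)).
Qed.

(** Functionals on the left factor separate tensors, so colinearity can be tested on matrix
    coefficients, where tensor products of coactions become products in [H]. *)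
Lemma coef_hom V W (F : V -> W) : linear F ->
  (forall f v, linear f -> coef f (F v) = coef (fun v => f (F v)) v) ->
  comod_hom F.
Proof.
move=> LF FP; split=> // v; apply: lslice_sep => f Lf.
by rewrite [LHS]FP // [RHS](lslice_tmap _ Lf LF (@linear_id k H)).
Qed.

Lemma hom_id V : comod_hom (fun v : V => v).
Proof. by split=> // v; rewrite tlift_pure. Qed.
Lemma hom_comp V W C (G : W -> C) (F : V -> W) : comod_hom G -> comod_hom F ->
  comod_hom (fun v => G (F v)).
Proof.
move=> hG hF; apply: coef_hom => [|f v Lf]; first exact: linear_comp hG.1 hF.1.
by rewrite !hom_coef //; apply: linear_comp Lf hG.1.
Qed.
Lemma hom_iso V W (F : V -> W) (G : W -> V) :
  comod_hom F -> cancel F G -> cancel G F -> comod_iso V W.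
Proof. by move=> hF FK GK; exists F => //; exists G. Qed.

Section TensorComodule.
Variables V W : comodule H.

Lemma tlift_coact_tensor (U : lmodType k) (F : V ⊗ W -> H -> U) v w : bilin F ->
  tlift F (coact (comod_tensor V W) (v ⊗v w)) =
  \sweedler_(v0, a <- coact V v) \sweedler_(w0, b <- coact W w)
    F (v0 ⊗v w0) (a * b).
Proof.
move=> bF; rewrite coact_tensorE (tlift_comp _ _ (tlift_linear bF)).
apply: eq_tlift => v0 a; rewrite (tlift_comp _ _ (tlift_linear bF)).
by apply: eq_tlift => w0 b; rewrite tliftE.
Qed.

Lemma coef_tensor (f : V ⊗ W -> k^o) v w : linear f ->
  coef (f : comod_tensor V W -> k^o) (v ⊗v w) =
  \sweedler_(w0, b <- coact W w) (coef (fun v : V => f (v ⊗v w0)) v * b).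
Proof.
move=> Lf; rewrite [LHS](tlift_coact_tensor _ _ (bilin_lslice _ Lf)).
rewrite tlift_exchange; apply: eq_tlift => w0 b.
rewrite /coef /lslice (tlift_comp _ _ (linear_mull b)).
by apply: eq_tlift => v0 a; rewrite scalerAl.
Qed.

Lemma coef_tensor_pure (f : V -> k^o) (g : W -> k^o) v w : linear f -> linear g ->
  coef ((tlift (fun v w => (f v * g w : k^o))) : comod_tensor V W -> k^o) (v ⊗v w) =
  coef f v * coef g w.
Proof.
move=> Lf Lg; have bfg : bilin (fun v w => (f v * g w : k^o)).
  by apply: bilin_pre (@bilin_mul k k^o) Lf Lg.
rewrite coef_tensor; last exact: tlift_linear.
rewrite [in RHS]/coef [X in _ * X]/lslice (tlift_comp _ _ (linear_mulr _)).
apply: eq_tlift => w0 b; rewrite -scalerAr scalerAl; congr (_ * _).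
rewrite /coef /lslice (tlift_comp _ _ (@linear_scale k H (g w0))).
by apply: eq_tlift => v0 a; rewrite tliftE // scalerA mulrC.
Qed.

End TensorComodule.

Lemma hom_tensor V W A B (F : V -> A) (G : W -> B) : comod_hom F -> comod_hom G ->
  comod_hom (tmap F G : comod_tensor V W -> comod_tensor A B).
Proof.
move=> hF hG; have LFG := tmap_linear hF.1 hG.1.
apply: coef_hom => // f t Lf; move: t; apply: tensor_ext.
- exact: linear_comp (coef_linear Lf) LFG.
- by apply: (@coef_linear (comod_tensor V W)); exact: linear_comp Lf LFG.
move=> v w; rewrite tmapE; [|exact: hF.1|exact: hG.1].
rewrite coef_tensor // coef_tensor; last exact: linear_comp Lf LFG.
have b : bilin (fun (w0 : B) (b : H) => coef (fun v : A => f (v ⊗v w0)) (F v) * b).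
  split=> [b|w0]; last exact: linear_mulr.
  apply: linear_comp (linear_mull b) _; apply: coef_linearl => x.
  exact: linear_comp Lf ((@tpure_bilin k _ _).2 x).
rewrite hG.2 (tlift_comp _ _ (tlift_linear b)); apply: eq_tlift => w0 h.
rewrite tliftE // hom_coef //; last first.
  exact: linear_comp Lf ((@tpure_bilin k _ _).1 _).
by congr (_ * _); apply: eq_coef => u; rewrite tmapE //; [case: hF|case: hG].
Qed.

End MatrixCoefficients.

(** * Monoidal structure and duality *)

Section TensorCoherence.
Variable k : fieldType.

Section Assoc.
Variables A B C : lmodType k.
Let bp V W := @tpure_bilin k V W.

Definition tassoc : (A ⊗ B) ⊗ C -> A ⊗ (B ⊗ C) :=
  tlift (fun t c => tlift (fun a b => a ⊗v (b ⊗v c)) t).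
Definition tassoci : A ⊗ (B ⊗ C) -> (A ⊗ B) ⊗ C :=
  tlift (fun a t => tlift (fun b c => (a ⊗v b) ⊗v c) t).

Let b1 (c : C) : bilin (fun (a : A) (b : B) => a ⊗v (b ⊗v c)).
Proof. by split=> ? a x y; rewrite ?tpureDZl ?tpureDZr. Qed.
Let b2 : bilin (fun (t : A ⊗ B) (c : C) => tlift (fun (a : A) (b : B) => a ⊗v (b ⊗v c)) t).
Proof.
split=> x; first exact: tlift_linear.
by apply: linear_tlift => a b d u v; rewrite !tpureDZr.
Qed.
Let b3 (a : A) : bilin (fun (b : B) (c : C) => (a ⊗v b) ⊗v c).
Proof. by split=> ? d x y; rewrite ?tpureDZr ?tpureDZl. Qed.
Let b4 : bilin (fun (a : A) (t : B ⊗ C) => tlift (fun (b : B) (c : C) => (a ⊗v b) ⊗v c) t).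
Proof.
split=> x; last exact: tlift_linear.
by apply: linear_tlift => a b d u v; rewrite !tpureDZl.
Qed.

Lemma tassoc_linear : linear tassoc. Proof. exact: tlift_linear. Qed.
Lemma tassoci_linear : linear tassoci. Proof. exact: tlift_linear. Qed.
Lemma tassocE a b c : tassoc ((a ⊗v b) ⊗v c) = a ⊗v (b ⊗v c).
Proof. by rewrite /tassoc !tliftE. Qed.
Lemma tassociE a b c : tassoci (a ⊗v (b ⊗v c)) = (a ⊗v b) ⊗v c.
Proof. by rewrite /tassoci !tliftE. Qed.
Lemma tassocK : cancel tassoc tassoci.
Proof.
have L1 := tassoc_linear; have L2 := tassoci_linear.
apply: (@tensor_ext _ _ _ _ (fun t => tassoci (tassoc t)) id) => [||t c].
- exact: linear_comp.
- exact: linear_id.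
move: t; apply: (@tensor_ext _ _ _ _ (fun t => tassoci (tassoc (t ⊗v c)))
  (fun t => t ⊗v c)) => [||a b]; last by rewrite tassocE tassociE.
- exact: linear_comp (linear_comp L2 L1) ((bp _ _).1 c).
- exact: (bp _ _).1.
Qed.
Lemma tassociK : cancel tassoci tassoc.
Proof.
have L1 := tassoc_linear; have L2 := tassoci_linear.
apply: (@tensor_ext _ _ _ _ (fun t => tassoc (tassoci t)) id) => [||a t].
- exact: linear_comp.
- exact: linear_id.
move: t; apply: (@tensor_ext _ _ _ _ (fun t => tassoc (tassoci (a ⊗v t)))
  (fun t => a ⊗v t)) => [||b c]; last by rewrite tassociE tassocE.
- exact: linear_comp (linear_comp L1 L2) ((bp _ _).2 a).
- exact: (bp _ _).2.
Qed.

End Assoc.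

Section Unit.
Variable A : lmodType k.
Definition tunitr (a : A) : A ⊗ k^o := a ⊗v (1 : k^o).
Definition tunitl (a : A) : k^o ⊗ A := (1 : k^o) ⊗v a.
Lemma tunitr_linear : linear tunitr. Proof. exact: (tpure_bilin _ _).1. Qed.
Lemma tunitl_linear : linear tunitl. Proof. exact: (tpure_bilin _ _).2. Qed.
Lemma tunitrK : cancel tunitr (rslice id).
Proof. by move=> a; rewrite rsliceE ?scale1r //. Qed.
Lemma tunitlK : cancel tunitl (lslice id).
Proof. by move=> a; rewrite lsliceE ?scale1r //. Qed.
Lemma tunitri_can : cancel (rslice (id : k^o -> k^o)) tunitr.
Proof.
apply: (@tensor_ext _ _ _ _ (fun t => tunitr (rslice id t)) id) => [||a c].
- exact: linear_comp tunitr_linear (rslice_linear (@linear_id k k^o)).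
- exact: linear_id.
by rewrite rsliceE // /tunitr tpureZl -tpureZr [_ *: _]mulr1.
Qed.
Lemma tunitli_can : cancel (lslice (id : k^o -> k^o)) tunitl.
Proof.
apply: (@tensor_ext _ _ _ _ (fun t => tunitl (lslice id t)) id) => [||c a].
- exact: linear_comp tunitl_linear (lslice_linear (@linear_id k k^o)).
- exact: linear_id.
by rewrite lsliceE // /tunitl tpureZr -tpureZl [_ *: _]mulr1.
Qed.
End Unit.

End TensorCoherence.

Section ComoduleCoherence.
Variables (k : fieldType) (H : hopfAlgType k).
Implicit Types A B C V W : comodule H.
Local Notation "A '⊠' B" := (comod_tensor A B) (at level 40, left associativity).
Local Notation I := (comod1 H).

Lemma hom_assoc A B C : comod_hom (@tassoc k A B C : (A ⊠ B) ⊠ C -> A ⊠ (B ⊠ C)).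
Proof.
have LT := @tassoc_linear k A B C; have bp (X Y : lmodType k) := @tpure_bilin k X Y.
apply: coef_hom => // f t Lf.
have L1 := linear_comp (coef_linear Lf) LT.
have LfT : linear (fun t : (A ⊠ B) ⊠ C => f (tassoc t)) by exact: linear_comp Lf LT.
have L2 := coef_linear LfT.
move: t; apply: (tensor_ext L1 L2) => t c.
have L1' := linear_comp L1 ((bp _ _).1 c).
have L2' := linear_comp L2 ((bp _ _).1 c).
move: t; apply: (tensor_ext L1' L2').
move=> a b; rewrite tassocE [LHS](@coef_tensor _ _ A (B ⊠ C)) //.
have bF : bilin (fun (w : B ⊗ C) (h : H) => coef (fun v : A => f (v ⊗v w)) a * h).
  split=> [h|w]; last exact: linear_mulr.
  apply: linear_comp (linear_mull h) _; apply: coef_linearl => x.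
  exact: linear_comp Lf ((bp _ _).2 x).
rewrite [LHS](tlift_coact_tensor _ _ bF) tlift_exchange.
rewrite [RHS](@coef_tensor _ _ (A ⊠ B) C) //.
apply: eq_tlift => c0 h; rewrite coef_tensor; last first.
  exact: linear_comp Lf (linear_comp LT ((bp _ _).1 _)).
rewrite (tlift_comp _ _ (linear_mull h)); apply: eq_tlift => b0 h'.
by rewrite mulrA; congr (_ * _ * _); apply: eq_coef => v; rewrite tassocE.
Qed.

Lemma hom_associ A B C : comod_hom (@tassoci k A B C : A ⊠ (B ⊠ C) -> (A ⊠ B) ⊠ C).
Proof. exact: comod_hom_can (@hom_assoc A B C) (@tassocK _ _ _ _) (@tassociK _ _ _ _). Qed.

Lemma hom_unitr A : comod_hom (@tunitr k A : A -> A ⊠ I).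
Proof.
split=> [|v]; first exact: tunitr_linear.
rewrite /tunitr coact_tensorE; apply: eq_tlift => w h.
rewrite coact1E tliftE ?mulr1 //.
exact: bilin_pre (@tpure_bilin k _ _) ((@tpure_bilin k _ _).2 _) (linear_mulr _).
Qed.
Lemma hom_unitl A : comod_hom (@tunitl k A : A -> I ⊠ A).
Proof.
split=> [|v]; first exact: tunitl_linear.
rewrite /tunitl coact_tensorE coact1E tliftE.
  by apply: eq_tlift => w h; rewrite mul1r.
apply: bilin_tlift => w h.
exact: bilin_pre (@tpure_bilin k _ _) ((@tpure_bilin k _ _).1 _) (linear_mull _).
Qed.
Lemma hom_unitri A : comod_hom (rslice id : A ⊠ I -> A).
Proof. exact: comod_hom_can (hom_unitr A) (@tunitrK _ _) (@tunitri_can _ _). Qed.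
Lemma hom_unitli A : comod_hom (lslice id : I ⊠ A -> A).
Proof. exact: comod_hom_can (hom_unitl A) (@tunitlK _ _) (@tunitli_can _ _). Qed.

Section Duality.
Variable V : comodule H.
Local Notation V' := (comod_dual V).
Local Notation e := (@cbasis k H V).
Local Notation e' := (@ccoord k H V).

Definition evd : V' ⊗ V -> k^o := tlift (fun (f : 'Hom(V, k^o)) v => f v).
Definition coevd (a : k^o) : V ⊗ V' := (a : k) *: \sum_i e i ⊗v e' i.

Lemma evd_bilin : bilin (fun (f : 'Hom(V, k^o)) v => f v).
Proof.
split=> [v a f g|f]; last exact: lfun_linear.
by rewrite add_lfunE scale_lfunE.
Qed.
Lemma evd_linear : linear evd. Proof. exact/tlift_linear/evd_bilin. Qed.
Lemma evdE (f : V') v : evd (f ⊗v v) = (f : 'Hom(V, k^o)) v.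
Proof. by rewrite /evd tliftE //; apply: evd_bilin. Qed.

Lemma coef_dual (v : V) (f : V') :
  coef (fun g : V' => (g : 'Hom(V, k^o)) v) f = antipode (coef (f : 'Hom(V, k^o)) v).
Proof. exact: coact_dualE. Qed.

Lemma linear_k (g : k^o -> k^o) (a : k^o) : linear g -> g a = a * g 1.
Proof. by move=> Lg; rewrite -{1}[a]mulr1 [LHS](linear_ZE a 1 Lg). Qed.

Lemma coef_unit (f : I -> k^o) (a : I) : linear f -> coef f a = (f a : k) *: 1.
Proof. by move=> Lf; rewrite /coef coact1E lsliceE. Qed.

(** Once the coaction of the tensor product is expanded, the identity required is [antipodel] at
    [coef f v]. The coevaluation below rests on [antipoder] in the same way. *)
Lemma hom_evd : comod_hom (evd : V' ⊠ V -> I).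
Proof.
apply: coef_hom => [|g t Lg]; first exact: evd_linear.
move: t; apply: tensor_ext => [||f v].
- exact: linear_comp (coef_linear Lg) evd_linear.
- by apply: (@coef_linear _ _ (V' ⊠ V)); exact: linear_comp Lg evd_linear.
rewrite coef_unit // coef_tensor; last exact: linear_comp Lg evd_linear.
have Lf := lfun_linear f; have LS := @antipode_linear k H.
transitivity (\sweedler_(w, h <- coact V v) ((g 1 : k) *: (antipode (coef f w) * h))).
  have <- := tlift_comp (fun w h => antipode (coef f w) * h) (coact V v)
    (@linear_scale k H (g 1)).
  have b : bilin (fun a b : H => antipode a * b).
    exact: bilin_pre (@bilin_mul k H) LS (@linear_id _ _).
  have := antipodel (coef f v); rewrite comul_coef // (tlift_comp _ _ (tlift_linear b)).
  under eq_tlift do rewrite tliftE //.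
  by move=> ->; rewrite counit_coef // scalerA evdE linear_k // mulrC.
apply: eq_tlift => w h; rewrite -coef_dual scalerAl; congr (_ * _).
rewrite /coef /lslice (tlift_comp _ _ (@linear_scale k H (g 1))).
by apply: eq_tlift => u h'; rewrite evdE (linear_k (u w) Lg) scalerA mulrC.
Qed.

Lemma coact_dual_basis (f : V') : coact V' f = \sum_i (e' i : V') ⊗v antipode (coef f (e i)).
Proof. by []. Qed.

Lemma coevd_linear : linear coevd.
Proof. by move=> a x y; rewrite /coevd scalerDl scalerA. Qed.

Lemma hom_coevd : comod_hom (coevd : I -> V ⊠ V').
Proof.
apply: coef_hom => [|f a Lf]; first exact: coevd_linear.
have Lf1 w : linear (fun v : V => f (v ⊗v w)).
  exact: linear_comp Lf ((@tpure_bilin k _ _).1 w).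
rewrite coef_unit; last exact: linear_comp Lf coevd_linear.
rewrite /coevd (linear_ZE _ _ Lf) (linear_ZE _ _ (coef_linear Lf)) -scalerA.
congr (_ *: _); rewrite (linear_sumE _ _ _ Lf) (linear_sumE _ _ _ (coef_linear Lf)).
rewrite scaler_suml.
have LS := @antipode_linear k H.
have bF i : bilin (fun (w : V') (h : H) => coef (fun v : V => f (v ⊗v w)) (e i) * h).
  split=> [h|w]; last exact: linear_mulr.
  apply: linear_comp (linear_mull h) _; apply: coef_linearl => x.
  exact: linear_comp Lf ((@tpure_bilin k _ _).2 x).
transitivity (\sum_i \sum_j coef (fun v : V => f (v ⊗v (e' j : V'))) (e i) *
   antipode (coef (e' i) (e j))).
  apply: eq_bigr => i _; rewrite coef_tensor // coact_dual_basis.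
  rewrite (linear_sumE _ _ _ (tlift_linear (bF i))).
  by apply: eq_bigr => j _; rewrite tliftE.
rewrite exchange_big; apply: eq_bigr => j _ /=.
have b : bilin (fun a b : H => a * antipode b).
  exact: bilin_pre (@bilin_mul k H) (@linear_id _ _) LS.
have := antipoder (coef (fun v : V => f (v ⊗v (e' j : V'))) (e j)).
rewrite comul_coef_basis // (linear_sumE _ _ _ (tlift_linear b)) counit_coef //.
by move=> <-; apply: eq_bigr => i _; rewrite tliftE.
Qed.

End Duality.

(** Nonvanishing of Hom(V, W). In the semisimple case, with one side simple, it detects
    constituents, and it survives adjunctions without any naturality being checked. *)
Definition occ V W := exists2 F : V -> W, comod_hom F & exists v, F v <> 0.

(** The transpose of [F] is a |-> \sum F(a ⊗ e_i) ⊗ e^i. Evaluating its second factor at b gives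
    back F(a ⊗ b), so it is nonzero along with [F]. *)
Lemma occ_curry A B C : occ (A ⊠ B) C -> occ A (C ⊠ comod_dual B).
Proof.
case=> F hF [t Ft]; have LF := hF.1.
pose G (a : A) : C ⊗ comod_dual B :=
  tmap F id (tassoci (tmap id (@coevd B) (tunitr a))).
exists (G : A -> C ⊠ comod_dual B).
  have h1 := hom_tensor (@hom_id _ _ A) (hom_coevd B).
  have h2 := hom_tensor hF (@hom_id _ _ (comod_dual B)).
  have h3 := hom_comp h1 (hom_unitr A).
  have h4 := hom_comp (@hom_associ A B (comod_dual B)) h3.
  exact: hom_comp h2 h4.
have GE a : G a = \sum_i F (a ⊗v cbasis i) ⊗v (ccoord i : comod_dual B).
  rewrite /G /tunitr tmapE //; last exact: coevd_linear.
  rewrite /coevd scale1r tpure_sumr (linear_sumE _ _ _ (@tassoci_linear _ _ _ _)).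
  rewrite (linear_sumE _ _ _ (tmap_linear LF (@linear_id _ _))).
  by apply: eq_bigr => i _; rewrite tassociE tmapE.
apply: contrapT => G0; apply: Ft; move: t.
apply: (@tensor_ext _ A B _ F (fun _ => 0)) => [//||a b]; first exact: linear_zero.
have Lb : linear (fun g : 'Hom(B, k^o) => g b) := (evd_bilin B).1 b.
have : G a = 0 by apply: contrapT => Ga; apply: G0; exists a.
move/(congr1 (rslice (fun g : 'Hom(B, k^o) => g b))).
rewrite (linear_0E (rslice_linear Lb)) => <-.
rewrite GE (linear_sumE _ _ _ (rslice_linear Lb)) {1}[b]cbasisE tpure_sumr.
rewrite (linear_sumE _ _ _ LF); apply: eq_bigr => i _.
by rewrite rsliceE // tpureZr (linear_ZE _ _ LF).
Qed.

(** The transpose sends f ⊗ x to the slice of [F x] by [f], and such slices separate the elements of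
    B ⊗ C. *)
Lemma occ_uncurry A B C : occ A (B ⊠ C) -> occ (comod_dual B ⊠ A) C.
Proof.
case=> F hF [a Fa]; have LF := hF.1.
pose G (t : comod_dual B ⊗ A) : C :=
  lslice id (tmap (@evd B) id (tassoci (tmap id F t))).
exists (G : comod_dual B ⊠ A -> C).
  have h1 := hom_tensor (@hom_id _ _ (comod_dual B)) hF.
  have h2 := hom_comp (@hom_associ (comod_dual B) B C) h1.
  have h3 := hom_comp (hom_tensor (hom_evd B) (@hom_id _ _ C)) h2.
  exact: hom_comp (hom_unitli C) h3.
have GE (f : comod_dual B) x : G (f ⊗v x) = lslice (f : 'Hom(B, k^o)) (F x).
  rewrite /G tmapE //; move: (F x) => {}x.
  have Lev := @evd_linear B.
  move: x; apply: tensor_ext => [||b c].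
  - apply: linear_comp (lslice_linear _) _ => //.
    apply: linear_comp (tmap_linear Lev (@linear_id _ _)) _.
    exact: linear_comp (@tassoci_linear _ _ _ _) ((@tpure_bilin k _ _).2 f).
  - exact: lslice_linear (lfun_linear f).
  by rewrite tassociE tmapE // lsliceE // evdE lsliceE //; apply: lfun_linear.
apply: contrapT => G0; apply: Fa; apply: lslice_sep => f Lf.
rewrite (linear_0E (lslice_linear Lf)).
have fE : (linfun (pack_linear Lf) : 'Hom(B, k^o)) =1 f by move=> x; rewrite lfunE.
have : G ((linfun (pack_linear Lf) : comod_dual B) ⊗v a) = 0.
  by apply: contrapT => Ga; apply: G0; eexists; exact: Ga.
by rewrite GE => <-; apply: eq_tlift => x y; rewrite fE.
Qed.

End ComoduleCoherence.

(** * Subcomodules and simple comodules *)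

Section Comatrix.
Variables (k : fieldType) (H : hopfAlgType k).

(** These identities hold for the matrix of a coaction in a basis, and they are exactly what makes
    such a matrix define a comodule of row vectors. *)
Definition comatrix n (c : 'I_n -> 'I_n -> H) :=
  (forall i j, comul (c i j) = \sum_l c i l ⊗v c l j) /\
  (forall i j, counit (c i j) = (i == j)%:R).

Section ComoduleOfComatrix.
Variables (n : nat) (c : 'I_n -> 'I_n -> H) (cP : comatrix c).
Local Notation e i := (delta_mx 0 i : 'rV[k]_n).

Let rho (r : 'rV[k]_n) : 'rV[k]_n ⊗ H := \sum_j r 0 j *: \sum_i e i ⊗v c i j.
Let rhoL : linear rho.
Proof.
apply: linear_sumf => j a x y.
by rewrite !mxE scalerDl scalerA.
Qed.
Let rhoe j : rho (e j) = \sum_i e i ⊗v c i j.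
Proof.
rewrite /rho (bigD1 j) //= mxE !eqxx scale1r [X in _ + X]big1 ?addr0 // => l lj.
by rewrite mxE (negPf lj) scale0r.
Qed.
Let rho_ext (U : lmodType k) (f g : 'rV[k]_n -> U) : linear f -> linear g ->
  (forall j, f (e j) = g (e j)) -> f =1 g.
Proof.
move=> Lf Lg fg r; rewrite [r]row_sum_delta (linear_sumE _ _ _ Lf).
rewrite (linear_sumE _ _ _ Lg); apply: eq_bigr => j _.
by rewrite (linear_ZE _ _ Lf) (linear_ZE _ _ Lg) fg.
Qed.
Let rhoA v :
  \sweedler_(v0, h <- rho v) \sweedler_(w, a <- rho v0) (w ⊗v (a ⊗v h))
  = \sweedler_(v0, h <- rho v) (v0 ⊗v comul h).
Proof.
have b1 (h : H) : bilin (fun (w : 'rV[k]_n) (a : H) => w ⊗v (a ⊗v h)).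
  by split=> ? a u w; rewrite ?tpureDZl ?tpureDZr.
have b2 : bilin (fun (v0 : 'rV[k]_n) (h : H) =>
    \sweedler_(w, a <- rho v0) (w ⊗v (a ⊗v h))).
  split=> [h|x]; first exact: (@linear_comp k _ _ _ _ _ (tlift_linear (b1 h)) rhoL).
  by apply: linear_tlift => w a b x' y; rewrite !tpureDZr.
have b3 : bilin (fun (v0 : 'rV[k]_n) (h : H) => v0 ⊗v comul h).
  exact: bilin_pre (@tpure_bilin k _ _) (@linear_id _ _) (@comul_linear k H).
move: v; apply: rho_ext => [||j].
- exact: linear_comp (tlift_linear b2) rhoL.
- exact: linear_comp (tlift_linear b3) rhoL.
rewrite rhoe (linear_sumE _ _ _ (tlift_linear b2)).
rewrite (linear_sumE _ _ _ (tlift_linear b3)).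
under [RHS]eq_bigr => i _ do rewrite tliftE // cP.1 tpure_sumr.
rewrite exchange_big; apply: eq_bigr => l _ /=.
rewrite tliftE // rhoe (linear_sumE _ _ _ (tlift_linear (b1 _))).
by apply: eq_bigr => i _; rewrite tliftE.
Qed.
Let rho1 v : \sweedler_(v0, h <- rho v) (counit h *: v0) = v.
Proof.
have b : bilin (fun (v : 'rV[k]_n) (h : H) => counit h *: v).
  exact: (bilin_rslice _ (@counit_linear k H)).
move: v; apply: rho_ext => [||j].
- exact: linear_comp (tlift_linear b) rhoL.
- exact: linear_id.
rewrite rhoe (linear_sumE _ _ _ (tlift_linear b)) (bigD1 j) //=.
rewrite tliftE // cP.2 eqxx scale1r big1 ?addr0 // => i ij.
by rewrite tliftE // cP.2 (negPf ij) scale0r.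
Qed.
Definition comod_mx : comodule H :=
  @Comodule k H 'rV[k]_n (pack_linear rhoL) rhoA rho1.

Lemma coact_mx (r : 'rV[k]_n) : coact comod_mx r = \sum_j r 0 j *: \sum_i e i ⊗v c i j.
Proof. by []. Qed.

End ComoduleOfComatrix.

(* U may be infinite-dimensional: this is applied to a subcomodule of a comodule
   and to H coacting on itself. *)
Lemma comatrix_of_family (U : lmodType k) (delta : U -> U ⊗ H) n (a : 'I_n -> U)
    (al : 'I_n -> U -> k^o) (c : 'I_n -> 'I_n -> H) : linear delta ->
  (forall v, \sweedler_(v0, h <- delta v) \sweedler_(w, a <- delta v0) (w ⊗v (a ⊗v h))
    = \sweedler_(v0, h <- delta v) (v0 ⊗v comul h)) ->
  (forall v, \sweedler_(v0, h <- delta v) (counit h *: v0) = v) ->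
  (forall i, linear (al i)) -> (forall i j, al i (a j) = (i == j)%:R) ->
  (forall j, delta (a j) = \sum_i a i ⊗v c i j) -> comatrix c.
Proof.
move=> Ld dA d1 La alE dE.
have b1 (h : H) : bilin (fun (w : U) (a : H) => w ⊗v (a ⊗v h)).
  by split=> ? b u w; rewrite ?tpureDZl ?tpureDZr.
have b2 : bilin (fun (v0 : U) (h : H) =>
    \sweedler_(w, a <- delta v0) (w ⊗v (a ⊗v h))).
  split=> [h|x]; first exact: (@linear_comp k _ _ _ _ _ (tlift_linear (b1 h)) Ld).
  by apply: linear_tlift => w b b' x' y; rewrite !tpureDZr.
have b3 : bilin (fun (v0 : U) (h : H) => v0 ⊗v comul h).
  exact: bilin_pre (@tpure_bilin k _ _) (@linear_id _ _) (@comul_linear k H).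
have b4 : bilin (fun (v : U) (h : H) => counit h *: v).
  exact: (bilin_rslice _ (@counit_linear k H)).
have slice (W : lmodType k) i (x : 'I_n -> W) :
    lslice (al i) (\sum_j a j ⊗v x j) = x i.
  rewrite (linear_sumE _ _ _ (lslice_linear (La i))) (bigD1 i) //=.
  rewrite lsliceE // alE eqxx scale1r big1 ?addr0 // => j ji.
  by rewrite lsliceE // alE eq_sym (negPf ji) scale0r.
split=> i j.
  have := dA (a j); rewrite dE (linear_sumE _ _ _ (tlift_linear b2)).
  rewrite (linear_sumE _ _ _ (tlift_linear b3)).
  under [X in _ = X -> _]eq_bigr do rewrite tliftE //.
  move/(congr1 (lslice (al i))); rewrite slice => <-.
  rewrite (linear_sumE _ _ _ (lslice_linear (La i))); apply: eq_bigr => l _.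
  rewrite tliftE // dE (linear_sumE _ _ _ (tlift_linear (b1 _))).
  by under eq_bigr do rewrite tliftE //; rewrite slice.
have /(congr1 (al i)) := d1 (a j).
rewrite dE (linear_sumE _ _ _ (tlift_linear b4)) (linear_sumE _ _ _ (La i)) alE => <-.
rewrite (bigD1 i) //= tliftE // (linear_ZE _ _ (La i)) alE eqxx.
rewrite [_ *: _]mulr1 big1 ?addr0 // => l li.
by rewrite tliftE // (linear_ZE _ _ (La i)) alE eq_sym (negPf li) [_ *: _]mulr0.
Qed.

(** Fundamental theorem of comodules. With [comul h] written as a shortest sum of a_i ⊗ b_i,
    applying the functional dual to b_j in the last factor of coassociativity shows that the a_i
    span a subcomodule of [H] with matrix [c]. It contains h = \sum ε(b_j) a_j, and h is the
    coefficient of h at the counit. *)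
Lemma coef_fundamental (h : H) : exists (V : comodule H) (f : V -> k^o) (v : V),
  linear f /\ h = coef f v.
Proof.
have LD := @comul_linear k H.
have [n [a [b [al [be [Lal Lbe alE beE hE]]]]]] := tensor_min (comul h).
pose c i j := rslice (be j) (comul (b i)).
have cE j : comul (a j) = \sum_i a i ⊗v c i j.
  pose G (x : H) (t : H ⊗ H) : H ⊗ H := x ⊗v rslice (be j) t.
  have bGG : bilin G.
    apply: bilin_pre (@tpure_bilin k _ _) (@linear_id _ _) _.
    exact: rslice_linear.
  have := comulA h; rewrite hE.
  have b1 (z : H) : bilin (fun (x y : H) => x ⊗v (y ⊗v z)).
    by split=> ? b' u w; rewrite ?tpureDZl ?tpureDZr.
  have b2 : bilin (fun (x z : H) =>
      \sweedler_(u, y <- comul x) (u ⊗v (y ⊗v z))).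
    split=> [z|x]; first exact: (@linear_comp k _ _ _ _ _ (tlift_linear (b1 z)) LD).
    by apply: linear_tlift => w b' b'' x' y; rewrite !tpureDZr.
  have b3 : bilin (fun (x z : H) => x ⊗v comul z).
    exact: bilin_pre (@tpure_bilin k _ _) (@linear_id _ _) LD.
  rewrite (linear_sumE _ _ _ (tlift_linear b2)) (linear_sumE _ _ _ (tlift_linear b3)).
  move/(congr1 (tlift G)).
  rewrite !(linear_sumE _ _ _ (tlift_linear bGG)) => E.
  transitivity (\sum_i tlift G (\sweedler_(x, z <- a i ⊗v b i)
      \sweedler_(u, y <- comul x) (u ⊗v (y ⊗v z)))); last first.
    by rewrite E; apply: eq_bigr => i _; rewrite !tliftE.
  have tE i : tlift G (\sweedler_(x, z <- a i ⊗v b i)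
      \sweedler_(u, y <- comul x) (u ⊗v (y ⊗v z))) = (be j (b i) : k) *: comul (a i).
    rewrite tliftE // (tlift_comp _ _ (tlift_linear bGG)) -[comul (a i) in RHS]tlift_pure.
    rewrite (tlift_comp _ _ (linear_scale _)); apply: eq_tlift => x y.
    by rewrite tliftE // /G rsliceE // tpureZr.
  rewrite (bigD1 j) //= tE beE eqxx scale1r big1 ?addr0 // => i ij.
  by rewrite tE beE eq_sym (negPf ij) scale0r.
have cP : comatrix c.
  exact: (comatrix_of_family LD (@comulA k H) (@counitr k H) Lal alE cE).
pose f (r : 'rV[k]_n) : k^o := \sum_i r 0 i * counit (a i).
have Lf : linear f.
  by apply: linear_sumf => i r x y; rewrite !mxE mulrDl -mulrA.
have fe i : f (delta_mx 0 i) = counit (a i).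
  rewrite /f (bigD1 i) //= mxE !eqxx mul1r big1 ?addr0 // => j ji.
  by rewrite mxE (negPf ji) mul0r.
have aE j : a j = \sum_i counit (a i) *: c i j.
  rewrite -{1}[a j]counitl cE.
  rewrite (linear_sumE _ _ _ (tlift_linear (bilin_lslice _ (@counit_linear k H)))).
  by apply: eq_bigr => i _; rewrite tliftE //; exact: bilin_lslice (@counit_linear k H).
exists (comod_mx cP), f, (\row_j counit (b j)); split=> //.
have := counitr h; rewrite hE => {1}<-.
rewrite (linear_sumE _ _ _ (tlift_linear (bilin_rslice _ (@counit_linear k H)))).
rewrite /coef coact_mx (linear_sumE _ _ _ (lslice_linear Lf)).
apply: eq_bigr => j _; rewrite tliftE; last exact: bilin_rslice (@counit_linear k H).
rewrite mxE (linear_ZE _ _ (lslice_linear Lf)); congr (_ *: _); rewrite {1}aE.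
rewrite (linear_sumE _ _ _ (lslice_linear Lf)); apply: eq_bigr => i _.
by rewrite lsliceE // fe.
Qed.

End Comatrix.

(** * Subcomodules and Schur's lemma *)

Section Subcomodules.
Variables (k : fieldType) (H : hopfAlgType k).
Implicit Types V W A B C X Y : comodule H.

(** Since [subcomodule] is only a property of a subspace, an actual comodule is built on coordinates
    in a basis of [K]; semisimplicity can then be applied to it. *)
Lemma subcomodule_embed V (K : {vspace V}) : subcomodule K ->
  exists (N : comodule H) (J : N -> V),
    [/\ comod_hom J, injective J & forall v, v \in K <-> exists x, v = J x].
Proof.
move=> sK; pose n := \dim K; pose a (i : 'I_n) := (vbasis K)`_i.
pose al (i : 'I_n) : V -> k^o := coord (vbasis K) i.
have Lal i : linear (al i) by move=> x u v; rewrite /al linearP.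
have alE i j : al i (a j) = (i == j)%:R.
  by rewrite /al /a coord_free ?(basis_free (vbasisP K)) // eq_sym.
have aK i : a i \in K by apply/vbasis_mem/mem_nth; rewrite size_tuple.
have KE v : v \in K -> v = \sum_i (al i v : k) *: a i by exact: coord_vbasis.
pose c i j := coef (al i) (a j).
have cE v : v \in K -> coact V v = \sum_i a i ⊗v coef (al i) v.
  move=> /sK [s [/allP sP vE]]; rewrite /coef vE.
  under [RHS]eq_bigr => i _ do rewrite (linear_sumE _ _ _ (lslice_linear (Lal i))) tpure_sumr.
  rewrite exchange_big big_seq [RHS]big_seq; apply: eq_bigr => p ps /=.
  rewrite {1}(KE _ (sP p ps)) tpure_suml; apply: eq_bigr => i _.
  by rewrite lsliceE // tpureZl tpureZr.
have cP : comatrix c.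
  apply: (comatrix_of_family (@coact_linear k H V) (@coactA k H V)
    (@coact_counit k H V) Lal alE) => j.
  exact: cE.
pose J (r : 'rV[k]_n) : V := \sum_i r 0 i *: a i.
have LJ : linear J.
  by apply: linear_sumf => i b x y; rewrite !mxE scalerDl scalerA.
have Je j : J (delta_mx 0 j) = a j.
  rewrite /J (bigD1 j) //= mxE !eqxx scale1r big1 ?addr0 // => l lj.
  by rewrite mxE (negPf lj) scale0r.
have JK r : J r \in K by apply: memv_suml => i _; apply: memvZ.
exists (comod_mx cP), J; split.
- split=> // r; rewrite cE // coact_mx.
  have b : bilin (fun (x : 'rV[k]_n) (h : H) => J x ⊗v h).
    exact: bilin_pre (@tpure_bilin k _ _) LJ (@linear_id _ _).
  rewrite (linear_sumE _ _ _ (tlift_linear b)).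
  transitivity (\sum_j \sum_i r 0 j *: (a i ⊗v c i j)).
    rewrite exchange_big; apply: eq_bigr => i _ /=.
    rewrite /J (linear_sumE _ _ _ (coef_linear (Lal i))) tpure_sumr.
    by apply: eq_bigr => j _; rewrite (linear_ZE _ _ (coef_linear (Lal i))) tpureZr.
  apply: eq_bigr => j _; rewrite (linear_ZE _ _ (tlift_linear b)) -scaler_sumr.
  congr (_ *: _); rewrite (linear_sumE _ _ _ (tlift_linear b)).
  by apply: eq_bigr => i _; rewrite tliftE // Je.
- apply: linear_inj => // r r0; apply/rowP => i; rewrite mxE.
  have := congr1 (al i) r0; rewrite (linear_0E (Lal i)) => <-.
  rewrite /J (linear_sumE _ _ _ (Lal i)) (bigD1 i) //= (linear_ZE _ _ (Lal i)).
  rewrite alE eqxx [_ *: _]mulr1 big1 ?addr0 // => l li.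
  by rewrite (linear_ZE _ _ (Lal i)) alE eq_sym (negPf li) [_ *: _]mulr0.
move=> v; split=> [vK|[x ->] //].
exists (\row_i al i v); rewrite {1}(KE v vK); apply: eq_bigr => i _.
by rewrite mxE.
Qed.

(** Take a shortest sum of a_i ⊗ h_i for the coaction of v. Slicing its vanishing image by the
    functionals dual to the h_i puts each a_i in the kernel. The target [U] is arbitrary so that
    [phi] may take values in [H]. *)
Lemma subcomodule_ker V (U : lmodType k) (phi : V -> U) (K : {vspace V}) :
  linear phi -> (forall v, v \in K <-> phi v = 0) ->
  (forall v, phi v = 0 -> tmap phi id (coact V v) = 0) -> subcomodule K.
Proof.
move=> Lphi KP phiP v /KP /phiP.
have [n [a [h [_ [om [_ Lom _ omE ->]]]]]] := tensor_min (coact V v).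
rewrite (linear_sumE _ _ _ (tmap_linear Lphi (@linear_id _ _))) => E.
have aK i : a i \in K.
  apply/KP; have := congr1 (rslice (om i)) E.
  rewrite (linear_0E (rslice_linear (Lom i))) => <-.
  rewrite (linear_sumE _ _ _ (rslice_linear (Lom i))) (bigD1 i) //=.
  rewrite tmapE // rsliceE // omE eqxx scale1r big1 ?addr0 // => j ji.
  by rewrite tmapE // rsliceE // omE eq_sym (negPf ji) scale0r.
exists [seq (a i, h i) | i <- enum 'I_n]; split.
  by apply/allP => p /mapP [i _ ->]; apply: aK.
by rewrite big_map big_enum.
Qed.

Lemma simple_hom_inj X Y (F : X -> Y) : simple_comodule X -> comod_hom F ->
  (exists v, F v <> 0) -> injective F.
Proof.
move=> [_ sX] [LF FP] [v Fv]; apply: linear_inj => // w Fw.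
have [|a x y Fx Fy|K KP] := @vspace_of_pred k X (fun v => F v = 0).
- exact: linear_0E.
- by rewrite LF Fx Fy scaler0 addr0.
have sK : subcomodule K.
  apply: (subcomodule_ker LF KP) => x Fx.
  by rewrite -[tmap _ _ _]FP Fx (linear_0E (@coact_linear k H Y)).
case: (sX K sK) => KE.
  by have /KP := Fw; rewrite KE memv0 => /eqP.
by case: Fv; apply/KP; rewrite KE memvf.
Qed.

Lemma simple_hom_surj X Y (F : X -> Y) : simple_comodule Y -> comod_hom F ->
  (exists v, F v <> 0) -> forall y, exists x, y = F x.
Proof.
move=> [_ sY] [LF FP] [v Fv].
have [|a x y [u ->] [w ->]|K KP] := @vspace_of_pred k Y (fun y => exists x, y = F x).
- by exists 0; rewrite (linear_0E LF).
- by exists (a *: u + w); rewrite LF.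
have sK : subcomodule K.
  move=> w /KP [x ->]; exists [seq (F p.1, p.2) | p <- repr (coact X x)]; split.
    by apply/allP => p /mapP [q _ ->]; apply/KP; exists q.1.
  by rewrite FP big_map.
case: (sY K sK) => KE; last by move=> y; apply/KP; rewrite KE memvf.
by case: Fv; apply/eqP; rewrite -memv0 -KE; apply/KP; exists v.
Qed.

Lemma simple_hom_iso X Y (F : X -> Y) : simple_comodule X -> simple_comodule Y ->
  comod_hom F -> (exists v, F v <> 0) ->
  exists G : Y -> X, [/\ comod_hom G, cancel F G & cancel G F].
Proof.
move=> sX sY hF F0; have inj := simple_hom_inj sX hF F0.
have surj := simple_hom_surj sY hF F0.
pose G y := sval (cid (surj y)).
have GK : cancel G F by move=> y; rewrite -(svalP (cid (surj y))).
have FK : cancel F G by move=> x; apply: inj; rewrite GK.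
by exists G; split=> //; apply: comod_hom_can hF FK GK.
Qed.

End Subcomodules.

(** * Retracts and semisimplicity *)

Section Retracts.
Variables (k : fieldType) (H : hopfAlgType k).
Implicit Types A B C S T V W X Y : comodule H.
Local Notation "A '⊠' B" := (comod_tensor A B) (at level 40, left associativity).
Local Notation "A '⊞' B" := (comod_sum A B) (at level 50, left associativity).
Local Notation I := (comod1 H).

(** A direct summand with no complement named; for simple [X] and cosemisimple [H] a complement is
    recovered in [retr_complement]. *)
Definition retr X V := exists (F : X -> V) (G : V -> X),
  [/\ comod_hom F, comod_hom G & cancel F G].

Lemma retr_iso X V : comod_iso X V -> retr X V.
Proof.
by case=> F hF [G FK GK]; exists F, G; split=> //; apply: comod_hom_can hF FK GK.
Qed.
Lemma retr_refl V : retr V V. Proof. exact/retr_iso/comod_iso_refl. Qed.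
Lemma retr_trans W V X : retr V W -> retr W X -> retr V X.
Proof.
move=> [F [G [hF hG FK]]] [F' [G' [hF' hG' FK']]].
exists (fun v => F' (F v)), (fun v => G (G' v)).
by split=> [||v]; [exact: hom_comp|exact: hom_comp|rewrite FK' FK].
Qed.
Lemma retr_tensor V W X Y : retr V X -> retr W Y -> retr (V ⊠ W) (X ⊠ Y).
Proof.
move=> [F [G [hF hG FK]]] [F' [G' [hF' hG' FK']]].
exists (tmap F F'), (tmap G G'); split; try exact: hom_tensor.
move=> t; rewrite tmap_comp; [|exact: hF.1|exact: hF'.1|exact: hG.1|exact: hG'.1].
by rewrite -[RHS]tmap_id; apply: eq_tmap.
Qed.

Lemma hom_inl V W : comod_hom ((fun v => (v, 0)) : V -> V ⊞ W).
Proof.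
split=> [a x y|v]; first by congr (_, _); rewrite /= scaler0 addr0.
rewrite coact_sumE /= linear0 [X in _ + X](linear_0E (tlift_linear _)) ?addr0 //.
apply: bilin_pre (@tpure_bilin k _ _) _ (@linear_id _ _) => a x y.
by congr (_, _); rewrite /= scaler0 addr0.
Qed.
Lemma hom_inr V W : comod_hom ((fun w => (0, w)) : W -> V ⊞ W).
Proof.
split=> [a x y|v]; first by congr (_, _); rewrite /= scaler0 addr0.
rewrite coact_sumE /= linear0 [X in X + _](linear_0E (tlift_linear _)) ?add0r //.
apply: bilin_pre (@tpure_bilin k _ _) _ (@linear_id _ _) => a x y.
by congr (_, _); rewrite /= scaler0 addr0.
Qed.

Lemma coef_sum V W (f : (V * W)%type -> k^o) (u : V ⊞ W) : linear f ->
  coef (f : V ⊞ W -> k^o) u =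
  coef (fun v : V => f (v, 0)) u.1 + coef (fun w : W => f (0, w)) u.2.
Proof.
move=> Lf; have {1}-> : u = ((u.1, 0) : V ⊞ W) + (0, u.2).
  by case: u => v w; congr (_, _); rewrite /= ?addr0 ?add0r.
rewrite (linear_DE _ _ (@coef_linear _ _ (V ⊞ W) _ Lf)).
by rewrite (hom_coef _ (hom_inl V W)) // (hom_coef _ (hom_inr V W)).
Qed.

Lemma hom_fst V W : comod_hom (fst : V ⊞ W -> V).
Proof.
apply: coef_hom => [//|f u Lf].
rewrite [RHS]coef_sum; last by move=> a x y; rewrite -Lf.
rewrite [X in _ + X](_ : _ = 0) ?addr0 //.
by rewrite /coef /lslice /tlift big1 // => p _ /=; rewrite (linear_0E Lf) scale0r.
Qed.
Lemma hom_snd V W : comod_hom (snd : V ⊞ W -> W).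
Proof.
apply: coef_hom => [//|f u Lf].
rewrite [RHS]coef_sum; last by move=> a x y; rewrite -Lf.
rewrite [X in X + _](_ : _ = 0) ?add0r //.
by rewrite /coef /lslice /tlift big1 // => p _ /=; rewrite (linear_0E Lf) scale0r.
Qed.
Lemma retr_suml V W : retr V (V ⊞ W).
Proof. by exists (fun v => (v, 0)), fst; split=> //; [exact: hom_inl|exact: hom_fst]. Qed.
Lemma retr_sumr V W : retr W (V ⊞ W).
Proof. by exists (fun v => (0, v)), snd; split=> //; [exact: hom_inr|exact: hom_snd]. Qed.

Lemma hom_pair V W X (F : X -> V) (G : X -> W) : comod_hom F -> comod_hom G ->
  comod_hom ((fun x => (F x, G x)) : X -> V ⊞ W).
Proof.
move=> hF hG; have L : linear (fun x => (F x, G x)).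
  by move=> a x y; congr (_, _); rewrite (hF.1, hG.1).
apply: coef_hom => // f v Lf; rewrite coef_sum //= hom_coef //; last first.
  exact: linear_comp Lf (hom_inl V W).1.
rewrite hom_coef //; last exact: linear_comp Lf (hom_inr V W).1.
have LF : linear (fun x => f (F x, 0)).
  exact: linear_comp (linear_comp Lf (hom_inl V W).1) hF.1.
have LG : linear (fun x => f (0, G x)).
  exact: linear_comp (linear_comp Lf (hom_inr V W).1) hG.1.
rewrite /coef /lslice /tlift -big_split; apply: eq_bigr => p _ /=.
rewrite -scalerDl -[X in X *: _](linear_DE _ _ Lf).
rewrite (_ : (F p.1, 0) + (0, G p.1) = (F p.1, G p.1)) //.
by congr (_, _); rewrite /= ?addr0 ?add0r.
Qed.

Lemma comod_sumC V W : comod_iso (V ⊞ W) (W ⊞ V).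
Proof.
apply: (@hom_iso _ _ (V ⊞ W) (W ⊞ V) (fun u => (u.2, u.1)) (fun u => (u.2, u.1))).
- exact: hom_pair (hom_snd V W) (hom_fst V W).
- by case.
- by case.
Qed.
Lemma comod_sumA V W X : comod_iso (V ⊞ (W ⊞ X)) ((V ⊞ W) ⊞ X).
Proof.
apply: (@hom_iso _ _ (V ⊞ (W ⊞ X)) ((V ⊞ W) ⊞ X)
  (fun u => ((u.1, u.2.1), u.2.2)) (fun u => (u.1.1, (u.1.2, u.2)))).
- have h := hom_snd V (W ⊞ X).
  apply: hom_pair; last exact: hom_comp (hom_snd W X) h.
  by apply: hom_pair; [exact: hom_fst|exact: hom_comp (hom_fst W X) h].
- by case=> v [].
- by case=> [[]].
Qed.
Lemma comod_sum0 V : comod_iso (V ⊞ comod0 H) V.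
Proof.
apply: (@hom_iso _ _ (V ⊞ comod0 H) V fst (fun v => (v, 0))) => //.
  exact: hom_fst.
by case=> v w; congr (_, _); rewrite [RHS]thinmx0.
Qed.

Lemma simple_neq0 S : simple_comodule S -> exists v : S, v <> 0.
Proof.
by case=> S0 _; exists (vpick {:S}); apply/eqP; rewrite vpick0.
Qed.

Lemma simple_iso X Y : comod_iso X Y -> simple_comodule X -> simple_comodule Y.
Proof.
move=> XY sX; have [F hF [G FK GK]] := XY; have hG := comod_hom_can hF FK GK.
split=> [|K sK].
  have [v v0] := simple_neq0 sX; apply/eqP => Y0; apply: v0.
  apply: (can_inj FK); rewrite (linear_0E hF.1); apply/eqP.
  by rewrite -memv0 -Y0 memvf.
have [|a x y Fx Fy|L LP] := @vspace_of_pred k X (fun v => F v \in K).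
- by rewrite (linear_0E hF.1) mem0v.
- by rewrite hF.1 memvD // memvZ.
have sL : subcomodule L.
  move=> w /LP /sK [s [/allP sP sE]]; exists [seq (G p.1, p.2) | p <- s]; split.
    by apply/allP => p /mapP [q qs ->]; apply/LP; rewrite /= GK; apply: sP.
  rewrite -{1}[w]FK hG.2 sE [LHS](linear_sumE _ _ _ (tmap_linear hG.1 (@linear_id _ _))).
  by rewrite big_map; apply: eq_bigr => p _; rewrite tmapE //; exact: hG.1.
case: (sX.2 L sL) => LE; [left|right]; apply/vspaceP => y.
  rewrite memv0; apply/idP/eqP => [|->]; last exact: mem0v.
  rewrite -[y]GK => /LP; rewrite LE memv0 => /eqP ->; exact: linear_0E hF.1.
by rewrite memvf -[y]GK; apply/LP; rewrite LE memvf.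
Qed.

Lemma simple_unit : simple_comodule I.
Proof.
have d1 : \dim {: I} = 1%N by rewrite dimvf.
split=> [|K _]; first by rewrite -dimv_eq0 d1.
have := dimvS (subvf K); rewrite d1; case E: (\dim K) => [|[|]] // _.
  by left; apply/eqP; rewrite -dimv_eq0 E.
by right; apply/eqP; rewrite eqEdim subvf E d1.
Qed.

Lemma retr_occ X V : simple_comodule X -> retr X V -> occ X V /\ occ V X.
Proof.
move=> /simple_neq0 [v v0] [F [G [hF hG FK]]]; split.
  by exists F => //; exists v => Fv; apply: v0; rewrite -[v]FK Fv (linear_0E hG.1).
by exists G => //; exists (F v); rewrite FK.
Qed.

Lemma retr_simple S T : simple_comodule S -> simple_comodule T -> retr S T ->
  comod_iso S T.
Proof.
move=> sS sT /(retr_occ sS) [[F hF F0] _].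
by have [G [hG FK GK]] := simple_hom_iso sS sT hF F0; apply: hom_iso hF FK GK.
Qed.

Lemma retr_sum_simple S V W : simple_comodule S -> retr S (V ⊞ W) ->
  occ S V \/ occ S W.
Proof.
move=> sS /(retr_occ sS) [[F hF [v Fv]] _].
case: (pselect ((F v).1 = 0)) => E1; last first.
  by left; exists (fun v => (F v).1); [exact: hom_comp (hom_fst V W) hF|exists v].
right; exists (fun v => (F v).2); first exact: hom_comp (hom_snd V W) hF.
exists v => E2; apply: Fv; rewrite [F v]surjective_pairing; congr (_, _).
  exact: E1.
exact: E2.
Qed.

Lemma occ_comod0 S : ~ occ S (comod0 H).
Proof. by case=> F hF [v []]; rewrite [LHS]thinmx0. Qed.

Lemma occ_isol X Y V : comod_iso X Y -> occ X V -> occ Y V.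
Proof.
case=> f hf [g fK gK] [F hF [v Fv]]; have hg := comod_hom_can hf fK gK.
by exists (fun y => F (g y)); [exact: hom_comp|exists (f v); rewrite fK].
Qed.
Lemma occ_isor X V W : comod_iso V W -> occ X V -> occ X W.
Proof.
case=> f hf [g fK gK] [F hF [v Fv]]; exists (fun y => f (F y)); first exact: hom_comp.
exists v => E; apply: Fv; apply: (can_inj fK); rewrite E.
exact/esym/linear_0E/hf.1.
Qed.
Lemma iso_unitr A : comod_iso (A ⊠ I) A.
Proof.
exact: hom_iso (hom_unitri A) (@tunitri_can _ _) (@tunitrK _ _).
Qed.
Lemma iso_unitl A : comod_iso (I ⊠ A) A.
Proof.
exact: hom_iso (hom_unitli A) (@tunitli_can _ _) (@tunitlK _ _).
Qed.
Lemma iso_assoc A B C : comod_iso ((A ⊠ B) ⊠ C) (A ⊠ (B ⊠ C)).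
Proof.
exact: hom_iso (@hom_assoc _ _ A B C) (@tassocK _ _ _ _) (@tassociK _ _ _ _).
Qed.

Lemma occ_pairing S V : occ S (comod_dual V) -> occ (S ⊠ V) I.
Proof.
case=> F hF [s Fs]; exists (fun t => evd (tmap F id t)).
  exact: hom_comp (hom_evd V) (hom_tensor hF (@hom_id _ _ V)).
apply: contrapT => E; apply: Fs; apply/lfunP => v; rewrite zero_lfunE.
apply: contrapT => Fsv; apply: E; exists (s ⊗v v).
by rewrite tmapE ?evdE //; exact: hF.1.
Qed.

End Retracts.

(** * Constituents and duals in the semisimple case *)

Section Semisimple.
Variables (k : fieldType) (H : hopfAlgType k) (cs : cosemisimple H).
Implicit Types A B C S T V W X Y : comodule H.
Local Notation "A '⊠' B" := (comod_tensor A B) (at level 40, left associativity).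
Local Notation "A '⊞' B" := (comod_sum A B) (at level 50, left associativity).
Local Notation I := (comod1 H).

Lemma semisimple_ind (Q : comodule H -> Prop) :
  (forall V W, comod_iso V W -> Q V -> Q W) -> Q (comod0 H) ->
  (forall S V, simple_comodule S -> Q V -> Q (S ⊞ V)) -> forall V, Q V.
Proof.
move=> Qiso Q0 QD V; have [n [S [sS /comod_iso_sym iV]]] := cs V.
apply: Qiso iV _; elim: n S sS => [|n IH] S sS; first by rewrite big_ord0.
by rewrite big_ord_recl; apply: QD => //; apply: IH => j.
Qed.

(* Read as an induction: the identity of V is a sum of idempotents that factor
   through simple comodules. *)
Lemma semisimple_split V (Z : (V -> V) -> Prop) :
  (forall S (F : S -> V) (G : V -> S), simple_comodule S -> comod_hom F ->
     comod_hom G -> cancel F G -> Z (fun v => F (G v))) ->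
  Z (fun _ => 0) -> (forall e e', Z e -> Z e' -> Z (fun v => e v + e' v)) -> Z id.
Proof.
move: V Z; apply: semisimple_ind => [V W [f hf [g fK gK]] IH Z Z1 Z0 ZD||S V sS IH Z Z1 Z0 ZD].
- have hg := comod_hom_can hf fK gK.
  have := IH (fun e => Z (fun w => f (e (g w)))).
  rewrite [X in _ -> _ -> _ -> Z X](_ : _ = id); last by apply/funext => w; exact: gK.
  apply=> [S F G sS hF hG FK||e e' Ze Ze'].
  + apply: (Z1 S (fun s => f (F s)) (fun w => G (g w))) => //; try exact: hom_comp.
    by move=> s; rewrite fK FK.
  + by rewrite (linear_0E hf.1).
  rewrite [X in Z X](_ : _ = fun w => f (e (g w)) + f (e' (g w))); first exact: ZD.
  by apply/funext => w; exact: linear_DE hf.1.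
- move=> Z _ Z0 _; rewrite [X in Z X](_ : _ = fun=> 0) //.
  by apply/funext => v; rewrite [LHS]thinmx0 [RHS]thinmx0.
have [hl hr h1 h2] := And4 (hom_inl S V) (hom_inr S V) (hom_fst S V) (hom_snd S V).
rewrite [X in Z X](_ : _ = fun u : S ⊞ V => ((u.1, 0) : S ⊞ V) + (0, u.2)).
  apply: (ZD); first exact: (Z1 S (fun s => (s, 0)) fst).
  apply: (IH (fun e => Z (fun u => (0, e u.2)))) => [T F G sT hF hG FK||e e' Ze Ze'] //.
    apply: (Z1 T (fun s => (0, F s)) (fun u => G u.2)) => //.
      exact: hom_comp hr hF.
    exact: hom_comp hG h2.
  rewrite [X in Z X](_ : _ = fun u => ((0, e u.2) : S ⊞ V) + (0, e' u.2)).
    exact: ZD.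
  by apply/funext => u; congr (_, _); rewrite /= addr0.
by apply/funext => -[s v]; congr (_, _); rewrite /= ?addr0 ?add0r.
Qed.

(** If [S] were not a retract, Schur's lemma would make [F] vanish on every simple summand of [V],
    hence on [V]. *)
Lemma occ_retrr S V : simple_comodule S -> occ V S -> retr S V.
Proof.
move=> sS [F hF [v Fv]]; apply: contrapT => nr; apply: Fv; move: v.
pose Z (e : V -> V) := forall v, F (e v) = 0.
apply: (@semisimple_split V Z) => [T f g sT hf hg fK v|v|e e' Ze Ze' v]; last 2 first.
- exact: linear_0E hF.1.
- by rewrite (linear_DE _ _ hF.1) Ze Ze' addr0.
apply: contrapT => FT; apply: nr.
have [|h [hh hK Kh]] := simple_hom_iso sT sS (hom_comp hF hf); first by exists (g v).
by exists (fun s => f (h s)), F; split=> //; exact: hom_comp.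
Qed.

Lemma occ_retrl S V : simple_comodule S -> occ S V -> retr S V.
Proof.
move=> sS [F hF [v Fv]]; apply: contrapT => nr; apply: Fv; move: v.
pose Z (e : V -> V) := forall s, e (F s) = 0.
apply: (@semisimple_split V Z) => [T f g sT hf hg fK v|v|e e' Ze Ze' v] //; last first.
  by rewrite Ze Ze' addr0.
apply: contrapT => FT; apply: nr.
have [|h [hh hK Kh]] := simple_hom_iso sS sT (hom_comp hg hF).
  by exists v => E; apply: FT; rewrite E (linear_0E hf.1).
by exists F, (fun w => h (g w)); split=> //; exact: hom_comp.
Qed.

Lemma simple_constituent V (v : V) : v <> 0 -> exists2 S, simple_comodule S & retr S V.
Proof.
move=> v0; apply: contrapT => nS; apply: v0; move: v.
pose Z (e : V -> V) := forall v, e v = 0.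
apply: (@semisimple_split V Z) => [T f g sT hf hg fK v|//|e e' Ze Ze' v]; last first.
  by rewrite Ze Ze' addr0.
by case: nS; exists T => //; exists f, g.
Qed.

(** The identity of [X] is a sum of idempotents through simple comodules, so a nonzero map from [S]
    to X ⊗ Y stays nonzero after projection to A ⊗ Y for one of these simples [A]. *)
Lemma retr_tensorl S X Y : simple_comodule S -> retr S (X ⊠ Y) ->
  exists A, [/\ simple_comodule A, retr A X & retr S (A ⊠ Y)].
Proof.
move=> sS /(retr_occ sS) [[F hF [v Fv]] _]; apply: contrapT => nA; apply: Fv.
move: v; pose Z (e : X -> X) := forall s, tmap e id (F s) = 0.
suff : Z id by move=> Z1 s; rewrite -[RHS](Z1 s) tmap_id.
apply: (@semisimple_split X Z) => [T f g sT hf hg fK s|s|e e' Ze Ze' s]; last 2 first.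
- exact: tmap0l.
- by rewrite tmapDl Ze Ze' addr0.
have hgF := hom_comp (hom_tensor hg (@hom_id _ _ Y)) hF.
have -> : tmap (fun v => f (g v)) id (F s) = tmap f id (tmap g id (F s)).
  by rewrite tmap_comp //; [exact: hg.1|exact: hf.1].
apply: contrapT => E; apply: nA; exists T; split=> //; first by exists f, g.
apply: occ_retrl => //; exists (fun s => tmap g id (F s)); first exact: hgF.
by exists s => E'; apply: E; rewrite E'; apply/linear_0E/tmap_linear => //; exact: hf.1.
Qed.

Lemma retr_tensorr S X Y : simple_comodule S -> retr S (X ⊠ Y) ->
  exists A, [/\ simple_comodule A, retr A Y & retr S (X ⊠ A)].
Proof.
move=> sS /(retr_occ sS) [[F hF [v Fv]] _]; apply: contrapT => nA; apply: Fv.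
move: v; pose Z (e : Y -> Y) := forall s, tmap id e (F s) = 0.
suff : Z id by move=> Z1 s; rewrite -[RHS](Z1 s) tmap_id.
apply: (@semisimple_split Y Z) => [T f g sT hf hg fK s|s|e e' Ze Ze' s]; last 2 first.
- by rewrite /tmap /tlift big1 // => p _; rewrite -(scale0r 0) tpureZr scale0r.
- rewrite -[RHS]addr0 -[X in _ = X + _](Ze s) -[X in _ = _ + X](Ze' s).
  rewrite -[X in _ = X + _]scale1r -tlift_fun; apply: eq_tlift => x y.
  by rewrite scale1r -{1}[e y]scale1r tpureDZr scale1r.
have hgF := hom_comp (hom_tensor (@hom_id _ _ X) hg) hF.
have -> : tmap id (fun v => f (g v)) (F s) = tmap id f (tmap id g (F s)).
  by rewrite tmap_comp //; [exact: hg.1|exact: hf.1].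
apply: contrapT => E; apply: nA; exists T; split=> //; first by exists f, g.
apply: occ_retrl => //; exists (fun s => tmap id g (F s)); first exact: hgF.
by exists s => E'; apply: E; rewrite E'; apply/linear_0E/tmap_linear => //; exact: hf.1.
Qed.

(** The complement comes from induction on the simple summands of [V] and not as a kernel: either
    [S] is isomorphic to the leading summand, or it splits off from the rest. *)
Lemma retr_complement S V : simple_comodule S -> retr S V ->
  exists Z, comod_iso V (S ⊞ Z).
Proof.
move=> sS /(retr_occ sS) [+ _]; move: V.
apply: semisimple_ind => [V W VW IH|/occ_comod0 //|T V sT IH].
  move=> /(occ_isor (comod_iso_sym VW)) /IH [Z iZ]; exists Z.
  exact: comod_iso_trans (comod_iso_sym VW) iZ.
move=> /(occ_retrl sS) /(retr_sum_simple sS) [].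
  move=> /(occ_retrl sS) /(retr_simple sS sT) ST; exists V.
  exact: comod_sum_iso (comod_iso_sym ST) (comod_iso_refl V).
move=> /IH [Z iZ]; exists (T ⊞ Z).
apply: comod_iso_trans (comod_sum_iso (comod_iso_refl T) iZ) _.
apply: comod_iso_trans (comod_sumA T S Z) _.
apply: comod_iso_trans (comod_sum_iso (comod_sumC T S) (comod_iso_refl Z)) _.
exact: comod_iso_sym (comod_sumA S T Z).
Qed.

Lemma retr_unit_dual V : simple_comodule V -> retr I (V ⊠ comod_dual V).
Proof.
move=> sV; apply: occ_retrl (@simple_unit k H) _; apply: occ_curry.
have [v v0] := simple_neq0 sV.
by exists (lslice id : I ⊠ V -> V); [exact: hom_unitli|exists (tunitl v); rewrite tunitlK].
Qed.
Lemma retr_dual_unit V : simple_comodule V -> retr I (comod_dual V ⊠ V).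
Proof.
move=> sV; apply: occ_retrr (@simple_unit k H) _; apply: occ_uncurry.
have [v v0] := simple_neq0 sV.
exists (@tunitr k V : V -> V ⊠ I); first exact: hom_unitr.
exists v => E; apply: v0; apply: (can_inj (@tunitrK k V)).
by rewrite E (linear_0E (@tunitr_linear k V)).
Qed.

Lemma retr_dim X V : retr X V -> (\dim {:X} <= \dim {:V})%N /\
  (\dim {:V} <= \dim {:X} -> comod_iso X V)%N.
Proof.
case=> F [G [hF hG FK]].
pose f := linfun (pack_linear hF.1); have fE : f =1 F by move=> x; rewrite lfunE.
have f0 : (fullv :&: lker f = 0)%VS.
  apply/eqP; rewrite -subv0; apply/subvP => x; rewrite memv_cap memvf memv_ker fE /=.
  by move=> /eqP Fx; rewrite memv0 -[x]FK Fx (linear_0E hG.1).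
have df := limg_dim_eq f0; split; first by rewrite -df dimvS ?subvf.
rewrite -df => le; apply: (hom_iso hF FK) => v.
have : v \in limg f.
  have /eqP -> : (limg f == fullv)%VS by rewrite eqEdim subvf; exact: le.
  exact: memvf.
by move=> /memv_imgP [x _ ->]; rewrite fE FK.
Qed.

Lemma dim_dual V : \dim {: comod_dual V} = \dim {:V}.
Proof. by rewrite !dimvf; exact: muln1. Qed.

(** Let [S] be a simple constituent of V^*. The pairing S ⊗ V -> I is nonzero, so I occurs in S ⊗ V,
    and uncurrying makes [V] a constituent of S^*. Thus dim V <= dim S^* = dim S <= dim V^* = dim V,
    and [S] is all of V^*. *)
Lemma simple_dual V : simple_comodule V -> simple_comodule (comod_dual V).
Proof.
move=> sV; have [v v0] := simple_neq0 sV.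
have [f [Lf fv]] := functional_neq0 v0.
have g0 : (linfun (pack_linear Lf) : comod_dual V) <> 0.
  by move/(congr1 (fun g : 'Hom(V, k^o) => g v)); rewrite lfunE zero_lfunE.
have [S sS SV] := simple_constituent g0.
have VS : retr V (comod_dual S).
  apply: occ_retrr => //; apply: (occ_isol (iso_unitr (comod_dual S))).
  apply: occ_uncurry; apply: (retr_occ (@simple_unit k H) _).1.
  apply: occ_retrr (@simple_unit k H) _; apply: occ_pairing.
  exact: (retr_occ sS SV).1.
apply: simple_iso sS; apply: (retr_dim SV).2.
by rewrite dim_dual; have := (retr_dim VS).1; rewrite dim_dual.
Qed.

(** The projection Z ⊗ X -> W is transposed to Z -> W ⊗ X^* and then to W^* ⊗ Z -> X^*, whose target
    is simple. *)
Lemma retr_frobenius W Z X : simple_comodule X -> simple_comodule W ->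
  retr W (Z ⊠ X) -> retr (comod_dual X) (comod_dual W ⊠ Z).
Proof.
move=> sX sW /(retr_occ sW) [_ WZX]; apply: occ_retrr (simple_dual sX) _.
exact/occ_uncurry/occ_curry.
Qed.

(** A nonzero S ⊗ X ⊗ Y -> I is curried over [Y] and then over [X]. Comparing constituents in this
    way avoids constructing an isomorphism between the two duals. *)
Lemma retr_dual_tensor S X Y : simple_comodule S -> retr S (comod_dual (X ⊠ Y)) ->
  retr S (comod_dual Y ⊠ comod_dual X).
Proof.
move=> sS /(retr_occ sS) [/occ_pairing SXY _].
apply: occ_retrl => //; apply: occ_curry; apply: (occ_isor (iso_unitl _)).
by apply: occ_curry; apply: occ_isol SXY; apply/comod_iso_sym/iso_assoc.
Qed.

Lemma retr_unit_of_dual Y : retr I Y -> retr I (comod_dual Y).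
Proof.
have sI := @simple_unit k H.
move=> /(retr_occ sI) [_ YI]; apply: occ_retrl => //.
apply: (occ_isor (iso_unitl _)); apply: occ_curry.
exact: occ_isol (comod_iso_sym (iso_unitl Y)) YI.
Qed.

End Semisimple.

(** * Fusion semiring *)

Section FusionRetracts.
Variables (k : fieldType) (H : hopfAlgType k).
Implicit Types (V W : comodule H) (x y z s t u w : fusion H).

Lemma fusion_ind (Q : fusion H -> Prop) : (forall V, Q (fclass V)) -> forall x, Q x.
Proof. by move=> QV x; rewrite -[x]freprK. Qed.

Definition fretr x y := retr (frepr x) (frepr y).

Lemma fretr_class V W : fretr (fclass V) (fclass W) <-> retr V W.
Proof.
have iso X := retr_iso (@frepr_class k H X).
have iso' X := retr_iso (comod_iso_sym (@frepr_class k H X)).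
split=> h; first exact: retr_trans (iso' _) (retr_trans h (iso _)).
exact: retr_trans (iso _) (retr_trans h (iso' _)).
Qed.

Lemma fsimple_class V : fsimple (fclass V) <-> simple_comodule V.
Proof.
split=> [[W sW /fclass_eq VW]|sV]; last by exists V.
exact: simple_iso (comod_iso_sym VW) sW.
Qed.

Lemma fretr_refl x : fretr x x. Proof. exact: retr_refl. Qed.
Lemma fretr_trans y x z : fretr x y -> fretr y z -> fretr x z.
Proof. exact: retr_trans. Qed.
Lemma fretr_mul x y x' y' : fretr x x' -> fretr y y' -> fretr (fmul x y) (fmul x' y').
Proof. by move=> xx yy; apply/fretr_class/retr_tensor. Qed.
Lemma fretr_mull z x y : fretr x y -> fretr (fmul z x) (fmul z y).
Proof. exact/fretr_mul/fretr_refl. Qed.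
Lemma fretr_mulr z x y : fretr x y -> fretr (fmul x z) (fmul y z).
Proof. by move=> h; apply: fretr_mul h (fretr_refl z). Qed.

Lemma fmulA x y z : fmul x (fmul y z) = fmul (fmul x y) z.
Proof.
elim/fusion_ind: x => X; elim/fusion_ind: y => Y; elim/fusion_ind: z => Z.
by rewrite !fmul_class; apply/fclass_eq/comod_iso_sym/iso_assoc.
Qed.
Lemma fmul1x x : fmul (fone H) x = x.
Proof. by elim/fusion_ind: x => X; rewrite fmul_class; apply/fclass_eq/iso_unitl. Qed.
Lemma fmulx1 x : fmul x (fone H) = x.
Proof. by elim/fusion_ind: x => X; rewrite fmul_class; apply/fclass_eq/iso_unitr. Qed.
Lemma faddx0 x : fadd x (fzero H) = x.
Proof. by elim/fusion_ind: x => X; rewrite fadd_class; apply/fclass_eq/comod_sum0. Qed.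
Lemma fsimple_one : fsimple (fone H).
Proof. exact/fsimple_class/simple_unit. Qed.

Lemma fle_retr x y : fle x y -> fretr x y.
Proof.
case=> z ->; elim/fusion_ind: x => X; elim/fusion_ind: z => Z.
by rewrite fadd_class; apply/fretr_class/retr_suml.
Qed.

Lemma fretr_big n (y : 'I_n -> fusion H) j :
  fretr (y j) (\big[@fadd k H/fzero H]_(i < n) y i).
Proof.
elim: n y j => [|n IH] y; first by case.
move=> j; rewrite big_ord_recl; case: (unliftP ord0 j) => [i|] ->; last first.
  by apply/fle_retr; eexists.
apply: fretr_trans (IH (fun i => y (lift ord0 i)) i) _.
move: (\big[_/_]_(i < n) _) (y ord0).
by elim/fusion_ind => X; elim/fusion_ind => Z; rewrite fadd_class; apply/fretr_class/retr_sumr.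
Qed.

Lemma fsimple_retr_eq s t : fsimple s -> fsimple t -> fretr s t -> s = t.
Proof.
elim/fusion_ind: s => S; elim/fusion_ind: t => T /fsimple_class sS /fsimple_class sT.
by move=> /fretr_class /(retr_simple sS sT) /fclass_eq.
Qed.

Inductive fword : fusion H -> Prop :=
| fword_one : fword (fone H)
| fword_mulr z w : fsimple z -> fword w -> fword (fmul z w).

Lemma fwordP w : fword w <-> exists (n : nat) (z : 'I_n -> fusion H),
  (forall j, fsimple (z j)) /\ w = \big[@fmul k H/fone H]_(j < n) z j.
Proof.
split=> [|[n [z [sz ->]]]].
  elim=> [|z w' sz _ [n [y [sy ->]]]].
    exists 0%N, (fun=> fone H); split; [by case|by rewrite big_ord0].
  exists n.+1, (fun j => if unlift ord0 j is Some i then y i else z); split=> [j|].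
    by case: unliftP.
  rewrite big_ord_recl unlift_none; congr fmul.
  by apply: eq_bigr => j _; rewrite liftK.
elim: n z sz => [|n IH] z sz; first by rewrite big_ord0; apply: fword_one.
by rewrite big_ord_recl; apply: fword_mulr => //; apply: IH.
Qed.

Lemma fword_mul v w : fword v -> fword w -> fword (fmul v w).
Proof.
elim=> [|z v' sz _ IH] fw; first by rewrite fmul1x.
by rewrite -fmulA; apply: fword_mulr => //; apply: IH.
Qed.
Lemma fword_simple s : fsimple s -> fword s.
Proof. by move=> fs; rewrite -[s]fmulx1; apply: fword_mulr => //; apply: fword_one. Qed.

(** The simples of the sub-semiring in (b) turn out to be the constituents of these products. *)
Inductive adjoint_word : fusion H -> Prop :=
| adjoint_word_one : adjoint_word (fone H)
| adjoint_word_mul z u : fsimple z -> adjoint_word u ->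
    adjoint_word (fmul (fmul z (fstar z)) u).

Lemma adjoint_wordM u v : adjoint_word u -> adjoint_word v -> adjoint_word (fmul u v).
Proof.
elim=> [|z u' sz _ IH] av; first by rewrite fmul1x.
by rewrite -fmulA; apply: adjoint_word_mul => //; apply: IH.
Qed.

End FusionRetracts.

(** * Constituents of products, adjoint words and linkage *)

Section FusionSemisimple.
Variables (k : fieldType) (H : hopfAlgType k) (cs : cosemisimple H).
Implicit Types (V W : comodule H) (x y z s t u w : fusion H).

Lemma fretr_fle s x : fsimple s -> fretr s x -> fle s x.
Proof.
elim/fusion_ind: s => S; elim/fusion_ind: x => X /fsimple_class sS /fretr_class SX.
have [Z iZ] := retr_complement cs sS SX.
by exists (fclass Z); rewrite fadd_class; apply/fclass_eq.
Qed.

Lemma fusion_decomp x : exists (n : nat) (y : 'I_n -> fusion H),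
  (forall j, fsimple (y j)) /\ x = \big[@fadd k H/fzero H]_(j < n) y j.
Proof.
elim/fusion_ind: x => X; have [n [S [sS /fclass_eq ->]]] := cs X.
exists n, (fun j => fclass (S j)); split=> [j|]; first exact/fsimple_class.
elim: n S {sS} => [|n IH] S; first by rewrite !big_ord0.
by rewrite !big_ord_recl -fadd_class IH.
Qed.

Lemma fretr_zero s : fsimple s -> ~ fretr s (fzero H).
Proof.
elim/fusion_ind: s => S /fsimple_class sS.
by move=> /fretr_class /(retr_occ sS) [/occ_comod0].
Qed.
Lemma fretr_add_simple s x y : fsimple s -> fretr s (fadd x y) ->
  fretr s x \/ fretr s y.
Proof.
elim/fusion_ind: s => S /fsimple_class sS.
elim/fusion_ind: x => X; elim/fusion_ind: y => Y; rewrite fadd_class.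
move=> /fretr_class /(retr_sum_simple sS) [h|h]; [left|right];
  exact/fretr_class/occ_retrl.
Qed.
Lemma fretr_sum_simple s n (y : 'I_n -> fusion H) : fsimple s ->
  (forall j, fsimple (y j)) -> fretr s (\big[@fadd k H/fzero H]_(j < n) y j) ->
  exists j, s = y j.
Proof.
move=> fs; elim: n y => [|n IH] y sy; first by rewrite big_ord0 => /fretr_zero.
rewrite big_ord_recl => /(fretr_add_simple fs) [h|h].
  by exists ord0; apply: fsimple_retr_eq.
by have [//|j ->] := IH _ _ h; exists (lift ord0 j).
Qed.

Lemma fretr_mul_simplel s x y : fsimple s -> fretr s (fmul x y) ->
  exists a, [/\ fsimple a, fretr a x & fretr s (fmul a y)].
Proof.
elim/fusion_ind: s => S; elim/fusion_ind: x => X; elim/fusion_ind: y => Y.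
rewrite fmul_class => /fsimple_class sS /fretr_class SXY.
have [A [sA AX SA]] := retr_tensorl cs sS SXY.
exists (fclass A); rewrite fmul_class.
by split; [exact/fsimple_class|exact/fretr_class|exact/fretr_class].
Qed.
Lemma fretr_mul_simpler s x y : fsimple s -> fretr s (fmul x y) ->
  exists a, [/\ fsimple a, fretr a y & fretr s (fmul x a)].
Proof.
elim/fusion_ind: s => S; elim/fusion_ind: x => X; elim/fusion_ind: y => Y.
rewrite fmul_class => /fsimple_class sS /fretr_class SXY.
have [A [sA AX SA]] := retr_tensorr cs sS SXY.
exists (fclass A); rewrite fmul_class.
by split; [exact/fsimple_class|exact/fretr_class|exact/fretr_class].
Qed.

Lemma fsimple_star s : fsimple s -> fsimple (fstar s).
Proof.
elim/fusion_ind: s => S /fsimple_class sS; rewrite fstar_class.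
exact/fsimple_class/simple_dual.
Qed.
Lemma fretr_one_mul_star s : fsimple s -> fretr (fone H) (fmul s (fstar s)).
Proof.
elim/fusion_ind: s => S /fsimple_class sS; rewrite fstar_class fmul_class.
exact/fretr_class/retr_unit_dual.
Qed.
Lemma fretr_one_star_mul s : fsimple s -> fretr (fone H) (fmul (fstar s) s).
Proof.
elim/fusion_ind: s => S /fsimple_class sS; rewrite fstar_class fmul_class.
exact/fretr_class/retr_dual_unit.
Qed.
Lemma fretr_frobenius w z x : fsimple x -> fsimple w -> fretr w (fmul z x) ->
  fretr (fstar x) (fmul (fstar w) z).
Proof.
elim/fusion_ind: w => W; elim/fusion_ind: z => Z; elim/fusion_ind: x => X.
rewrite !fstar_class !fmul_class => /fsimple_class sX /fsimple_class sW.
by move=> /fretr_class h; apply/fretr_class/retr_frobenius.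
Qed.
Lemma fretr_star_mul s x y : fsimple s -> fretr s (fstar (fmul x y)) ->
  fretr s (fmul (fstar y) (fstar x)).
Proof.
elim/fusion_ind: s => S; elim/fusion_ind: x => X; elim/fusion_ind: y => Y.
rewrite fmul_class !fstar_class fmul_class => /fsimple_class sS /fretr_class h.
exact/fretr_class/retr_dual_tensor.
Qed.
Lemma fretr_one_star y : fretr (fone H) y -> fretr (fone H) (fstar y).
Proof.
elim/fusion_ind: y => Y; rewrite fstar_class => /fretr_class h.
exact/fretr_class/retr_unit_of_dual.
Qed.

(** The product is nonzero because [x] occurs in x y y^*; this occurrence passes through some
    constituent of x y. *)
Lemma fsimple_mul x y : fsimple x -> fsimple y -> exists2 u, fsimple u & fretr u (fmul x y).
Proof.
move=> sx sy; have : fretr x (fmul (fmul x y) (fstar y)).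
  by rewrite -fmulA -{1}[x]fmulx1; apply/fretr_mull/fretr_one_mul_star.
by move=> /(fretr_mul_simplel sx) [u [su uxy _]]; exists u.
Qed.

(** The word [u'] depends on [s], and [s] is kept general in the induction on [u]: once one factor
    has been moved, the induction hypothesis is applied to another simple, a constituent [t'] of z
    u1. *)
Lemma adjoint_word_normal z u s : fsimple z -> adjoint_word u -> fsimple s ->
  fretr s (fmul z u) -> exists2 u', adjoint_word u' & fretr s (fmul u' z).
Proof.
move=> sz au; elim: au s => [|x u1 sx _ IH] s fs.
  by rewrite fmulx1 => h; exists (fone H); [exact: adjoint_word_one|rewrite fmul1x].
rewrite !fmulA => /(fretr_mul_simplel fs) [t [st tzxx stu]].
have [w [sw wzx twx]] := fretr_mul_simplel st tzxx.
have tww : fretr t (fmul (fmul w (fstar w)) z).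
  apply: fretr_trans twx _; rewrite -fmulA; apply: fretr_mull.
  exact: fretr_frobenius sx sw wzx.
have : fretr s (fmul (fmul w (fstar w)) (fmul z u1)).
  by apply: fretr_trans stu _; rewrite fmulA; apply: fretr_mulr.
move=> /(fretr_mul_simpler fs) [t' [st' /(IH _ st') [u' au' tu'] sww]].
exists (fmul (fmul w (fstar w)) u'); first exact: adjoint_word_mul.
by apply: fretr_trans sww _; rewrite -[X in fretr _ X]fmulA; apply: fretr_mull.
Qed.

(** For w = z w1 the constituents lie in z w1 w1^* z^*. By induction the middle is replaced by an
    adjoint word; moving that word to the left of [z] leaves z z^* as the last factor. *)
Lemma fretr_adjoint_word w s : fword w -> fsimple s -> fretr s (fmul w (fstar w)) ->
  exists2 u, adjoint_word u & fretr s u.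
Proof.
move=> fw; elim: fw s => [|z w1 sz _ IH] s fs.
  move=> h; exists (fone H); first exact: adjoint_word_one.
  apply: fretr_trans h _; rewrite fmul1x.
  (* The dual of the unit is simple and contains the unit, hence equals it. *)
  have E := fsimple_retr_eq (fsimple_one H) (fsimple_star (fsimple_one H))
    (fretr_one_star (fretr_refl _)).
  by rewrite -E; apply: fretr_refl.
move=> /(fretr_mul_simpler fs) [b [sb /(fretr_star_mul sb) bz sb']].
have : fretr s (fmul (fmul z (fmul w1 (fstar w1))) (fstar z)).
  apply: fretr_trans sb' _.
  by rewrite (fmulA z) -[X in fretr _ X]fmulA; apply: fretr_mull.
move=> /(fretr_mul_simplel fs) [a [sa azw saz]].
have [y [sy yww azy]] := fretr_mul_simpler sa azw.
have [u au yu] := IH _ sy yww.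
have azu : fretr a (fmul z u) by apply: fretr_trans azy _; apply: fretr_mull.
have [u' au' au'z] := adjoint_word_normal sz au sa azu.
exists (fmul u' (fmul (fmul z (fstar z)) (fone H))).
  by apply: adjoint_wordM => //; apply: adjoint_word_mul => //; apply: adjoint_word_one.
by apply: fretr_trans saz _; rewrite fmulx1 fmulA; apply: fretr_mulr.
Qed.

Definition linked x y := exists2 w, fword w & fretr x w /\ fretr y w.

Lemma linked_refl x : fsimple x -> linked x x.
Proof. by move=> sx; exists x; [exact: fword_simple|split; exact: fretr_refl]. Qed.
Lemma linked_sym x y : linked x y -> linked y x.
Proof. by case=> w fw [xw yw]; exists w. Qed.
(** The common product is w y^* v: as [y] lies in [v], the unit lies in y^* v, and [x] lies in [w];
    as [y] lies in [w], the unit lies in w y^*, and [z] lies in [v]. *)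
Lemma linked_trans y x z : fsimple y -> linked x y -> linked y z -> linked x z.
Proof.
move=> sy [w fw [xw yw]] [v fv [yv zv]].
exists (fmul w (fmul (fstar y) v)).
  by do 2?[apply: fword_mul => //]; apply/fword_simple/fsimple_star.
split.
  rewrite -{1}[x]fmulx1; apply: fretr_mul => //.
  by apply: fretr_trans (fretr_one_star_mul sy) _; apply: fretr_mull.
rewrite fmulA -{1}[z]fmul1x; apply: fretr_mul => //.
by apply: fretr_trans (fretr_one_mul_star sy) _; apply: fretr_mulr.
Qed.
Lemma linked_mul x x' y y' u u' : linked x x' -> linked y y' ->
  fretr u (fmul x y) -> fretr u' (fmul x' y') -> linked u u'.
Proof.
move=> [w fw [xw xw']] [v fv [yv yv']] uxy uxy'.
exists (fmul w v); first exact: fword_mul.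
split; first by apply: fretr_trans uxy _; apply: fretr_mul.
by apply: fretr_trans uxy' _; apply: fretr_mul.
Qed.

Lemma linked_one x : linked x (fone H) ->
  exists2 w, fword w & fretr x (fmul w (fstar w)).
Proof.
case=> w fw [xw /fretr_one_star ow]; exists w => //.
by rewrite -{1}[x]fmulx1; apply: fretr_mul.
Qed.

End FusionSemisimple.

(** * The chain group and its central map *)

Section ChainGroup.
Variables (k : fieldType) (H : hopfAlgType k) (cs : cosemisimple H).
Implicit Types (A B S T V W : comodule H) (x y z s t u w : fusion H).
Local Notation "A '⊠' B" := (comod_tensor A B) (at level 40, left associativity).
Local Notation "A '⊞' B" := (comod_sum A B) (at level 50, left associativity).

(** The difference of the two coefficients is a colinear map from A ⊞ B to [H], and (a, b) lies in
    its kernel [K]. A simple summand of [K] with nonzero projections to both [A] and [B] would be a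
    common constituent, so one of its projections vanishes. *)
Lemma coef_disjoint A B (al : A -> k^o) (be : B -> k^o) a b :
  (forall S, simple_comodule S -> retr S A -> retr S B -> False) ->
  linear al -> linear be -> coef al a = coef be b -> coef al a = 0.
Proof.
move=> dAB Lal Lbe ab.
pose f (u : (A * B)%type) : k^o := al u.1 - be u.2.
have Lf : linear f.
  by move=> c x y; rewrite /f /= Lal Lbe opprD scalerBr addrACA.
have fE (u : A ⊞ B) : coef (f : A ⊞ B -> k^o) u = coef al u.1 - coef be u.2.
  rewrite coef_sum //; congr (_ + _).
    by apply: eq_coef => v; rewrite /f /= (linear_0E Lbe) subr0.
  rewrite /coef /lslice /tlift -sumrN; apply: eq_bigr => p _.
  by rewrite /f /= (linear_0E Lal) sub0r scaleNr.
have Lcf := @coef_linear _ _ (A ⊞ B) f Lf.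
have [|c x y fx fy|K KP] := @vspace_of_pred k (A ⊞ B)
  (fun u : A ⊞ B => coef (f : A ⊞ B -> k^o) u = 0).
- exact: coef0.
- by rewrite Lcf fx fy scaler0 addr0.
have sK : subcomodule K.
  apply: (subcomodule_ker Lcf KP) => v fv.
  by rewrite -comul_coef // fv (linear_0E (@comul_linear k H)).
have [N [J [hJ _ JK]]] := subcomodule_embed sK.
have [x Jx] : exists x : N, (a, b) = J x.
  by apply/JK/KP; rewrite fE /= ab subrr.
have -> : a = (J x).1 by rewrite -Jx.
move: x {Jx}; pose Z (e : N -> N) := forall x : N, coef al (J (e x)).1 = 0.
have L1 := (hom_fst A B).1; have LJ := hJ.1.
apply: (@semisimple_split _ _ cs N Z) => [T F G sT hF hG FK x|x|e e' Ze Ze' x]; last 2 first.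
- by rewrite (linear_0E LJ) coef0.
- by rewrite (linear_DE _ _ LJ) (linear_DE _ _ (coef_linear Lal)) Ze Ze' addr0.
have hJF := hom_comp hJ hF.
case: (pselect (forall t : T, (J (F t)).1 = 0)) => [->|E1]; first exact: coef0.
(* If the second projection vanishes, membership in [K] says that the coefficient of the first is
   zero. *)
case: (pselect (forall t : T, (J (F t)).2 = 0)) => [E2|E2].
  have : J (F (G x)) \in K by apply/JK; exists (F (G x)).
  by move/KP; rewrite fE E2 coef0 // subr0.
case: (dAB T sT); apply: occ_retrl => //.
  exists (fun t : T => (J (F t)).1); first exact: hom_comp (hom_fst A B) hJF.
  by apply: contrapT => E; apply: E1 => t; apply: contrapT => Et; apply: E; exists t.
exists (fun t : T => (J (F t)).2); first exact: hom_comp (hom_snd A B) hJF.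
by apply: contrapT => E; apply: E2 => t; apply: contrapT => Et; apply: E; exists t.
Qed.

(* Comodules live in a universe too large for a groupType, so the class of x in
   the chain group is represented by a set of matrix coefficients. *)
Definition chain_class x (h : H) : Prop := exists V (f : V -> k^o) v,
  [/\ simple_comodule V, linked x (fclass V), linear f & h = coef f v].

(** To recover linkage from equal sets, take a coefficient of [X] with nonzero counit. It is also a
    coefficient of some simple [W] linked to [y]; by [coef_disjoint] the two share a constituent, so
    [X] and [W] are isomorphic. *)
Lemma chain_classP x y : fsimple x -> fsimple y ->
  chain_class x = chain_class y <-> linked x y.
Proof.
move=> sx sy; split=> [|xy]; last first.
  apply/funext => h; apply/propext; split=> -[V [f [v [sV xV Lf ->]]]];
    exists V, f, v; split=> //.
    exact: (linked_trans cs sx (linked_sym xy) xV).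
  exact: (linked_trans cs sy xy xV).
move: sx; elim/fusion_ind: x => X /fsimple_class sX E.
have [v v0] := simple_neq0 sX.
have [f [Lf fv]] := functional_neq0 v0.
have : chain_class (fclass X) (coef f v).
  by exists X, f, v; split=> //; apply/linked_refl/fsimple_class.
rewrite E => -[W [g [w [sW yW Lg fg]]]].
have [S [sS SX SW]] : exists S, [/\ simple_comodule S, retr S X & retr S W].
  apply: contrapT => nS; apply: fv; rewrite -counit_coef //.
  rewrite (coef_disjoint _ Lf Lg fg) ?(linear_0E (@counit_linear k H)) //.
  by move=> S sS SX SW; apply: nS; exists S.
have -> : fclass X = fclass W; last exact: linked_sym.
apply/fclass_eq; apply: comod_iso_trans (comod_iso_sym (retr_simple sS sX SX)) _.
exact: retr_simple.
Qed.

(** The group law is chosen by means of semisimplicity, so its proof is a parameter of the type,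
    from which the group structure is inferred. *)
Definition chain_group of cosemisimple H :=
  {classic {D : H -> Prop | exists x, fsimple x /\ D = chain_class x}}.
HB.instance Definition _ := Choice.on (chain_group cs).
Implicit Types g : chain_group cs.

Definition chain_of x (sx : fsimple x) : chain_group cs :=
  exist _ (chain_class x) (ex_intro _ x (conj sx erefl)).
Definition chain_repr g : fusion H := projT1 (cid (svalP g)).
Lemma chain_repr_simple g : fsimple (chain_repr g).
Proof. by rewrite /chain_repr; case: cid => x []. Qed.
Lemma chain_reprK g : chain_of (chain_repr_simple g) = g.
Proof. by case: g => D Dx; apply: eq_exist; rewrite /chain_repr; case: cid => x []. Qed.
Lemma chain_ofP x y (sx : fsimple x) (sy : fsimple y) :
  chain_of sx = chain_of sy <-> linked x y.
Proof.
split=> [/(congr1 sval) /(chain_classP sx sy) //|xy].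
exact/eq_exist/(chain_classP sx sy).
Qed.
Lemma chain_ind (Q : chain_group cs -> Prop) :
  (forall x (sx : fsimple x), Q (chain_of sx)) -> forall g, Q g.
Proof. by move=> Qx g; rewrite -[g]chain_reprK. Qed.

(** The class of an arbitrary constituent of the product of representatives; [chain_mulE] gives
    independence of all choices. *)
Definition chain_mul g g' : chain_group cs :=
  let u := cid2 (fsimple_mul cs (chain_repr_simple g) (chain_repr_simple g')) in
  chain_of (s2valP u).
Definition chain_one : chain_group cs := chain_of (fsimple_one H).
Definition chain_inv g : chain_group cs := chain_of (fsimple_star cs (chain_repr_simple g)).

Lemma chain_repr_of x (sx : fsimple x) : linked (chain_repr (chain_of sx)) x.
Proof. by apply/(chain_ofP (chain_repr_simple _) sx); rewrite chain_reprK. Qed.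

Lemma chain_mulE x y u (sx : fsimple x) (sy : fsimple y) (su : fsimple u) :
  fretr u (fmul x y) -> chain_mul (chain_of sx) (chain_of sy) = chain_of su.
Proof.
move=> uxy; apply/chain_ofP.
exact: linked_mul (chain_repr_of sx) (chain_repr_of sy)
  (s2valP' (cid2 (fsimple_mul cs _ _))) uxy.
Qed.

(** Both bracketings are represented by constituents of the single word x y z, hence by linked
    simples. *)
Fact chain_mulA : associative chain_mul.
Proof.
elim/chain_ind => x sx; elim/chain_ind => y sy; elim/chain_ind => z sz.
have [u su uxy] := fsimple_mul cs sx sy; have [v sv vyz] := fsimple_mul cs sy sz.
have [s ss suz] := fsimple_mul cs su sz; have [t st txv] := fsimple_mul cs sx sv.
rewrite (chain_mulE sy sz sv vyz) (chain_mulE sx sv st txv).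
rewrite (chain_mulE sx sy su uxy) (chain_mulE su sz ss suz); apply/chain_ofP.
exists (fmul x (fmul y z)).
  by apply: fword_mulr => //; apply: fword_mulr => //; apply: fword_simple.
split; first by apply: fretr_trans txv _; apply: fretr_mull.
by apply: fretr_trans suz _; rewrite fmulA; apply: fretr_mulr.
Qed.
Fact chain_mul1g : left_id chain_one chain_mul.
Proof.
elim/chain_ind => x sx; apply: chain_mulE; rewrite fmul1x; exact: fretr_refl.
Qed.
Fact chain_mulg1 : right_id chain_one chain_mul.
Proof.
elim/chain_ind => x sx; apply: chain_mulE; rewrite fmulx1; exact: fretr_refl.
Qed.
Fact chain_mulVg : left_inverse chain_one chain_inv chain_mul.
Proof.
move=> g; rewrite -{2}[g]chain_reprK; apply: chain_mulE.
exact/fretr_one_star_mul/chain_repr_simple.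
Qed.
Fact chain_mulgV : right_inverse chain_one chain_inv chain_mul.
Proof.
move=> g; rewrite -{1}[g]chain_reprK; apply: chain_mulE.
exact/fretr_one_mul_star/chain_repr_simple.
Qed.

End ChainGroup.

HB.instance Definition _ (k : fieldType) (H : hopfAlgType k) (cs : cosemisimple H) :=
  isGroup.Build (chain_group cs) (@chain_mulA k H cs) (@chain_mul1g k H cs)
    (@chain_mulg1 k H cs) (@chain_mulVg k H cs) (@chain_mulgV k H cs).

(** * The grading of [H] by the chain group *)

Section Grading.
Variables (k : fieldType) (H : hopfAlgType k) (cs : cosemisimple H).
Implicit Types (A B S T V W : comodule H) (g : chain_group cs).
Local Notation G := (chain_group cs).
Local Notation kG := (group_algebra k G).
Local Notation "A '⊠' B" := (comod_tensor A B) (at level 40, left associativity).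
Local Notation "A '⊞' B" := (comod_sum A B) (at level 50, left associativity).

(** The zero comodule is thereby homogeneous of every degree, which gives [graded_split] its
    starting point. *)
Definition homog V g := forall S (sS : fsimple (fclass S)), retr S V ->
  chain_of cs sS = g.

Lemma homog_simple S (sS : fsimple (fclass S)) : homog S (chain_of cs sS).
Proof.
move=> T sT TS; apply/chain_ofP.
have -> : fclass T = fclass S; last exact: linked_refl.
by apply/fclass_eq/retr_simple => //; apply/fsimple_class.
Qed.

Lemma homog_tensor V W g g' : homog V g -> homog W g' -> homog (V ⊠ W) (g * g')%g.
Proof.
move=> hV hW S sS /fretr_class; rewrite -fmul_class.
move=> /(fretr_mul_simplel cs sS) [a [sa aV]] /(fretr_mul_simpler cs sS) [b [sb bW]].
move: sa aV sb bW; elim/fusion_ind: a => A; elim/fusion_ind: b => B.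
move=> sA /fretr_class /(hV A sA) <- sB /fretr_class /(hW B sB) <- Sab.
by apply/esym/chain_mulE.
Qed.

Lemma homog_one : homog (comod1 H) 1%g.
Proof.
move=> S sS S1; apply/chain_ofP.
have -> : fclass S = fone H; last exact/linked_refl/fsimple_one.
apply/fclass_eq/retr_simple => //; [exact/fsimple_class|exact: simple_unit].
Qed.

(** The graph of h |-> \sum_g ε(h_g) g; the scalar [f v] is the counit of [coef f v]. It is a
    relation because independence of the expression of [h] as a sum of coefficients has yet to be
    proved. *)
Inductive graded : H -> kG -> Prop :=
| graded_zero : graded 0 0
| graded_add V g (f : V -> k^o) v h y : homog V g -> linear f -> graded h y ->
    graded (coef f v + h) ((f v : k) *: gelt k g + y).

Lemma graded_linear a h y h' y' : graded h y -> graded h' y' ->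
  graded (a *: h + h') (a *: y + y').
Proof.
move=> + r'; elim=> [|V g f v h0 y0 hV Lf _ IH]; first by rewrite !scaler0 !add0r.
rewrite !scalerDr -!addrA scalerA.
rewrite -(linear_ZE _ _ (coef_linear Lf)) -[a * f v](linear_ZE _ _ Lf).
exact: graded_add.
Qed.

Lemma graded_coef V g (f : V -> k^o) v : homog V g -> linear f ->
  graded (coef f v) ((f v : k) *: gelt k g).
Proof.
move=> hV Lf; rewrite -[coef f v]addr0 -[X in graded _ X]addr0.
by apply: graded_add => //; apply: graded_zero.
Qed.

Lemma graded_total h : exists y, graded h y.
Proof.
have [V [f [v [Lf ->]]]] := coef_fundamental h; move: v.
pose Z (e : V -> V) := forall v, exists y, graded (coef f (e v)) y.
apply: (@semisimple_split _ _ cs V Z) => [S F F' sS hF hF' FK v|v|e e' Ze Ze' v].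
- rewrite (hom_coef _ hF) //; eexists; apply: graded_coef.
    by apply: homog_simple; apply/fsimple_class.
  exact: linear_comp Lf hF.1.
- by rewrite coef0 //; exists 0; apply: graded_zero.
have [y ry] := Ze v; have [y' ry'] := Ze' v; exists (1 *: y + y').
rewrite (linear_DE _ _ (coef_linear Lf)) -[coef f (e v)]scale1r.
exact: graded_linear.
Qed.

Lemma coef_pair A B (al : A -> k^o) (be : B -> k^o) (a : A) (b : B) :
  linear al -> linear be -> let f (u : A ⊞ B) : k^o := al u.1 + be u.2 in
  linear f /\ coef f (a, b) = coef al a + coef be b.
Proof.
move=> Lal Lbe f; have L : linear f.
  by move=> c x y; rewrite /f /= Lal Lbe scalerDr addrACA.
split=> //; rewrite coef_sum //=; congr (_ + _); apply: eq_coef => x; rewrite /f /=.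
  by rewrite (linear_0E Lbe) addr0.
by rewrite (linear_0E Lal) add0r.
Qed.

(** The summands of class [g] are gathered into one coefficient of [A], all others into one of [B].
    Then [al a] is the counit of the component of degree [g], and [A] and [B] have no common
    constituent. *)
Lemma graded_split h y g : graded h y ->
  exists A B (al : A -> k^o) (be : B -> k^o) a b,
  [/\ linear al /\ linear be, homog A g,
      forall S (sS : fsimple (fclass S)), retr S B -> chain_of cs sS <> g,
      h = coef al a + coef be b & mcoeff g y = al a].
Proof.
have no0 S (sS : fsimple (fclass S)) : ~ retr S (comod0 H).
  by move=> /fretr_class; apply: fretr_zero.
have lz (V : comodule H) := @linear_zero k V k^o.
elim=> [|V g' f v h0 y0 hV Lf _ [A [B [al [be [a [b [[Lal Lbe] hA hB -> yE]]]]]]]].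
  exists (comod0 H), (comod0 H), (fun _ => 0), (fun _ => 0), 0, 0; split.
  - by split; exact: lz.
  - by move=> S sS /no0.
  - by move=> S sS /no0.
  - by rewrite !coef0 ?addr0 //; exact: lz.
  - by rewrite mcoeff0.
case: (eqVneq g' g) => [E|ne].
  have [L cE] := coef_pair v a Lf Lal.
  exists (V ⊞ A), B, (fun u => f u.1 + al u.2), be, (v, a), b; split=> //.
  - move=> S sS SVA; have /fsimple_class sS' := sS.
    have [h'|h'] := retr_sum_simple sS' SVA.
      by rewrite -E; apply: hV; apply: occ_retrl.
    by apply: hA; apply: occ_retrl.
  - by rewrite cE addrA.
  - by rewrite mcoeffD mcoeffZ mcoeffU yE E eqxx mulr1.
have [L cE] := coef_pair v b Lf Lbe.
exists A, (V ⊞ B), al, (fun u => f u.1 + be u.2), a, (v, b); split=> //.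
- move=> S sS SVB; have /fsimple_class sS' := sS.
  have [h'|h'] := retr_sum_simple sS' SVB; last by apply: hB; apply: occ_retrl.
  have -> : chain_of cs sS = g' by apply: hV; apply: occ_retrl.
  exact/eqP.
- by rewrite cE addrCA.
- by rewrite mcoeffD mcoeffZ mcoeffU yE (negPf ne) mulr0 add0r.
Qed.

(** The component of degree [g] is minus a coefficient of a comodule disjoint from [A], so by
    [coef_disjoint] it vanishes, and with it its counit, the coefficient of [y] at [g]. *)
Lemma graded_zero_uniq y : graded 0 y -> y = 0.
Proof.
move=> ry; apply/malgP => g; rewrite mcoeff0.
have [A [B [al [be [a [b [[Lal Lbe] hA hB E ->]]]]]]] := graded_split g ry.
have Lnbe : linear (fun x => - be x).
  by move=> c u v; rewrite Lbe opprD scalerN.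
rewrite -counit_coef // (@coef_disjoint _ _ cs A B al (fun x => - be x) a b) //.
- exact: (linear_0E (@counit_linear k H)).
- move=> S sS SA SB; have fS : fsimple (fclass S) by apply/fsimple_class.
  by case: (hB S fS SB); apply: hA.
apply/eqP; rewrite -subr_eq0 [X in _ - X](_ : _ = - coef be b).
  by rewrite opprK -E.
by rewrite /coef /lslice /tlift -sumrN; apply: eq_bigr => p _; rewrite scaleNr.
Qed.

End Grading.

Lemma gelt_inj (k : fieldType) (G : groupType) : injective (@gelt k G).
Proof.
move=> g g' /(congr1 (mcoeff g')); rewrite !mcoeffU eqxx.
by case: eqP => // _ /eqP; rewrite eq_sym oner_eq0.
Qed.

(** * The central map to the algebra of the chain group *)

Section ChainMap.
Variables (k : fieldType) (H : hopfAlgType k) (cs : cosemisimple H).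
Implicit Types (A B S T V W : comodule H) (g : chain_group cs).
Local Notation G := (chain_group cs).
Local Notation kG := (group_algebra k G).
Local Notation "A '⊠' B" := (comod_tensor A B) (at level 40, left associativity).

Lemma graded_uniq h (y y' : kG) : graded h y -> graded h y' -> y = y'.
Proof.
move=> r r'; have := graded_linear (-1) r r'; rewrite !scaleN1r addNr.
by move=> /graded_zero_uniq /eqP; rewrite addrC subr_eq0 => /eqP.
Qed.

Lemma graded_mul h (y : kG) h' (y' : kG) : graded h y -> graded h' y' ->
  graded (h * h') (y * y').
Proof.
have mulc V g (f : V -> k^o) v h0 y0 : homog V g -> linear f -> graded h0 y0 ->
    graded (coef f v * h0) (((f v : k) *: gelt k g) * y0).
  move=> hV Lf; elim=> [|W g' f' v' h1 y1 hW Lf' _ IH].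
    by rewrite !mulr0; apply: graded_zero.
  rewrite !mulrDr -scalerAl -scalerAr scalerA -geltM.
  rewrite -(coef_tensor_pure v v' Lf Lf').
  have bff : bilin (fun v w => (f v * f' w : k^o)).
    by apply: bilin_pre (@bilin_mul k k^o) Lf Lf'.
  have -> : f v * f' v' = tlift (fun v w => (f v * f' w : k^o)) (v ⊗v v').
    by rewrite tliftE.
  by apply: graded_add => //; [exact: homog_tensor|exact: tlift_linear].
move=> + r'; elim=> [|V g f v h0 y0 hV Lf _ IH]; first by rewrite !mul0r; apply: graded_zero.
rewrite !mulrDl -[coef f v * h']scale1r -[X in graded _ (X + _)]scale1r.
by apply: graded_linear => //; apply: mulc.
Qed.

Definition chain_map (h : H) : kG := projT1 (cid (graded_total cs h)).
Lemma chain_mapP h : graded h (chain_map h).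
Proof. by rewrite /chain_map; case: cid. Qed.
Lemma chain_map_uniq h y : graded h y -> chain_map h = y.
Proof. by move=> r; apply: graded_uniq r; apply: chain_mapP. Qed.
Lemma chain_map_coef V g (f : V -> k^o) v : homog V g -> linear f ->
  chain_map (coef f v) = (f v : k) *: gelt k g.
Proof. by move=> hV Lf; apply/chain_map_uniq/graded_coef. Qed.

Fact chain_map_linear : linear chain_map.
Proof. by move=> a x y; apply/chain_map_uniq/graded_linear; apply: chain_mapP. Qed.
Fact chain_map_monoid_morphism : monoid_morphism chain_map.
Proof.
split; last by move=> x y; apply/chain_map_uniq/graded_mul; apply: chain_mapP.
have Li : linear (id : k^o -> k^o) by [].
have := chain_map_coef (1 : comod1 H) (homog_one cs) Li.
by rewrite coef_unit // !scale1r.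
Qed.

Let q : {lrmorphism H -> kG} :=
  HB.pack chain_map (GRing.isLinear.Build _ _ _ _ chain_map chain_map_linear)
    (GRing.isMonoidMorphism.Build _ _ chain_map chain_map_monoid_morphism).

Lemma graded_ext (U : lmodType k) (f f' : H -> U) : linear f -> linear f' ->
  (forall V g (al : V -> k^o) v, homog V g -> linear al ->
    f (coef al v) = f' (coef al v)) -> f =1 f'.
Proof.
move=> Lf Lf' ff' h; elim: (chain_mapP h) => [|V g al v h0 y0 hV Lal _ IH].
  by rewrite (linear_0E Lf) (linear_0E Lf').
by rewrite (linear_DE _ _ Lf) (linear_DE _ _ Lf') IH (ff' _ _ _ _ hV Lal).
Qed.

Let Lq := chain_map_linear.
Let LD := @comul_linear k H.

(** All coefficients of a comodule homogeneous of degree g have degree g, so at [coef f v] both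
    sides are f(v) g ⊗ g. *)
Let q_comul h : comul (q h) = \sweedler_(h1, h2 <- comul h) (q h1 ⊗v q h2).
Proof.
have Lqq := tmap_linear Lq Lq.
move: h; apply: graded_ext => [||V g f v hV Lf].
- exact: linear_comp (@comul_linear k kG) Lq.
- exact: linear_comp Lqq LD.
rewrite /= (chain_map_coef v hV Lf) (linear_ZE _ _ (@comul_linear k kG)).
have -> : comul (gelt k g) = gelt k g ⊗v gelt k g by apply: galiftE.
rewrite -[RHS]/(tmap chain_map chain_map _) comul_coef_basis //.
rewrite (linear_sumE _ _ _ Lqq) -tpureZr -(chain_map_coef v hV Lf).
rewrite {1}[v]cbasisE (linear_sumE _ _ _ (coef_linear Lf)) (linear_sumE _ _ _ Lq).
rewrite tpure_sumr; apply: eq_bigr => i _; rewrite tmapE //.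
have Li := lfun_linear (@ccoord k H V i).
rewrite (linear_ZE _ _ (coef_linear Lf)) (linear_ZE _ _ Lq).
by rewrite !(chain_map_coef _ hV) // !tpureZr !tpureZl !scalerA mulrC.
Qed.

Let q_counit h : counit (q h) = counit h.
Proof.
move: h; apply: (@graded_ext k^o) => [||V g f v hV Lf].
- exact: linear_comp (@counit_linear k kG) Lq.
- exact: counit_linear.
rewrite /= (chain_map_coef v hV Lf) [LHS](linear_ZE _ _ (@counit_linear k kG)).
have -> : counit (gelt k g) = 1 by apply: (@galiftE k G k^o).
by rewrite counit_coef // [LHS]mulr1.
Qed.

Definition chain_hopf_map : hopf_map H kG := HopfMap q_comul q_counit.

(** For [V] homogeneous of degree g, both factors of the comultiplication of [coef f v] have degree
    g; applying the map to either one gives g ⊗ [coef f v]. *)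
Lemma chain_hopf_map_central : central chain_hopf_map.
Proof.
have b1 : bilin (fun h1 h2 : H => chain_map h1 ⊗v h2).
  exact: bilin_tmap Lq (@linear_id _ _).
have b2 : bilin (fun h1 h2 : H => chain_map h2 ⊗v h1).
  exact: bilin_swap (bilin_tmap Lq (@linear_id _ _)).
apply: graded_ext => [||V g f v hV Lf].
- exact: linear_comp (tlift_linear b1) LD.
- exact: linear_comp (tlift_linear b2) LD.
transitivity (gelt k g ⊗v coef f v).
  rewrite comul_coef // [LHS](tlift_comp _ _ (tlift_linear b1)).
  rewrite {2}/coef /lslice (tlift_comp _ _ ((@tpure_bilin k _ _).2 _)).
  apply: eq_tlift => w h; rewrite tliftE // (chain_map_coef _ hV) //.
  by rewrite tpureZl tpureZr.
rewrite comul_coef_basis // [RHS](linear_sumE _ _ _ (tlift_linear b2)).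
rewrite {1}[v]cbasisE (linear_sumE _ _ _ (coef_linear Lf)) tpure_sumr.
apply: eq_bigr => i _; rewrite tliftE // (chain_map_coef _ hV) ?tpureZl; last exact: lfun_linear.
by rewrite (linear_ZE _ _ (coef_linear Lf)) tpureZr.
Qed.

(** A coefficient with nonzero counit detects the class g of [S]: f(v) g = f(v) 1 forces g = 1. *)
Lemma chain_hopf_map_trivial S : simple_comodule S ->
  (forall (f : S -> k^o) v, linear f -> chain_hopf_map (coef f v) = (f v : k) *: 1) ->
  linked (fclass S) (fone H).
Proof.
move=> sS qS; have fS : fsimple (fclass S) by apply/fsimple_class.
have [v v0] := simple_neq0 sS.
have [f [Lf fv]] := functional_neq0 v0.
have := qS f v Lf; rewrite /= (chain_map_coef v (homog_simple cs fS) Lf).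
have fv0 : (f v : k) != 0 by apply/eqP.
by move=> /(scalerI fv0) /gelt_inj /chain_ofP.
Qed.

End ChainMap.

(** * Degrees along a central map *)

Section Degree.
Variables (k : fieldType) (H : hopfAlgType k) (G : groupType).
Variables (p : hopf_map H (group_algebra k G)) (cp : central p).
Implicit Types (V W S : comodule H) (g : G).
Local Notation kG := (group_algebra k G).
Local Notation "A '⊠' B" := (comod_tensor A B) (at level 40, left associativity).

(** Concentration in degree [g] of the coaction pushed along [p], phrased by coefficients because
    these are what has to be located in the Hopf kernel. *)
Definition degree V g := forall (f : V -> k^o) v, linear f ->
  p (coef f v) = (f v : k) *: gelt k g.

Let Lp : linear p. Proof. exact: linearP. Qed.
Let LD := @comul_linear k H.
Let Lc g : linear (mcoeff g : kG -> k^o). Proof. by move=> a x y; rewrite mcoeffD mcoeffZ. Qed.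
Let beta g (h : H) : k^o := mcoeff g (p h).
Let Lbeta g : linear (beta g). Proof. exact: linear_comp (Lc g) Lp. Qed.

(** The projection onto the component of degree [g] of the coaction induced by [p]. *)
Let comp g V (v : V) : V := rslice (beta g) (coact V v).

Let compE g V (f : V -> k^o) v : linear f -> f (comp g v) = beta g (coef f v).
Proof.
move=> Lf; rewrite /comp /rslice (tlift_comp _ _ Lf) /coef /lslice.
rewrite (tlift_comp _ _ (Lbeta g)); apply: eq_tlift => w h.
by rewrite (linear_ZE _ _ Lf) (linear_ZE _ _ (Lbeta g)); exact: mulrC.
Qed.

Let coef_comp g V (f : V -> k^o) v : linear f ->
  coef f (comp g v) = rslice (beta g) (comul (coef f v)).
Proof.
move=> Lf; rewrite comul_coef // /comp {1}/rslice (tlift_comp _ _ (coef_linear Lf)).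
rewrite /tmap (tlift_comp _ _ (rslice_linear (Lbeta g))).
by apply: eq_tlift => w h; rewrite rsliceE // (linear_ZE _ _ (coef_linear Lf)).
Qed.

Let comp_linear g V : linear (@comp g V).
Proof. exact: linear_comp (rslice_linear (Lbeta g)) (@coact_linear k H V). Qed.

(* Centrality of p makes the homogeneous components of v depend on v through
   comodule endomorphisms. *)
Let comp_hom g V : comod_hom (@comp g V).
Proof.
apply: coef_hom => [|f v Lf]; first exact: comp_linear.
have := congr1 (lslice (mcoeff g : kG -> k^o)) (cp (coef f v)).
rewrite !(tlift_comp _ _ (lslice_linear (Lc g))) => E.
rewrite coef_comp //; transitivity (lslice (beta g) (comul (coef f v))).
  transitivity (\sweedler_(h1, h2 <- comul (coef f v))
      lslice (mcoeff g : kG -> k^o) (p h2 ⊗v h1)).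
    by apply: eq_tlift => h1 h2; rewrite lsliceE.
  by rewrite -E; apply: eq_tlift => h1 h2; rewrite lsliceE.
rewrite comul_coef // /tmap (tlift_comp _ _ (lslice_linear (Lbeta g))).
by apply: eq_tlift => w h; rewrite lsliceE // compE.
Qed.

Let rslice_comul g (y : kG) :
  rslice (mcoeff g : kG -> k^o) (comul y) = mcoeff g y *: gelt k g.
Proof.
have Lr := rslice_linear (V := kG) (Lc g).
move: y; apply: group_algebra_ext => [||g'].
- exact: linear_comp Lr (@comul_linear k kG).
- exact: linear_scalel (Lc g).
have -> : comul (gelt k g') = gelt k g' ⊗v gelt k g' by apply: galiftE.
rewrite rsliceE // !mcoeffU.
by case: eqP => [->|] //; rewrite !scale0r.
Qed.

Let p_coef_comp g V (f : V -> k^o) v : linear f ->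
  p (coef f (comp g v)) = (f (comp g v) : k) *: gelt k g.
Proof.
move=> Lf; rewrite coef_comp // compE // -[beta g _]/(mcoeff g (p (coef f v))).
rewrite -rslice_comul hopf_comul (tlift_comp _ _ (rslice_linear (Lc g))).
rewrite /rslice (tlift_comp _ _ Lp); apply: eq_tlift => h1 h2.
by rewrite [RHS]rsliceE // (linear_ZE _ _ Lp).
Qed.

(** Not all components vanish, because the counit of p(coef f v) is f(v). A nonzero component
    projection is an endomorphism of a simple comodule, hence onto, so every vector has that
    degree. *)
Lemma simple_degree V : simple_comodule V -> exists g, degree V g.
Proof.
move=> sV; have [v v0] := simple_neq0 sV.
have [f [Lf fv]] := functional_neq0 v0.
have [g cg] : exists g, comp g v <> 0.
  apply: contrapT => ng; apply: fv; rewrite -counit_coef // -(hopf_counit p).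
  suff -> : p (coef f v) = 0 by apply: (linear_0E (@counit_linear k kG)).
  apply/malgP => g; rewrite mcoeff0; apply: contrapT => cg; apply: ng; exists g.
  by move=> E; apply: cg; rewrite -[LHS]/(beta g _) -compE // E (linear_0E Lf).
exists g => f' w Lf'.
have [|u ->] := simple_hom_surj sV (comp_hom g V) _ w; first by exists v.
exact: p_coef_comp.
Qed.

Lemma degree_retr V W g : retr V W -> degree W g -> degree V g.
Proof.
move=> [F [F' [hF hF' FK]]] dW f v Lf.
have -> : coef f v = coef (fun w => f (F' w)) (F v).
  rewrite hom_coef //; last exact: linear_comp Lf hF'.1.
  by apply: eq_coef => x; rewrite FK.
by rewrite dW ?FK //; exact: linear_comp Lf hF'.1.
Qed.

Lemma degree_one : degree (comod1 H) 1%g.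
Proof. by move=> f v Lf; rewrite coef_unit // (linear_ZE _ _ Lp) rmorph1 gelt1. Qed.

Lemma degree_tensor V W g g' : degree V g -> degree W g' -> degree (V ⊠ W) (g * g')%g.
Proof.
move=> dV dW f t Lf; move: t.
apply: (@tensor_ext k V W _ (fun t => p (coef (f : V ⊠ W -> k^o) t))
  (fun t => (f t : k) *: gelt k (g * g')%g)).
- exact: linear_comp Lp (@coef_linear _ _ (V ⊠ W) _ Lf).
- exact: linear_scalel Lf.
move=> v w; have Lfl w0 : linear (fun v : V => f (v ⊗v w0)).
  exact: linear_comp Lf ((@tpure_bilin k _ _).1 w0).
have Lfr : linear (fun w : W => f (v ⊗v w)).
  exact: linear_comp Lf ((@tpure_bilin k _ _).2 v).
rewrite coef_tensor // (tlift_comp _ _ Lp) geltM scalerAr -(dW _ w Lfr).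
rewrite {2}/coef /lslice (tlift_comp _ _ Lp) (tlift_comp _ _ (linear_mulr _)).
apply: eq_tlift => w0 b.
by rewrite rmorphM /= (dV _ v (Lfl w0)) (linear_ZE _ _ Lp) -scalerAl -scalerAr.
Qed.

Lemma dual_functional V (F : comod_dual V -> k^o) : linear F ->
  exists v : V, forall phi : comod_dual V, F phi = (phi : 'Hom(V, k^o)) v.
Proof.
move=> LF; exists (\sum_i F (@ccoord k H V i : comod_dual V) *: cbasis i) => phi.
rewrite (linear_sumE _ _ _ (lfun_linear phi)).
have {1}-> : phi = \sum_i (phi (cbasis i) : k) *: (@ccoord k H V i : 'Hom(V, k^o)).
  apply/lfunP => v; rewrite sum_lfunE {1}[v]cbasisE.
  rewrite (linear_sumE _ _ _ (lfun_linear phi)); apply: eq_bigr => i _.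
  by rewrite scale_lfunE (linear_ZE _ _ (lfun_linear phi)); exact: mulrC.
rewrite (linear_sumE _ _ _ LF); apply: eq_bigr => i _.
by rewrite (linear_ZE _ _ LF) (linear_ZE _ _ (lfun_linear phi)); exact: mulrC.
Qed.

(** Coefficients of the dual are antipodes of those of [V]. As [hopf_map] does not mention
    antipodes, [p] is applied to [antipodel]: this yields the image of the antipode times
    [gelt k g], and [gelt k g] is then cancelled. *)
Lemma degree_dual V g : degree V g -> degree (comod_dual V) g^-1%g.
Proof.
move=> dV F phi LF; have [v Fv] := dual_functional LF.
rewrite Fv (eq_coef phi Fv) coef_dual.
have Lphi := lfun_linear (phi : 'Hom(V, k^o)).
have LS := @antipode_linear k H.
have bS : bilin (fun a b : H => antipode a * b).
  exact: bilin_pre (@bilin_mul k H) LS (@linear_id _ _).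
suff E : p (antipode (coef (phi : 'Hom(V, k^o)) v)) * gelt k g =
    ((phi : 'Hom(V, k^o)) v : k) *: 1.
  rewrite -[LHS]mulr1 -gelt1 -(mulgV g) geltM mulrA E -scalerAl mul1r.
  by [].
have := congr1 p (antipodel (coef (phi : 'Hom(V, k^o)) v)).
rewrite counit_coef // (linear_ZE _ _ Lp) rmorph1 => <-.
rewrite comul_coef_basis // (linear_sumE _ _ _ (tlift_linear bS)) (linear_sumE _ _ _ Lp).
rewrite {1}[v]cbasisE (linear_sumE _ _ _ (coef_linear Lphi)) (linear_sumE _ _ _ LS).
rewrite (linear_sumE _ _ _ Lp) mulr_suml; apply: eq_bigr => i _.
rewrite tliftE // rmorphM /= dV; last exact: lfun_linear.
rewrite (linear_ZE _ _ (coef_linear Lphi)) (linear_ZE _ _ LS) (linear_ZE _ _ Lp).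
by rewrite -scalerAl -scalerAr.
Qed.

Lemma degree_one_kernel V (f : V -> k^o) v : degree V 1%g -> linear f ->
  hopf_kernel p (coef f v).
Proof.
move=> dV Lf; rewrite /hopf_kernel -[LHS]/(tmap p id _) comul_coef //.
rewrite tmap_comp //; last exact: coef_linear.
rewrite {2}/coef /lslice (tlift_comp _ _ ((@tpure_bilin k _ _).2 _)).
by apply: eq_tlift => w h; rewrite dV // gelt1 tpureZl tpureZr.
Qed.

(** Apply the counit to the second factor of the kernel identity. *)
Lemma hopf_kernel_trivial h : hopf_kernel p h -> p h = counit h *: 1.
Proof.
have Le := @counit_linear k H.
move=> /(congr1 (rslice (counit : H -> k^o))); rewrite [RHS]rsliceE // => <-.
rewrite (tlift_comp _ _ (rslice_linear Le)) -{1}[h]counitr (tlift_comp _ _ Lp).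
by apply: eq_tlift => h1 h2; rewrite rsliceE // (linear_ZE _ _ Lp).
Qed.

Definition fdegree (x : fusion H) g := degree (frepr x) g.

Lemma fdegree_class V g : degree V g -> fdegree (fclass V) g.
Proof. exact/degree_retr/retr_iso/frepr_class. Qed.

Lemma fword_degree w : fword w -> exists g, fdegree w g.
Proof.
elim=> [|z w' sz _ [g dg]]; first by exists 1%g; apply/fdegree_class/degree_one.
have [g' dg'] : exists g', fdegree z g'.
  by apply: simple_degree; apply/fsimple_class; rewrite freprK.
by exists (g' * g)%g; apply/fdegree_class/degree_tensor.
Qed.

Lemma fword_star_kernel w V (f : V -> k^o) v : fword w ->
  fretr (fclass V) (fmul w (fstar w)) -> linear f -> hopf_kernel p (coef f v).
Proof.
move=> /fword_degree [g dg] /fretr_class Vw Lf.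
apply: degree_one_kernel => //; apply: degree_retr Vw _.
rewrite -(mulgV g); apply: degree_tensor => //.
exact/fdegree_class/degree_dual.
Qed.

End Degree.

(** * Comodules over the cocenter *)

Section Push.
Variables (k : fieldType) (P H : hopfAlgType k) (i : hopf_map P H).
Implicit Types (V W : comodule P).
Let Li : linear i. Proof. exact: linearP. Qed.

Lemma coact_push_tmap V v : coact (comod_push i V) v = tmap id i (coact V v).
Proof. by []. Qed.

Lemma coef_push V (f : V -> k^o) v : linear f ->
  coef (f : comod_push i V -> k^o) v = i (coef f v).
Proof.
move=> Lf; rewrite /coef coact_push_tmap lslice_tmap //; exact: linear_id.
Qed.

Lemma push_sum V W :
  comod_iso (comod_push i (comod_sum V W)) (comod_sum (comod_push i V) (comod_push i W)).
Proof.
apply: (@hom_iso _ _ (comod_push i (comod_sum V W))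
  (comod_sum (comod_push i V) (comod_push i W)) id id) => //.
apply: coef_hom => // f v Lf; rewrite coef_push // coef_sum // coef_sum //.
rewrite (linear_DE _ _ Li) !coef_push //.
- exact: linear_comp Lf (hom_inr V W).1.
- exact: linear_comp Lf (hom_inl V W).1.
Qed.

Lemma push_tensor V W :
  comod_iso (comod_push i (comod_tensor V W)) (comod_tensor (comod_push i V) (comod_push i W)).
Proof.
apply: (@hom_iso _ _ (comod_push i (comod_tensor V W))
  (comod_tensor (comod_push i V) (comod_push i W)) id id) => //.
apply: coef_hom => // f t Lf; rewrite [RHS]coef_push //; move: t.
apply: (@tensor_ext k V W H) => [||v w].
- exact: (@coef_linear _ _ (comod_tensor (comod_push i V) (comod_push i W))).
- exact: linear_comp Li (@coef_linear _ _ (comod_tensor V W) _ Lf).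
rewrite [LHS](@coef_tensor _ _ (comod_push i V) (comod_push i W)) //.
rewrite [in RHS]coef_tensor // (tlift_comp _ _ Li).
have Lfl w0 : linear (fun v : V => f (v ⊗v w0)).
  exact: linear_comp Lf ((@tpure_bilin k _ _).1 w0).
have b : bilin (fun (w0 : W) (b : H) =>
    coef ((fun v => f (v ⊗v w0)) : comod_push i V -> k^o) v * b).
  split=> [b|w0]; last exact: linear_mulr.
  apply: linear_comp (linear_mull b) _; apply: coef_linearl => x.
  exact: linear_comp Lf ((@tpure_bilin k V W).2 x).
rewrite coact_push_tmap [LHS](tlift_comp _ _ (tlift_linear b)).
apply: eq_tlift => w0 h; rewrite tliftE // coef_push // rmorphM.
by [].
Qed.

Lemma push_one : comod_iso (comod_push i (comod1 P)) (comod1 H).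
Proof.
apply: (@hom_iso _ _ (comod_push i (comod1 P)) (comod1 H) id id) => //.
apply: coef_hom => // f v Lf; rewrite coef_push // !coef_unit //.
by rewrite (linear_ZE _ _ Li) rmorph1.
Qed.

Lemma push_zero : comod_iso (comod_push i (comod0 P)) (comod0 H).
Proof.
apply: (@hom_iso _ _ (comod_push i (comod0 P)) (comod0 H) id id) => //.
apply: coef_hom => // f v Lf; rewrite coef_push // [v]thinmx0 !coef0 //.
by rewrite (linear_0E Li).
Qed.

(** A linear retraction [r] of [i] carries the coefficient matrix of [W] back to [P]. The
    comultiplication identity must be pulled back through i ⊗ i, which r ⊗ r inverts on the left. *)
Lemma push_lift (W : comodule H) : injective i ->
  (forall (f : W -> k^o) v, linear f -> exists x, i x = coef f v) ->
  exists V, comod_iso (comod_push i V) W.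
Proof.
move=> inj_i Wi; have [r [Lr iK]] := linear_retraction Li inj_i.
have irK (f : W -> k^o) v : linear f -> i (r (coef f v)) = coef f v.
  by move=> /(Wi _ v) [x <-]; rewrite iK.
pose n := \dim {:W}; pose e := @cbasis k H W; pose e' := @ccoord k H W.
have Le' j : linear (e' j) := lfun_linear (e' j).
have e'E j l : e' j (e l) = (j == l)%:R.
  by rewrite lfunE /= coord_free ?(basis_free (vbasisP _)) // eq_sym.
pose c a b := r (coef (e' a) (e b)).
have ic a b : i (c a b) = coef (e' a) (e b) by apply: irK.
have cP : comatrix c.
  have [HD He] : comatrix (fun a b => coef (e' a) (e b)).
    apply: (comatrix_of_family (@coact_linear k H W) (@coactA k H W)
      (@coact_counit k H W) Le' e'E) => j.
    exact: coact_basis.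
  split=> a b; last by rewrite -(hopf_counit i) ic.
  have := HD a b; rewrite -ic hopf_comul => /(congr1 (tmap r r)).
  rewrite tmap_comp // (linear_sumE _ _ _ (tmap_linear Lr Lr)).
  have -> : tmap (fun v => r (i v)) (fun w => r (i w)) (comul (c a b)) = comul (c a b).
    by rewrite -[RHS]tmap_id; apply: eq_tmap.
  by move=> ->; apply: eq_bigr => l _; rewrite tmapE.
pose J (s : 'rV[k]_n) : W := \sum_j s 0 j *: e j.
have LJ : linear J.
  by apply: linear_sumf => j a x y; rewrite !mxE scalerDl scalerA.
have Je j : J (delta_mx 0 j) = e j.
  rewrite /J (bigD1 j) //= mxE !eqxx scale1r big1 ?addr0 // => l lj.
  by rewrite mxE (negPf lj) scale0r.
exists (comod_mx cP).
apply: (@hom_iso _ _ (comod_push i (comod_mx cP)) W J (fun w => \row_j e' j w)).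
- split=> // s; rewrite coact_push_tmap coact_mx.
  rewrite -[RHS]/(tmap J id _) tmap_comp //.
  have Lt := tmap_linear LJ Li.
  rewrite (linear_sumE _ _ _ Lt) (linear_sumE _ _ _ (@coact_linear k H W)).
  apply: eq_bigr => j _; rewrite (linear_ZE _ _ (@coact_linear k H W)) (linear_ZE _ _ Lt).
  congr (_ *: _); rewrite coact_basis (linear_sumE _ _ _ Lt).
  by apply: eq_bigr => l _; rewrite tmapE // Je ic.
- move=> s; apply/rowP => j; rewrite mxE (linear_sumE _ _ _ (Le' j)) (bigD1 j) //=.
  rewrite (linear_ZE _ _ (Le' j)) e'E eqxx [_ *: _]mulr1 big1 ?addr0 // => l lj.
  by rewrite (linear_ZE _ _ (Le' j)) e'E eq_sym (negPf lj) [_ *: _]mulr0.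
- move=> w; rewrite [RHS]cbasisE; apply: eq_bigr => j _.
  by rewrite mxE.
Qed.

End Push.

(** * The fusion semiring of the cocenter *)

Section Cocenter.
Variables (k : fieldType) (H P : hopfAlgType k) (i : hopf_map P H).
Hypotheses (cs : cosemisimple H) (cocenterP : is_cocenter i).
Implicit Types (x y s : fusion H).

Definition adjoint_simple s := fsimple s /\
  exists (n : nat) (z : 'I_n -> fusion H), (forall j, fsimple (z j)) /\
    let p := \big[@fmul k H/fone H]_(j < n) z j in fle s (fmul p (fstar p)).

Lemma adjoint_simpleP s : adjoint_simple s <->
  fsimple s /\ exists2 w, fword w & fretr s (fmul w (fstar w)).
Proof.
split=> -[fs].
  move=> [n [z [sz /fle_retr zs]]]; split=> //; eexists; last exact: zs.
  by apply/fwordP; exists n, z.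
move=> [w /fwordP [n [z [sz wE]]] sw]; split=> //; exists n, z; split=> //=.
by rewrite -wE; apply: fretr_fle.
Qed.

Lemma fimage_class W : (exists V, comod_iso (comod_push i V) W) -> fimage i (fclass W).
Proof. by case=> V VW; exists (fclass V); rewrite fpush_class; apply/esym/fclass_eq. Qed.

Lemma fimage_ind (Q : fusion H -> Prop) :
  (forall V, Q (fclass (comod_push i V))) -> forall x, fimage i x -> Q x.
Proof. by move=> QV x [y ->]; apply: QV. Qed.

Lemma fimage_zero : fimage i (fzero H).
Proof. by apply: fimage_class; exists (comod0 P); apply: push_zero. Qed.
Lemma fimage_one : fimage i (fone H).
Proof. by apply: fimage_class; exists (comod1 P); apply: push_one. Qed.
Lemma fimage_add x y : fimage i x -> fimage i y -> fimage i (fadd x y).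
Proof.
move=> ix; move: x ix y; apply: fimage_ind => V y; move: y; apply: fimage_ind => W.
by rewrite fadd_class; apply: fimage_class; exists (comod_sum V W); apply: push_sum.
Qed.
Lemma fimage_mul x y : fimage i x -> fimage i y -> fimage i (fmul x y).
Proof.
move=> ix; move: x ix y; apply: fimage_ind => V y; move: y; apply: fimage_ind => W.
by rewrite fmul_class; apply: fimage_class; exists (comod_tensor V W); apply: push_tensor.
Qed.

Lemma adjoint_simple_fimage s : adjoint_simple s -> fimage i s.
Proof.
case: cocenterP => inj_i [G [p [[cp _] kerp]]] /adjoint_simpleP [fs [w fw]].
elim/fusion_ind: s fs => S _ Sw; apply/fimage_class/push_lift => // f v Lf.
by apply/kerp; apply: fword_star_kernel Sw Lf.
Qed.

(** The coefficients of [s] come from [P], so [p] takes each to its counit times 1; composing with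
    [F] shows the same for the chain map, whence [s] is linked to the unit. *)
Lemma fimage_adjoint_simple x s : fimage i x -> fsimple s -> fretr s x ->
  adjoint_simple s.
Proof.
case: cocenterP => _ [G [p [[_ init] kerp]]] ix fs sx.
apply/adjoint_simpleP; split=> //; apply: (linked_one cs).
have [F [FE _]] := init _ _ (chain_hopf_map_central cs).
move: x ix sx; apply: fimage_ind => V.
elim/fusion_ind: s fs => S /fsimple_class sS /fretr_class [iota [pi [hiota hpi piK]]].
apply: (chain_hopf_map_trivial (cs := cs)) => // f v Lf.
have Lfpi : linear (fun u => f (pi u)) by exact: linear_comp Lf hpi.1.
have -> : coef f v = coef (fun u => f (pi u)) (iota v).
  by rewrite hom_coef //; apply: eq_coef => u; rewrite piK.
rewrite -FE (@hopf_kernel_trivial k H G p); last first.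
  by apply/kerp; rewrite coef_push //; eexists.
by rewrite counit_coef // piK linearZ rmorph1.
Qed.

Lemma fimage_span x : fimage i x <-> fspan adjoint_simple x.
Proof.
split=> [ix|[n [y [ay ->]]]].
  have [n [y [sy xE]]] := fusion_decomp cs x; exists n, y; split=> // j.
  apply: fimage_adjoint_simple ix (sy j) _; rewrite xE; exact: fretr_big.
elim: n y ay => [|n IH] y ay; first by rewrite big_ord0; apply: fimage_zero.
rewrite big_ord_recl; apply: fimage_add; first exact: adjoint_simple_fimage.
by apply: IH => j.
Qed.

Lemma fimage_based : based_subsemiring (fimage i).
Proof.
split; first by split; [exact: fimage_zero|exact: fimage_one].
- exact: fimage_add.
- exact: fimage_mul.
by exists adjoint_simple => [x []|x] //; apply: fimage_span.
Qed.

(** A simple constituent of a sum of simples is one of them, so [T] contains all constituents of its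
    elements. Membership can therefore be tested on simples, where retracts replace the order. *)
Lemma based_constituents (T : fusion H -> Prop) x : based_subsemiring T ->
  T x <-> (forall s, fsimple s -> fretr s x -> T s).
Proof.
case=> [[T0 _] TD _ [S sS TE]]; split=> [/TE [n [y [Sy ->]]] s fs sy|Tx].
  have [j ->] := fretr_sum_simple cs fs (fun j => sS _ (Sy j)) sy.
  apply/TE; exists 1%N, (fun _ => y j); split=> //.
  by rewrite big_ord_recl big_ord0 faddx0.
have [n [y [sy xE]]] := fusion_decomp cs x.
have {Tx} : forall j, T (y j).
  by move=> j; apply: Tx => //; rewrite xE; apply: fretr_big.
rewrite xE; elim: n y {sy xE} => [|n IH] y Ty; first by rewrite big_ord0.
by rewrite big_ord_recl; apply: TD => //; apply: IH => j.
Qed.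

Lemma fimage_generated x : fimage i x <->
  fgenerated (fun y => fsimple y /\
    exists z : fusion H, fsimple z /\ fle y (fmul z (fstar z))) x.
Proof.
split=> [ix T bT TS|gx].
  have [[_ T1] _ TM _] := bT.
  (* Each z z^* lies in [T], being a sum of constituents that are all generators. *)
  have Tadj u : adjoint_word u -> T u.
    elim=> [//|z u' sz _ Tu']; apply: TM => //.
    apply/(based_constituents _ bT) => s fs szz; apply: TS; split=> //.
    by exists z; split=> //; apply: fretr_fle.
  apply/(based_constituents _ bT) => s fs sx.
  have /adjoint_simpleP [_ [w fw sw]] := fimage_adjoint_simple ix fs sx.
  have [u au su] := fretr_adjoint_word cs fw fs sw.
  exact: ((based_constituents _ bT).1 (Tadj u au) s fs su).
(* By (a) the image is itself a based sub-semiring, so it suffices that it contains the generators;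
   these are the case of a word of one letter. *)
apply: (gx _ fimage_based) => y [fy [z [fz yzz]]].
apply/adjoint_simple_fimage/adjoint_simpleP; split=> //.
exists z; first exact: fword_simple.
exact: fle_retr.
Qed.

End Cocenter.

Theorem proposition2p13 (k : closedFieldType) (H P : hopfAlgType k)
    (i : hopf_map P H) (cosemisimpleH : cosemisimple H)
    (cocenterP : is_cocenter i) :
  [/\ based_subsemiring (fimage i),
      (forall x : fusion H, fimage i x <->
         fspan (fun y => fsimple y /\
           exists (n : nat) (z : 'I_n -> fusion H),
             (forall j, fsimple (z j)) /\
             let p := \big[@fmul k H/fone H]_(j < n) z j in
             fle y (fmul p (fstar p))) x)
    & (forall x : fusion H, fimage i x <->
         fgenerated (fun y => fsimple y /\
           exists z : fusion H, fsimple z /\ fle y (fmul z (fstar z))) x)].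
Proof.
split; first exact: fimage_based cosemisimpleH cocenterP.
- exact: (fimage_span cosemisimpleH cocenterP).
- exact: (fimage_generated cosemisimpleH cocenterP).
Qed.
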